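(* Let $\gamma_1,\gamma_2,\gamma_3,\delta_1,\delta_2,\delta_3,\delta_4\in\mathbb{C}$, let $\alpha_1,\dots,\alpha_4,\beta_1,\dots,\beta_4$ be positive real numbers, and let $\operatorname{Re}p>0$, $\operatorname{Re}q>0$. Then $$L_2\left\{x^{\delta_1-1}y^{\delta_2-1}D_2\left(\begin{matrix}\gamma_1,\alpha_1,\beta_1;\gamma_2,\alpha_2;\gamma_3,\beta_2;\\ \delta_1,\alpha_3;\delta_2,\beta_3;\delta_3,\alpha_4;\delta_4,\beta_4;\end{matrix}\left|\begin{matrix}x^{\alpha_3}\\ y^{\beta_3}\end{matrix}\right.\right);p,q\right\}=\frac{1}{p^{\delta_1}q^{\delta_2}}E_{11}\left(\begin{matrix}\gamma_1,\alpha_1,\beta_1;\gamma_2,\alpha_2;\gamma_3,\beta_2;\\ \delta_3,\alpha_4;\delta_4,\beta_4;\end{matrix}\left|\begin{matrix}1/p^{\alpha_3}\\ 1/q^{\beta_3}\end{matrix}\right.\right),$$ where the Laplace transform is taken with respect to the variables $x,y>0$.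
   Context: $L_2\{f(t_1,t_2);p,q\}=\int_0^\infty\int_0^\infty f(t_1,t_2)e^{-t_1p-t_2q}\,dt_1\,dt_2$ is the two-dimensional Laplace transform. $(\gamma)_\lambda=\Gamma(\gamma+\lambda)/\Gamma(\gamma)$ for $\gamma\in\mathbb{C}$ and real $\lambda\ge0$. For complex $\gamma_i,\delta_i,x,y$ and positive real $\alpha_i,\beta_i$, $$D_2\left(\begin{matrix}\gamma_1,\alpha_1,\beta_1;\gamma_2,\alpha_2;\gamma_3,\beta_2;\\ \delta_1,\alpha_3;\delta_2,\beta_3;\delta_3,\alpha_4;\delta_4,\beta_4;\end{matrix}\left|\begin{matrix}x\\ y\end{matrix}\right.\right)=\sum_{m,n=0}^{\infty}\frac{(\gamma_1)_{\alpha_1 m+\beta_1 n}(\gamma_2)_{\alpha_2 m}(\gamma_3)_{\beta_2 n}}{\Gamma(\delta_1+\alpha_3 m)\Gamma(\delta_2+\beta_3 n)}\frac{x^m}{\Gamma(\delta_3+\alpha_4 m)}\frac{y^n}{\Gamma(\delta_4+\beta_4 n)},$$ $$E_{11}\left(\begin{matrix}\gamma_1,\alpha_1,\beta_1;\gamma_2,\alpha_2;\gamma_3,\beta_2;\\ \delta_1,\alpha_3;\delta_2,\beta_3;\end{matrix}\left|\begin{matrix}x\\ y\end{matrix}\right.\right)=\sum_{m,n=0}^{\infty}(\gamma_1)_{\alpha_1 m+\beta_1 n}(\gamma_2)_{\alpha_2 m}(\gamma_3)_{\beta_2 n}\frac{x^m}{\Gamma(\delta_1+\alpha_3 m)}\frac{y^n}{\Gamma(\delta_2+\beta_3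 n)}.$$ The functions are considered at arguments in the region of absolute convergence of their defining series; powers of $p,q$ are principal.
   Formalization: The formal theorem additionally assumes that the double Laplace integral on the left converges absolutely, and that no δ₁+α₃m or δ₂+β₃n (m,n ≥ 0) is a pole of Γ; without these the identity fails, e.g. for δ₁ = 0. *)

(* Defs.v *)
From HB Require Import structures.
From mathcomp Require Import all_boot all_order all_algebra.
From mathcomp Require Import all_classical all_reals all_analysis.
From mathcomp Require Export complex.

Set Implicit Arguments.
Unset Strict Implicit.
Unset Printing Implicit Defensive.

Import Order.TTheory GRing.Theory Num.Theory.
Import numFieldNormedType.Exports.

Local Open Scope classical_set_scope.
Local Open Scope ring_scope.
Local Open Scope complex_scope.

Section complex_analysis.
Context {R : realType}.
Implicit Types z a : R[i].

Definition cexp z : R[i] :=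
  (expR (complex.Re z) * cos (complex.Im z)) +i*
  (expR (complex.Re z) * sin (complex.Im z)).

(* Principal argument, in ]-pi, pi], for z != 0. *)
Definition carg z : R :=
  if 0 <= complex.Im z then acos (complex.Re z / Normc.normc z)
  else - acos (complex.Re z / Normc.normc z).

Definition clog z : R[i] := ln (Normc.normc z) +i* carg z.

(* Principal value of z ^ a; only meaningful for z != 0. *)
Definition cpow z a : R[i] := cexp (a * clog z).

Definition cintegrable d (T : measurableType d) (mu : {measure set T -> \bar R})
    (D : set T) (f : T -> R[i]) : Prop :=
  mu.-integrable D (fun t => (complex.Re (f t))%:E) /\
  mu.-integrable D (fun t => (complex.Im (f t))%:E).

Definition cintegral d (T : measurableType d) (mu : {measure set T -> \bar R})
    (D : set T) (f : T -> R[i]) : R[i] :=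
  Rintegral mu D (fun t => complex.Re (f t)) +i*
  Rintegral mu D (fun t => complex.Im (f t)).

Definition abs_convergent2 (t : nat -> nat -> R[i]) : Prop :=
  summable [set: nat * nat] (fun k => (Normc.normc (t k.1 k.2))%:E).

(* Sum of a double series: the limit of its rectangular partial sums as both
   bounds tend independently to infinity. *)
Definition rsum2 (t : nat -> nat -> R) : R :=
  lim ((fun N : nat * nat => \sum_(m < N.1) \sum_(n < N.2) t m n)
       @ filter_prod \oo \oo).

Definition csum2 (t : nat -> nat -> R[i]) : R[i] :=
  rsum2 (fun m n => complex.Re (t m n)) +i*
  rsum2 (fun m n => complex.Im (t m n)).

End complex_analysis.

Section gamma_function.
Context {R : realType}.
Implicit Types z g : R[i].

(* z is a pole of Gamma: z = 0, -1, -2, ... *)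
Definition gamma_pole z : Prop := exists k : nat, z = - k%:R.

(* Euler's integral, for Re z > 0. *)
Definition euler_gamma z : R[i] :=
  cintegral (@lebesgue_measure R) `]0, +oo[%classic
    (fun t : R => cpow t%:C (z - 1) * cexp (- t%:C)).

(* Continuation to Re z <= 0 by Gamma(z) = Gamma(z + n) / (z (z+1) ... (z+n-1)),
   n being the least natural number with Re (z + n) > 0. At a pole the product
   vanishes, so Gamma z = 0 and (Gamma z)^-1 = 0 since 0^-1 = 0: the inverse
   (Gamma z)^-1 is thus the entire function 1/Gamma on the whole plane. *)
Definition Gamma z : R[i] :=
  if 0 < complex.Re z then euler_gamma z
  else let n := (Num.truncn (- complex.Re z)).+1 in
       euler_gamma (z + n%:R) / \prod_(i < n) (z + i%:R).

(* (g)_l = Gamma (g + l) / Gamma g. If g is a pole and l is a natural number,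
   this quotient is indeterminate and is replaced by its limit, the rising
   factorial g (g+1) ... (g+l-1); in particular (g)_0 = 1. If g is a pole and
   l is not a natural number, the formula gives 0, again its limit. *)
Definition pochhammer g (l : R) : R[i] :=
  if `[< gamma_pole g >] && (l \is a Num.nat)
  then \prod_(i < Num.truncn l) (g + i%:R)
  else Gamma (g + l%:C) / Gamma g.

End gamma_function.

Section laplace.
Context {R : realType}.
Implicit Types (f : R -> R -> R[i]) (p q : R[i]).

Definition quadrant : set (R * R) := `]0, +oo[%classic `*` `]0, +oo[%classic.

Definition laplace2_kernel f p q (t : R * R) : R[i] :=
  f t.1 t.2 * cexp (- (t.1%:C * p) - t.2%:C * q).

Definition laplace2_exists f p q : Prop :=
  cintegrable (@lebesgue_measure R \x @lebesgue_measure R)%E quadrant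
    (laplace2_kernel f p q).

Definition laplace2 f p q : R[i] :=
  cintegral (@lebesgue_measure R \x @lebesgue_measure R)%E quadrant
    (laplace2_kernel f p q).

End laplace.

Section two_variable_functions.
Context {R : realType}.

Definition D2_term (g1 : R[i]) (a1 b1 : R) (g2 : R[i]) (a2 : R)
    (g3 : R[i]) (b2 : R) (d1 : R[i]) (a3 : R) (d2 : R[i]) (b3 : R)
    (d3 : R[i]) (a4 : R) (d4 : R[i]) (b4 : R) (x y : R[i]) (m n : nat) : R[i] :=
  pochhammer g1 (a1 * m%:R + b1 * n%:R) * pochhammer g2 (a2 * m%:R)
    * pochhammer g3 (b2 * n%:R)
    / (Gamma (d1 + (a3 * m%:R)%:C) * Gamma (d2 + (b3 * n%:R)%:C))
    * (x ^+ m / Gamma (d3 + (a4 * m%:R)%:C))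
    * (y ^+ n / Gamma (d4 + (b4 * n%:R)%:C)).

Definition D2 (g1 : R[i]) (a1 b1 : R) (g2 : R[i]) (a2 : R)
    (g3 : R[i]) (b2 : R) (d1 : R[i]) (a3 : R) (d2 : R[i]) (b3 : R)
    (d3 : R[i]) (a4 : R) (d4 : R[i]) (b4 : R) (x y : R[i]) : R[i] :=
  csum2 (D2_term g1 a1 b1 g2 a2 g3 b2 d1 a3 d2 b3 d3 a4 d4 b4 x y).

Definition E11_term (g1 : R[i]) (a1 b1 : R) (g2 : R[i]) (a2 : R)
    (g3 : R[i]) (b2 : R) (d1 : R[i]) (a3 : R) (d2 : R[i]) (b3 : R)
    (x y : R[i]) (m n : nat) : R[i] :=
  pochhammer g1 (a1 * m%:R + b1 * n%:R) * pochhammer g2 (a2 * m%:R)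
    * pochhammer g3 (b2 * n%:R)
    * (x ^+ m / Gamma (d1 + (a3 * m%:R)%:C))
    * (y ^+ n / Gamma (d2 + (b3 * n%:R)%:C)).

Definition E11 (g1 : R[i]) (a1 b1 : R) (g2 : R[i]) (a2 : R)
    (g3 : R[i]) (b2 : R) (d1 : R[i]) (a3 : R) (d2 : R[i]) (b3 : R)
    (x y : R[i]) : R[i] :=
  csum2 (E11_term g1 a1 b1 g2 a2 g3 b2 d1 a3 d2 b3 x y).

End two_variable_functions.

(* Main.v *)
From HB Require Import structures.
Require Import Defs.
From mathcomp Require Import all_boot all_order all_algebra.
From mathcomp Require Import all_classical all_reals all_analysis.
From mathcomp Require Import measurable_realfun.
From mathcomp Require Import complex ring lra.

(** Write c_mn for the coefficients of E11, so that the term of D2 of index (m, n) is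
    c_mn x^m y^n / (Gamma z_m Gamma w_n) with z_m = d1 + a3 m and w_n = d2 + b3 n. Since
    the Laplace transform of x^(z-1) / Gamma z is p^(-z) ([mintegralE]), the formula says
    that the double series may be transformed term by term, for whatever c_mn make both
    sides converge ([laplace2_original]). Three obstacles stand in the way.

    The terms with Re z_m <= 0 or Re w_n <= 0 have no Laplace transform. They vanish: for
    almost every y the integrand is integrable in x near 0, where the series is equivalent
    to its first nonzero term, so the coefficient of every x^m with Re z_m <= 0 is zero;
    it is a power series in y^b3, whence c_mn = 0 ([slice_vanish]).

    Absolute convergence of the image series is controlled by |p|, that of the integrals
    of the moduli of the terms by Re p, which is smaller. Fubini's theorem therefore only
    applies to p + s and q + t with s >= |p| and t >= |q| ([laplace2_termwise]). It needs
    Gamma (Re z_m) / |Gamma z_m| to be bounded, which follows, together with the fact that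
    Gamma has no zero, from a lower bound on |Gamma (x + i y)| for large x
    ([euler_gamma_lower]).

    It remains to come back to s = t = 0, one variable at a time ([laplace_descent]). On
    s > 0 both sides are analytic functions of s: the integral because e^(-su) has a Taylor
    series at s0 that is dominated up to the distance s0 ([laplace_pser]), the series
    because that of (p + s)^(-z) has, up to the distance |p + s0| - |p|, an absolute sum
    of order |p|^(-Re z) ([cpow_shift_pser]). Both radii are at least |p + s0| - |p|, which
    increases with s0, so that the identity propagates from large s down to all s > 0
    ([continuation]); both sides are continuous at s = 0 by dominated convergence.

    Series are treated as integrals for the counting measure, so that dominated
    convergence and termwise integration ([termwise_cintegral]) serve for sums too. *)


Set Implicit Arguments.
Unset Strict Implicit.
Unset Printing Implicit Defensive.

Import Order.TTheory GRing.Theory Num.Theory.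
Import numFieldNormedType.Exports.

Local Open Scope classical_set_scope.
Local Open Scope ring_scope.
Local Open Scope complex_scope.

Notation Re := (@complex.Re _).
Notation Im := (@complex.Im _).
Notation normc := (@Normc.normc _).

(** * Complex exponential and principal powers *)

Section complex_exponential.
Context {R : realType}.
Implicit Types (z w a b p : R[i]) (x : R).

Lemma complex_ext z w : Re z = Re w -> Im z = Im w -> z = w.
Proof. by case: z w => [? ?] [? ?] /= -> ->. Qed.

Lemma cReD z w : Re (z + w) = Re z + Re w. Proof. by case: z w => [? ?] []. Qed.
Lemma cImD z w : Im (z + w) = Im z + Im w. Proof. by case: z w => [? ?] []. Qed.
Lemma cReN z : Re (- z) = - Re z. Proof. by case: z. Qed.
Lemma cImN z : Im (- z) = - Im z. Proof. by case: z. Qed.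
Lemma cReM z w : Re (z * w) = Re z * Re w - Im z * Im w.
Proof. by case: z w => [? ?] []. Qed.
Lemma cImM z w : Im (z * w) = Re z * Im w + Im z * Re w.
Proof. by case: z w => [? ?] []. Qed.
Lemma cRe_nat n : Re (n%:R : R[i]) = n%:R.
Proof. by rewrite -(rmorph_nat (real_complex R)). Qed.
Lemma cIm_nat n : Im (n%:R : R[i]) = 0.
Proof. by rewrite -(rmorph_nat (real_complex R)). Qed.
Lemma cRe1 : Re (1 : R[i]) = 1. Proof. by []. Qed.
Lemma cIm1 : Im (1 : R[i]) = 0. Proof. by []. Qed.
Lemma cRe0 : Re (0 : R[i]) = 0. Proof. by []. Qed.
Lemma cIm0 : Im (0 : R[i]) = 0. Proof. by []. Qed.

Definition ReImE := (cReD, cImD, cReN, cImN, cReM, cImM, cRe_nat, cIm_nat, cRe1, cIm1, cRe0, cIm0).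

Lemma normc_sqrtE z : normc z = Num.sqrt (Re z ^+ 2 + Im z ^+ 2).
Proof. by case: z. Qed.

Lemma normc_ge0 z : 0 <= normc z.
Proof. by rewrite normc_sqrtE sqrtr_ge0. Qed.

Lemma normc_sqr z : normc z ^+ 2 = Re z ^+ 2 + Im z ^+ 2.
Proof. by rewrite normc_sqrtE sqr_sqrtr// addr_ge0// sqr_ge0. Qed.

Lemma normc_Re_le z : `|Re z| <= normc z.
Proof.
by rewrite -(@ler_pXn2r _ 2)// ?nnegrE ?normc_ge0// normc_sqr real_normK ?num_real// lerDl sqr_ge0.
Qed.

Lemma normc_Im_le z : `|Im z| <= normc z.
Proof.
by rewrite -(@ler_pXn2r _ 2)// ?nnegrE ?normc_ge0// normc_sqr real_normK ?num_real// lerDr sqr_ge0.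
Qed.

Lemma normc_le_ReIm z : normc z <= `|Re z| + `|Im z|.
Proof.
rewrite -(@ler_pXn2r _ 2)// ?nnegrE ?normc_ge0 ?addr_ge0//.
rewrite normc_sqr sqrrD !real_normK ?num_real//.
by rewrite lerD2r lerDl mulrn_wge0// mulr_ge0.
Qed.

Lemma normc_gt0 z : (0 < normc z) = (z != 0).
Proof.
rewrite lt0r normc_ge0 andbT; congr (~~ _); apply/eqP/eqP => [/Normc.eq0_normc//|->].
exact: Normc.normc0.
Qed.

Lemma normc_real x : normc x%:C = `|x|.
Proof. by rewrite normc_sqrtE /= expr0n addr0 sqrtr_sqr. Qed.

Lemma cexpD a b : cexp (a + b) = cexp a * cexp b.
Proof.
case: a b => [x y] [x' y']; apply: complex_ext; rewrite !ReImE /= expRD ?cosD ?sinD; ring.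
Qed.

Lemma cexp0 : cexp (0 : R[i]) = 1.
Proof. by rewrite /cexp /= expR0 cos0 sin0 mulr1 mulr0. Qed.

Lemma cexp_real x : cexp x%:C = (expR x)%:C.
Proof. by rewrite /cexp /= cos0 sin0 mulr1 mulr0. Qed.

Lemma cexpNK a : cexp (- a) * cexp a = 1.
Proof. by rewrite -cexpD addNr cexp0. Qed.

Lemma cexp_neq0 a : cexp a != 0.
Proof. by apply: contra_eq_neq (cexpNK a) => ->; rewrite mulr0 eq_sym oner_neq0. Qed.

Lemma cexpN a : cexp (- a) = (cexp a)^-1.
Proof. by apply: (mulIf (cexp_neq0 a)); rewrite cexpNK mulVf// cexp_neq0. Qed.

Lemma normc_cexp a : normc (cexp a) = expR (Re a).
Proof.
rewrite normc_sqrtE /= !exprMn -mulrDr cos2Dsin2 mulr1 sqrtr_sqr ger0_norm//.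
Qed.

Lemma cexpX a n : cexp (n%:R * a) = cexp a ^+ n.
Proof.
elim: n => [|n ih]; first by rewrite mul0r cexp0.
by rewrite exprS -ih -cexpD -natr1 mulrDl mul1r addrC.
Qed.

Lemma cpowD p a b : cpow p (a + b) = cpow p a * cpow p b.
Proof. by rewrite /cpow mulrDl cexpD. Qed.

Lemma cpowN p a : cpow p (- a) = (cpow p a)^-1.
Proof. by rewrite /cpow mulNr cexpN. Qed.

Lemma cpowX p a n : cpow p (n%:R * a) = cpow p a ^+ n.
Proof. by rewrite /cpow -mulrA cexpX. Qed.

Lemma normc_cpow p a :
  normc (cpow p a) = expR (Re a * ln (normc p) - Im a * carg p).
Proof. by rewrite /cpow normc_cexp cReM. Qed.

Lemma clog_real x : 0 < x -> clog x%:C = (ln x)%:C.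
Proof.
move=> x0; rewrite /clog /carg /= lexx expr0n addr0 sqrtr_sqr ger0_norm ?ltW//.
by rewrite divff ?gt_eqF// acos1.
Qed.

Section right_half_plane.
Variable p : R[i].
Hypothesis p_gt0 : 0 < Re p.

Lemma normc_Re_gt0 : 0 < normc p.
Proof. by rewrite normc_gt0; apply: contraTneq p_gt0 => ->; rewrite /= ltxx. Qed.

Let cosarg_bound : -1 <= Re p / normc p <= 1.
Proof.
by rewrite -ler_norml normrM normfV (ger0_norm (normc_ge0 _)) ler_pdivrMr ?normc_Re_gt0// mul1r normc_Re_le.
Qed.

Lemma normc_cos_carg : normc p * cos (carg p) = Re p.
Proof.
have -> : cos (carg p) = Re p / normc p.
  by rewrite /carg; case: ifP => _; rewrite ?cosN acosK// inE.
by rewrite mulrC divfK// gt_eqF// normc_Re_gt0.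
Qed.

Lemma normc_sin_carg : normc p * sin (carg p) = Im p.
Proof.
have n0 := normc_Re_gt0.
have e : normc p * Num.sqrt (1 - (Re p / normc p) ^+ 2) = `|Im p|.
  rewrite -[X in X * _](ger0_norm (normc_ge0 p)) -sqrtr_sqr -sqrtrM ?sqr_ge0//.
  rewrite -sqrtr_sqr; congr Num.sqrt; rewrite mulrBr mulr1 -exprMn.
  by rewrite [_ * (_ / _)]mulrC divfK ?gt_eqF// normc_sqr addrC addKr.
rewrite /carg; case: ifP => h; rewrite ?sinN sin_acos// ?mulrN e.
  by rewrite ger0_norm.
by rewrite ltr0_norm ?opprK// ltNge h.
Qed.

Lemma cexp_clog : cexp (clog p) = p.
Proof.
have n0 := normc_Re_gt0.
by apply: complex_ext; rewrite /cexp /= lnK ?posrE// ?normc_cos_carg ?normc_sin_carg.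
Qed.

Lemma carg_lt : `|carg p| < pi / 2.
Proof.
have n0 := normc_Re_gt0.
suff : acos (Re p / normc p) < pi / 2 /\ 0 <= acos (Re p / normc p).
  by move=> [h1 h2]; rewrite /carg; case: ifP => _; rewrite ?normrN ger0_norm.
have b := cosarg_bound; split; last exact: acos_ge0.
rewrite -ltr_cos ?in_itv/= ?acos_ge0 ?acos_lepi//.
  by rewrite cos_pihalf acosK ?inE// divr_gt0.
by rewrite divr_ge0 ?pi_ge0//= ler_pdivrMr// ler_peMr ?pi_ge0// ler1n.
Qed.

End right_half_plane.

(** The argument lies in ]-pi/2, pi/2[ on the right half-plane, so that up to a factor
    depending on Im a only, |p^a| is |p|^(Re a). *)
Lemma normc_cpow_le p a : 0 < Re p ->
  normc (cpow p a) <= expR (`|Im a| * (pi / 2)) * expR (Re a * ln (normc p)).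
Proof.
move=> p0; rewrite normc_cpow addrC expRD ler_wpM2r ?expR_ge0// ler_expR.
rewrite (le_trans (ler_norm _))// normrN normrM ler_wpM2l//.
exact/ltW/carg_lt.
Qed.

End complex_exponential.

(** * Complex integrals, and series as integrals for the counting measure *)

Section complex_integration.
Context {R : realType} d (T : measurableType d).
Variables (mu : {measure set T -> \bar R}) (D : set T).
Hypothesis mD : measurable D.
Implicit Types (f g : T -> R[i]) (c : R[i]).

Definition cmeasurable f := measurable_fun D (Re \o f) /\ measurable_fun D (Im \o f).

Lemma cmeasurable_cst c : cmeasurable (fun=> c).
Proof. by split; exact: measurable_cst. Qed.

Lemma cmeasurable_real (h : T -> R) :
  measurable_fun D h -> cmeasurable (fun x => (h x)%:C).
Proof. by move=> mh; split=> //; exact: measurable_cst. Qed.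

Lemma cmeasurableD f g :
  cmeasurable f -> cmeasurable g -> cmeasurable (fun x => f x + g x).
Proof.
move=> [f1 f2] [g1 g2]; split.
- by apply: eq_measurable_fun (measurable_funD f1 g1) => x _; rewrite /= cReD.
- by apply: eq_measurable_fun (measurable_funD f2 g2) => x _; rewrite /= cImD.
Qed.

Lemma cmeasurableM f g :
  cmeasurable f -> cmeasurable g -> cmeasurable (fun x => f x * g x).
Proof.
move=> [f1 f2] [g1 g2]; split.
- apply: eq_measurable_fun (measurable_funB (measurable_funM f1 g1) (measurable_funM f2 g2)).
  by move=> x _; rewrite /= cReM.
- apply: eq_measurable_fun (measurable_funD (measurable_funM f1 g2) (measurable_funM f2 g1)).
  by move=> x _; rewrite /= cImM.
Qed.

Lemma cmeasurable_cexp f : cmeasurable f -> cmeasurable (cexp \o f).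
Proof.
move=> [f1 f2]; split; rewrite /comp /=; apply: measurable_funM;
  try exact: (measurableT_comp (@measurable_expR R) f1).
- exact: (measurableT_comp (continuous_measurable_fun (@continuous_cos R)) f2).
- exact: (measurableT_comp (continuous_measurable_fun (@continuous_sin R)) f2).
Qed.

Lemma cmeasurable_normc f : cmeasurable f -> measurable_fun D (normc \o f).
Proof.
move=> [f1 f2].
have h : measurable_fun D (fun x => Num.sqrt (Re (f x) ^+ 2 + Im (f x) ^+ 2)).
  apply: (measurableT_comp (continuous_measurable_fun (@sqrt_continuous R))).
  by apply: measurable_funD; apply: measurable_funX.
by apply: eq_measurable_fun h => x _; rewrite /= normc_sqrtE.
Qed.

Lemma cintegrable_measurable f : cintegrable mu D f -> cmeasurable f.
Proof. by move=> [/measurable_int/measurable_EFinP ? /measurable_int/measurable_EFinP]. Qed.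

Lemma cintegrable_le f (h : T -> R) : cmeasurable f ->
  mu.-integrable D (EFin \o h) -> (forall x, D x -> normc (f x) <= h x) ->
  cintegrable mu D f.
Proof.
move=> [f1 f2] ih fh; split.
- apply: (le_integrable mD _ _ ih); first exact/measurable_EFinP.
  move=> x Dx /=; rewrite lee_fin (le_trans (normc_Re_le _))// (le_trans (fh _ Dx))//.
  exact: ler_norm.
- apply: (le_integrable mD _ _ ih); first exact/measurable_EFinP.
  move=> x Dx /=; rewrite lee_fin (le_trans (normc_Im_le _))// (le_trans (fh _ Dx))//.
  exact: ler_norm.
Qed.

Lemma integrable_normc f :
  cintegrable mu D f -> mu.-integrable D (fun x => (normc (f x))%:E).
Proof.
move=> fi; have [f1 f2] := fi.
have f12 := integrableD mD (integrable_norm f1) (integrable_norm f2).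
apply: (le_integrable mD _ _ f12).
  exact/measurable_EFinP/cmeasurable_normc/cintegrable_measurable.
move=> x Dx /=; rewrite lee_fin ger0_norm ?normc_ge0//.
by rewrite (le_trans (normc_le_ReIm _))// ler_norm.
Qed.

Lemma eq_cintegral f g : {in D, f =1 g} -> cintegral mu D f = cintegral mu D g.
Proof.
by move=> fg; congr (_ +i* _); apply: eq_Rintegral => x xD; rewrite fg.
Qed.

Lemma cintegrableZ c f : cintegrable mu D f -> cintegrable mu D (fun x => c * f x).
Proof.
move=> fi; apply: (@cintegrable_le _ (fun x => normc c * normc (f x))).
- by apply: cmeasurableM; [exact: cmeasurable_cst|exact: cintegrable_measurable].
- exact: (integrableZl mD _ (integrable_normc fi)).
- by move=> x _; rewrite Normc.normcM.
Qed.

Lemma cintegralZ c f : cintegrable mu D f ->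
  cintegral mu D (fun x => c * f x) = c * cintegral mu D f.
Proof.
move=> [f1 f2]; have rl (r : R) (h : T -> R) : mu.-integrable D (fun x => (h x)%:E) ->
    mu.-integrable D (fun x => (r * h x)%:E).
  by move=> ih; exact: (integrableZl mD r ih).
apply: complex_ext; rewrite ?cReM ?cImM /=.
- rewrite -!RintegralZl// -RintegralB//; [|exact: rl..].
  by apply: eq_Rintegral => x _; rewrite cReM.
- rewrite -!RintegralZl// -RintegralD//; [|exact: rl..].
  by apply: eq_Rintegral => x _; rewrite cImM.
Qed.

Lemma cintegralB f g : cintegrable mu D f -> cintegrable mu D g ->
  cintegral mu D (fun x => f x - g x) = cintegral mu D f - cintegral mu D g.
Proof.
move=> [f1 f2] [g1 g2]; apply: complex_ext.
- rewrite cReD cReN /= -RintegralB//.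
  by apply: eq_Rintegral => x _; rewrite cReD cReN.
- rewrite cImD cImN /= -RintegralB//.
  by apply: eq_Rintegral => x _; rewrite cImD cImN.
Qed.

Lemma cintegrableB f g : cintegrable mu D f -> cintegrable mu D g ->
  cintegrable mu D (fun x => f x - g x).
Proof.
move=> [f1 f2] [g1 g2]; split.
- by apply: eq_integrable (integrableB mD f1 g1) => // x _; rewrite cReD cReN.
- by apply: eq_integrable (integrableB mD f2 g2) => // x _; rewrite cImD cImN.
Qed.

(** The constant 2 comes from bounding the two components separately. *)
Lemma normc_cintegral_le f : cintegrable mu D f ->
  normc (cintegral mu D f) <= 2 * \int[mu]_(x in D) normc (f x).
Proof.
move=> fi; have [f1 f2] := fi; have fn := integrable_normc fi.
rewrite (le_trans (normc_le_ReIm _))//= mulr_natl mulr2n lerD//.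
- rewrite (le_trans (le_normr_Rintegral mD f1))// le_Rintegral//.
    exact: integrable_norm.
  by move=> x _; exact: normc_Re_le.
- rewrite (le_trans (le_normr_Rintegral mD f2))// le_Rintegral//.
    exact: integrable_norm.
  by move=> x _; exact: normc_Im_le.
Qed.

End complex_integration.

Definition ccvg {R : realType} (u : nat -> R[i]) (l : R[i]) : Prop :=
  ((fun n => Re (u n)) @ \oo --> Re l) /\ ((fun n => Im (u n)) @ \oo --> Im l).

Section limits.
Context {R : realType}.
Implicit Types (u v : nat -> R[i]) (l k c : R[i]).

Lemma ccvg_unique u l k : ccvg u l -> ccvg u k -> l = k.
Proof.
by move=> [u1 u2] [v1 v2]; apply: complex_ext; [exact: cvg_unique u1 v1|exact: cvg_unique u2 v2].
Qed.

Lemma ccvg_cst c : ccvg (fun=> c) c.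
Proof. by split; exact: cvg_cst. Qed.

Lemma ccvgM u v l k : ccvg u l -> ccvg v k -> ccvg (fun n => u n * v n) (l * k).
Proof.
move=> [u1 u2] [v1 v2]; split.
- by rewrite cReM; under eq_fun do rewrite cReM; apply: cvgB; exact: cvgM.
- by rewrite cImM; under eq_fun do rewrite cImM; apply: cvgD; exact: cvgM.
Qed.

End limits.

Section exchange.
Context {R : realType} d (T : measurableType d).
Variables (mu : {measure set T -> \bar R}) (D : set T).
Hypothesis mD : measurable D.

Lemma Rintegral_dominated (f_ : nat -> T -> R) (f g : T -> R) :
  (forall n, measurable_fun D (f_ n)) -> measurable_fun D f ->
  (forall x, D x -> f_ ^~ x @ \oo --> f x) ->
  mu.-integrable D (EFin \o g) ->
  (forall n x, D x -> `|f_ n x| <= g x) ->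
  (fun n => \int[mu]_(x in D) f_ n x) @ \oo --> \int[mu]_(x in D) f x.
Proof.
move=> mf_ mf f_f ig f_g.
have [//|||//||if' _ h] := @dominated_convergence _ _ _ mu _ mD
   (fun n => EFin \o f_ n) (EFin \o f) (EFin \o g).
- by move=> n; exact/measurable_EFinP.
- exact/measurable_EFinP.
- by apply: aeW => x Dx; apply: cvg_EFin; [exact: nearW|exact: f_f].
- by apply: aeW => x n Dx; rewrite /= lee_fin f_g.
apply: fine_cvg; rewrite fineK; first exact: h.
exact: integrable_fin_num.
Qed.

Lemma cintegral_dominated (f_ : nat -> T -> R[i]) (f : T -> R[i]) (g : T -> R) :
  (forall n, cmeasurable D (f_ n)) -> cmeasurable D f ->
  (forall x, D x -> ccvg (f_ ^~ x) (f x)) ->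
  mu.-integrable D (EFin \o g) ->
  (forall n x, D x -> normc (f_ n x) <= g x) ->
  ccvg (fun n => cintegral mu D (f_ n)) (cintegral mu D f).
Proof.
move=> mf_ mf f_f ig f_g; split.
- apply: (@Rintegral_dominated (fun n x => Re (f_ n x)) (fun x => Re (f x)) g) => //.
  + by move=> n; exact: (mf_ n).1.
  + exact: mf.1.
  + by move=> x Dx; exact: (f_f x Dx).1.
  + by move=> n x Dx; rewrite (le_trans (normc_Re_le _))// f_g.
- apply: (@Rintegral_dominated (fun n x => Im (f_ n x)) (fun x => Im (f x)) g) => //.
  + by move=> n; exact: (mf_ n).2.
  + exact: mf.2.
  + by move=> x Dx; exact: (f_f x Dx).2.
  + by move=> n x Dx; rewrite (le_trans (normc_Im_le _))// f_g.
Qed.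

End exchange.

Section series_as_integrals.
Context {R : realType}.

Notation cnt := (@counting nat R).

Definition summableR (u : nat -> R) := (cnt).-integrable setT (EFin \o u).
Definition sumR (u : nat -> R) : R := \int[cnt]_k u k.
Definition csum (u : nat -> R[i]) : R[i] := cintegral cnt setT u.
Definition csummable (u : nat -> R[i]) := summableR (normc \o u).

Lemma cmeasurable_nat (u : nat -> R[i]) : cmeasurable setT u.
Proof. by split. Qed.

Lemma csummable_cintegrable (u : nat -> R[i]) : csummable u -> cintegrable cnt setT u.
Proof. by move=> su; apply: (cintegrable_le measurableT (cmeasurable_nat u) su). Qed.

Lemma ge0_integral_count (a : nat -> \bar R) : (forall k, 0 <= a k)%E ->
  (\int[cnt]_k a k = \sum_(k <oo) a k)%E.
Proof.
move=> a0; transitivity (\int[mseries (fun n => @dirac _ nat n R) O]_t a t)%E.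
  congr (integral _ _ _); apply/funext => A; by rewrite /= counting_dirac.
rewrite ge0_integral_measure_series//.
by apply: eq_eseriesr => i _; rewrite integral_dirac//= diracT mul1e.
Qed.

Lemma summableRP (u : nat -> R) :
  summableR u <-> (\sum_(k <oo) `|u k|%:E < +oo)%E.
Proof.
split=> [/integrableP[_]|h]; last apply/integrableP; rewrite ?ge0_integral_count//; split=> //.
Qed.

Lemma summableR_cvg (u : nat -> R) : summableR u -> series u @ \oo --> sumR u.
Proof.
move=> su; have /summableRP h := su.
have hs : summable setT (EFin \o u).
  rewrite /summable; apply: le_lt_trans h.
  by rewrite nneseries_esumT//=.
have cu : cvgn (series u).
  apply: normed_cvg; apply: nondecreasing_is_cvgn; first by apply: nondecreasing_series => k _ _ /=.
  exists (fine (\sum_(k <oo) `|u k|%:E)%E) => _ [n _ <-] /=.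
  rewrite -lee_fin fineK.
    by rewrite -sumEFin; apply: nneseries_lim_ge.
  by rewrite ge0_fin_numE// nneseries_ge0.
rewrite /sumR /Rintegral integral_count//.
have -> : (\sum_(k <oo) (u k)%:E = (limn (series u))%:E)%E.
  apply/cvg_lim => //; rewrite (_ : (fun n => _) = EFin \o series u).
    by apply: cvg_EFin; [exact: nearW|].
  by apply/funext => n /=; rewrite sumEFin.
exact: cu.
Qed.

Lemma summableR_le (u v : nat -> R) :
  (forall k, `|u k| <= v k) -> summableR v -> summableR u.
Proof.
move=> uv; apply: le_integrable => //.
by move=> k _ /=; rewrite lee_fin (le_trans (uv k))// ler_norm.
Qed.

Lemma csummable_le (u : nat -> R[i]) (v : nat -> R) :
  (forall k, normc (u k) <= v k) -> summableR v -> csummable u.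
Proof.
by move=> uv; apply: summableR_le => k /=; rewrite ger0_norm ?normc_ge0.
Qed.

Lemma csummableZ (c : R[i]) (u : nat -> R[i]) :
  csummable u -> csummable (fun k => c * u k).
Proof.
move=> su; apply: (@csummable_le _ (fun k => normc c * normc (u k))).
  by move=> k; rewrite Normc.normcM.
exact: (integrableZl measurableT _ su).
Qed.

Lemma csumZ (c : R[i]) (u : nat -> R[i]) :
  csummable u -> csum (fun k => c * u k) = c * csum u.
Proof.
by move=> su; rewrite /csum cintegralZ//; exact: csummable_cintegrable.
Qed.

End series_as_integrals.

(** * Termwise integration and double series *)

Section termwise_integration.
Context {R : realType} d (T : measurableType d).
Variables (mu : {measure set T -> \bar R}) (D : set T).
Hypothesis mD : measurable D.

(** Dominated convergence of the partial sums: they are bounded by the sum of the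
    absolute values, which is integrable, hence finite almost everywhere. *)
Lemma termwise_Rintegral (f : nat -> T -> R) :
  (forall k, measurable_fun D (f k)) ->
  (\sum_(k <oo) \int[mu]_(x in D) `|f k x|%:E < +oo)%E ->
  (forall x, D x -> summableR (f ^~ x)) ->
  [/\ mu.-integrable D (fun x => (sumR (f ^~ x))%:E),
      summableR (fun k => \int[mu]_(x in D) f k x) &
      \int[mu]_(x in D) sumR (f ^~ x) = sumR (fun k => \int[mu]_(x in D) f k x)].
Proof.
move=> mf sf fx.
have mfE k : measurable_fun D (fun x => `|f k x|%:E).
  by apply/measurable_EFinP; apply: measurableT_comp.
have if_ k : mu.-integrable D (EFin \o f k).
  apply/integrableP; split; first exact/measurable_EFinP.
  apply: le_lt_trans sf; rewrite (@nneseriesD1 _ _ k)//; last first.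
    by move=> ? _; exact: integral_ge0.
  by rewrite leeDl// nneseries_ge0// => *; exact: integral_ge0.
pose G x : \bar R := (\sum_(k <oo) `|f k x|%:E)%E.
have iG : mu.-integrable D G.
  apply/integrableP; split; first by apply: ge0_emeasurable_sum.
  under eq_integral do rewrite gee0_abs ?nneseries_ge0//.
  by rewrite integral_nneseries.
pose S n x := \sum_(0 <= k < n) f k x.
have iS n : mu.-integrable D (EFin \o S n).
  have := integrable_sum mD (index_iota 0 n) (fun k (_ : true) => if_ k).
  by apply: eq_integrable => // x _; rewrite /S /= sumEFin.
have mS n : measurable_fun D (S n) by exact/measurable_EFinP/(measurable_int mu).
have cS x : D x -> S ^~ x @ \oo --> sumR (f ^~ x).
  by move=> /fx/summableR_cvg.
have mF : measurable_fun D (fun x => sumR (f ^~ x)).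
  exact: (measurable_fun_cvg mS cS).
have [|||//||iF _ h] := @dominated_convergence _ _ _ mu _ mD
   (fun n => EFin \o S n) (fun x => (sumR (f ^~ x))%:E) G.
- by move=> n; exact/measurable_EFinP.
- exact/measurable_EFinP.
- by apply: aeW => x Dx; apply: cvg_EFin; [exact: nearW|exact: cS].
- apply: aeW => x n Dx; rewrite /= /G.
  apply: (@le_trans _ _ (\sum_(0 <= k < n) `|f k x|%:E)%E).
    by rewrite sumEFin lee_fin; exact: ler_norm_sum.
  exact: nneseries_lim_ge.
have sI : summableR (fun k => \int[mu]_(x in D) f k x).
  apply/summableRP; apply: le_lt_trans sf; apply: lee_nneseries => [k _ _|k _].
    by rewrite lee_fin.
  rewrite EFin_normr_Rintegral//; apply: le_trans (le_abse_integral mu mD _) _ => //.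
  exact/measurable_EFinP.
split=> //.
have h1 : (fun n => \int[mu]_(x in D) S n x) @ \oo --> \int[mu]_(x in D) sumR (f ^~ x).
  by apply: fine_cvg; rewrite fineK; [exact: h|exact: integrable_fin_num].
have h2 := summableR_cvg sI.
apply: (cvg_unique _ h1) => //.
rewrite (_ : (fun n => _) = series (fun k => \int[mu]_(x in D) f k x))//.
apply/funext => n; rewrite /series /= /Rintegral.
under eq_integral do rewrite /S -sumEFin.
rewrite (@integral_sum _ _ _ mu _ mD _ (fun k x => (f k x)%:E))//.
transitivity (fine (\sum_(0 <= k < n) (\int[mu]_(x in D) f k x)%:E)%E).
  congr fine; apply: eq_bigr => k _; rewrite fineK//.
  exact: (integrable_fin_num mD (if_ k)).
by rewrite sumEFin.
Qed.

Lemma termwise_cintegral (f : nat -> T -> R[i]) :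
  (forall k, cmeasurable D (f k)) ->
  (\sum_(k <oo) \int[mu]_(x in D) (normc (f k x))%:E < +oo)%E ->
  (forall x, D x -> csummable (f ^~ x)) ->
  [/\ cintegrable mu D (fun x => csum (f ^~ x)),
      csummable (fun k => cintegral mu D (f k)) &
      cintegral mu D (fun x => csum (f ^~ x)) = csum (fun k => cintegral mu D (f k))].
Proof.
move=> mf sf fx.
have mn k : measurable_fun D (fun x => (normc (f k x))%:E).
  exact/measurable_EFinP/cmeasurable_normc.
have [|||i1 s1 e1] := @termwise_Rintegral (fun k x => Re (f k x)).
- by move=> k; exact: (mf k).1.
- apply: le_lt_trans sf; apply: lee_nneseries => [k _ _|k _]; first by apply: integral_ge0 => x _; rewrite lee_fin.
  apply: ge0_le_integral => //; last by move=> x _; rewrite lee_fin normc_Re_le.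
  by apply/measurable_EFinP; apply: measurableT_comp => //; exact: (mf k).1.
- by move=> x /fx sx; apply: (summableR_le _ sx) => k; exact: normc_Re_le.
have [|||i2 s2 e2] := @termwise_Rintegral (fun k x => Im (f k x)).
- by move=> k; exact: (mf k).2.
- apply: le_lt_trans sf; apply: lee_nneseries => [k _ _|k _]; first by apply: integral_ge0 => x _; rewrite lee_fin.
  apply: ge0_le_integral => //; last by move=> x _; rewrite lee_fin normc_Im_le.
  by apply/measurable_EFinP; apply: measurableT_comp => //; exact: (mf k).2.
- by move=> x /fx sx; apply: (summableR_le _ sx) => k; exact: normc_Im_le.
split; first by split.
- apply: (@csummable_le _ _ (fun k => `|Re (cintegral mu D (f k))| + `|Im (cintegral mu D (f k))|)).
    by move=> k; exact: normc_le_ReIm.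
  exact: (integrableD measurableT (integrable_norm s1) (integrable_norm s2)).
- exact: complex_ext.
Qed.

End termwise_integration.

Section double_series.
Context {R : realType}.

Lemma nneseries_single (w : R) (m : nat) :
  (\sum_(k <oo) (if k == m then w else 0)%:E = w%:E)%E.
Proof.
apply: lim_near_cst => //; near=> n.
rewrite sumEFin; congr EFin; rewrite -big_mkcond /=.
rewrite big_nat1_eq /=; case: ifP => //.
by move=> /negP; case; near: n; exists m.+1.
Unshelve. all: by end_near. Qed.

Lemma sumR_single (v : R) (m : nat) :
  summableR (fun k => if k == m then v else 0) /\
  sumR (fun k => if k == m then v else 0) = v.
Proof.
have s : summableR (fun k => if k == m then v else 0).
  apply/summableRP; under eq_eseriesr do rewrite (fun_if Num.norm) normr0.
  by rewrite nneseries_single ltry.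
split=> //; rewrite /sumR /Rintegral integral_count ?nneseries_single//.
move/summableRP : s; rewrite /summable; apply: le_lt_trans.
by rewrite nneseries_esumT.
Qed.

Lemma csum_single (v : R[i]) (m : nat) :
  csummable (fun k => if k == m then v else 0) /\
  csum (fun k => if k == m then v else 0) = v.
Proof.
split.
  have [] := sumR_single (normc v) m; rewrite /csummable (_ : _ \o _ = fun k => if k == m then normc v else 0)//.
  by apply/funext => k /=; case: ifP => // _; exact: Normc.normc0.
apply: complex_ext => /=.
- rewrite -[RHS](sumR_single (Re v) m).2; apply: eq_Rintegral => k _; by case: ifP.
- rewrite -[RHS](sumR_single (Im v) m).2; apply: eq_Rintegral => k _; by case: ifP.
Qed.

(** Summation by packets, the j-th packet being the terms with m i = j. This is termwise
    integration for the counting measure: at each i, the series over j has one nonzero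
    term. *)
Lemma csum_packets (m : nat -> nat) (f : nat -> R[i]) : csummable f ->
  [/\ forall j, csummable (fun i => if m i == j then f i else 0),
      csummable (fun j => csum (fun i => if m i == j then f i else 0)) &
      csum f = csum (fun j => csum (fun i => if m i == j then f i else 0))].
Proof.
move=> sf; pose g j i := if m i == j then f i else 0.
have gsum i : csummable (g ^~ i) /\ csum (g ^~ i) = f i.
  have [s e] := csum_single (f i) (m i).
  have -> : g ^~ i = (fun k => if k == m i then f i else 0).
    by apply/funext => j; rewrite /g eq_sym.
  by split.
have [|||_ s e] := @termwise_cintegral R _ nat (@counting nat R) setT measurableT g.
- by move=> k; exact: cmeasurable_nat.
- rewrite -integral_nneseries//; last by move=> k i _; rewrite lee_fin normc_ge0.
  move/integrableP : (sf) => [_]; apply: le_lt_trans.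
  apply: ge0_le_integral => //.
  + by move=> i _; apply: nneseries_ge0 => k _ _; rewrite lee_fin normc_ge0.
  + move=> i _; rewrite /= ger0_norm ?normc_ge0//.
    rewrite (_ : \sum_(k <oo) _ = (normc (f i))%:E)%E// -(nneseries_single _ (m i)).
    apply: eq_eseriesr => k _; rewrite /g eq_sym; case: ifP => // _.
    by rewrite Normc.normc0.
- by move=> i _; exact: (gsum i).1.
split.
- move=> j; apply: (csummable_le _ sf) => i /=; case: ifP => // _.
  by rewrite Normc.normc0 normc_ge0.
- exact: s.
- by rewrite -e; apply: eq_cintegral => i _; rewrite (gsum i).2.
Qed.

Lemma nat_pair_enum : exists e : nat -> nat * nat, set_bij setT setT e.
Proof.
have /ppcard_eqP[e] : ([set: nat] #= [set: nat * nat])%card.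
  by rewrite card_eq_sym; exact: card_nat2.
by exists e; exact: bij.
Qed.

Lemma sumR_sum (I : Type) (s : seq I) (F : I -> nat -> R) :
  (forall i, summableR (F i)) ->
  sumR (fun k => \sum_(i <- s) F i k) = \sum_(i <- s) sumR (F i).
Proof.
move=> sF; elim: s => [|i s ih].
  rewrite big_nil -[RHS](sumR_single 0 0).2; congr sumR; apply/funext => k.
  by rewrite big_nil; case: ifP.
rewrite big_cons -ih /sumR -RintegralD//; last 2 first.
- exact: sF.
- have := integrable_sum measurableT s (fun i (_ : true) => sF i).
  by apply: eq_integrable => // k _ /=; rewrite sumEFin.
by apply: eq_Rintegral => k _; rewrite big_cons.
Qed.

Section enumeration.
Variable e : nat -> nat * nat.
Hypothesis e_bij : set_bij setT setT e.

(** Every large rectangle contains the first n pairs of the enumeration, so its sum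
    differs from the total by at most the sum of the absolute values of the others. *)
Lemma rsum2_enum (u : nat -> nat -> R) : summableR (fun k => u (e k).1 (e k).2) ->
  rsum2 u = sumR (fun k => u (e k).1 (e k).2).
Proof.
set v := fun k => u (e k).1 (e k).2 => sv.
have [_ e_inj e_surj] := e_bij.
pose rect (N : nat * nat) k := ((e k).1 < N.1)%N && ((e k).2 < N.2)%N.
have single m n : summableR (fun k => if e k == (m, n) then u m n else 0) /\
    sumR (fun k => if e k == (m, n) then u m n else 0) = u m n.
  have [k0 _ ek0] := e_surj (m, n) I.
  rewrite (_ : (fun k => _) = (fun k => if k == k0 then u m n else 0)).
    exact: sumR_single.
  apply/funext => k; congr (if _ then _ else _); rewrite -ek0.
  by apply/eqP/eqP => [/e_inj->//|->]; rewrite ?inE.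
have rectE N : \sum_(m < N.1) \sum_(n < N.2) u m n =
    sumR (fun k => if rect N k then v k else 0).
  transitivity (\sum_(0 <= m < N.1) \sum_(0 <= n < N.2)
     sumR (fun k => if e k == (m, n) then u m n else 0)).
    rewrite big_mkord; apply: eq_bigr => m _; rewrite big_mkord; apply: eq_bigr => n _.
    by rewrite (single m n).2.
  rewrite (eq_bigr (fun m => sumR (fun k =>
      \sum_(0 <= n < N.2) (if e k == (m, n) then u m n else 0)))); last first.
    by move=> m _; rewrite sumR_sum// => n; exact: (single m n).1.
  rewrite -sumR_sum; last first.
    move=> m; have := integrable_sum measurableT (index_iota 0 N.2) (fun n (_ : true) => (single m n).1).
    apply: eq_integrable => // k _ /=. by rewrite sumEFin.
  congr sumR; apply/funext => k; rewrite /rect /v; case: (e k) => a b /=.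
  transitivity (\sum_(0 <= m < N.1 | m == a) \sum_(0 <= n < N.2 | n == b) u m n).
    rewrite [RHS]big_mkcond; apply: eq_bigr => m _ /=; case: ifP => ma.
      rewrite [RHS]big_mkcond; apply: eq_bigr => n _.
      by rewrite xpair_eqE [a == m]eq_sym ma [b == n]eq_sym.
    by rewrite big1// => n _; rewrite xpair_eqE [a == m]eq_sym ma.
  by rewrite big_nat1_eq /= big_nat1_eq /=; case: ltnP; case: ltnP.
pose tail n := sumR (fun k => if (k < n)%N then 0 else `|v k|).
have sumR0 : sumR (fun=> (0 : R)) = 0.
  rewrite -[RHS](sumR_single (0 : R) 0).2; congr sumR; apply/funext => k; by case: ifP.
have tail0 : tail @ \oo --> 0.
  suff : tail @ \oo --> sumR (fun=> (0 : R)) by rewrite sumR0.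
  apply: (@Rintegral_dominated _ _ _ (@counting nat R) setT measurableT
    (fun n k => if (k < n)%N then 0 else `|v k|) (fun=> 0) (fun k => `|v k|)) => //.
  - move=> k _; apply: (@cvg_near_cst); near=> n.
    by case: ifP => //= /negP; case; near: n; exists k.+1.
  - exact: integrable_norm.
  - by move=> n k _; case: ifP; rewrite ?normr0// normr_id.
apply/cvg_lim => //; apply/cvgrPdist_le => eps eps0.
move/cvgrPdist_le : tail0 => /(_ _ eps0)[n _ /(_ n (leqnn _))].
rewrite sub0r normrN => tn.
(* K exceeds both components of each of the first n pairs. *)
pose K := (\sum_(k < n) ((e k).1 + (e k).2).+1)%N.
have eK k : (k < n)%N -> ((e k).1 < K)%N && ((e k).2 < K)%N.
  move=> kn; have : (((e k).1 + (e k).2).+1 <= K)%N.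
    by rewrite /K (bigD1 (Ordinal kn))//= leq_addr.
  by move=> h; apply/andP; split; apply: leq_trans h; rewrite ltnS ?leq_addr ?leq_addl.
exists ([set N | (K <= N)%N], [set N | (K <= N)%N]).
  by split; exists K.
move=> [N1 N2] /= [KN1 KN2]; rewrite (rectE (N1, N2)) /sumR -RintegralB//; last first.
  apply: (summableR_le _ (integrable_norm sv)) => k /=.
  by case: ifP; rewrite ?normr0.
have sr : summableR (fun k => v k - (if rect (N1, N2) k then v k else 0)).
  apply: (summableR_le _ (integrable_norm sv)) => k /=.
  by case: ifP; rewrite ?subrr ?subr0 ?normr0.
apply: le_trans (le_normr_Rintegral measurableT sr) _.
apply: le_trans tn; apply: le_trans (ler_norm _); apply: le_Rintegral => //.
- exact: integrable_norm.
- apply: (summableR_le _ (integrable_norm sv)) => k /=.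
  by case: ifP; rewrite ?normr0 ?normr_id.
- move=> k _; case: (ltnP k n) => [kn|_].
    have /andP[h1 h2] := eK _ kn.
    by rewrite /rect /= (leq_trans h1 KN1) (leq_trans h2 KN2) subrr normr0.
  by case: ifP; rewrite ?subrr ?subr0 ?normr0.
Unshelve. all: by end_near. Qed.

Lemma csum2_enum (t : nat -> nat -> R[i]) : abs_convergent2 t ->
  csummable (fun k => t (e k).1 (e k).2) /\
  csum2 t = csum (fun k => t (e k).1 (e k).2).
Proof.
move=> at2; have st : csummable (fun k => t (e k).1 (e k).2).
  apply/summableRP; apply: le_lt_trans at2.
  by rewrite nneseries_esumT// (reindex_esum _ _ _ _ e_bij).
split=> //; apply: complex_ext => /=.
- rewrite (@rsum2_enum (fun m n => Re (t m n)))//.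
  by apply: (summableR_le _ st) => k /=; exact: normc_Re_le.
- rewrite (@rsum2_enum (fun m n => Im (t m n)))//.
  by apply: (summableR_le _ st) => k /=; exact: normc_Im_le.
Qed.

End enumeration.

End double_series.

(** * Primitives on the half-line *)

Section half_line.
Context {R : realType}.
Notation leb := (@lebesgue_measure R).
Notation Rpos := (`]0%R, +oo[%classic : set R).

Lemma measurable_Rpos_continuous (f : R -> R) :
  (forall x : R, 0 < x -> {for x, continuous f}) -> measurable_fun Rpos f.
Proof.
move=> cf; apply: open_continuous_measurable_fun => //.
by move=> x; rewrite inE /= in_itv /= andbT; exact: cf.
Qed.

Lemma FTC_segment (F f : R -> R) (a b : R) : 0 < a -> a < b ->
  (forall x : R, 0 < x -> is_derive x 1 F (f x)) ->
  (forall x : R, 0 < x -> {for x, continuous f}) ->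
  (\int[leb]_(x in `[a, b]) (f x)%:E = (F b - F a)%:E)%E.
Proof.
move=> a0 ab dF cf; have b0 := lt_trans a0 ab.
have cF (x : R) : 0 < x -> {for x, continuous F}.
  by move=> x0; apply: differentiable_continuous; apply/derivable1_diffP; apply: ex_derive; exact: dF.
rewrite EFinB; apply: continuous_FTC2 => //.
- apply: continuous_in_subspaceT => x; rewrite inE /= in_itv /= => /andP[ax _].
  exact/cf/(lt_le_trans a0).
- split.
  + move=> x; rewrite in_itv /= => /andP[ax _].
    by apply: ex_derive; apply: dF; exact: lt_trans ax.
  + by apply: cvg_at_right_filter; exact: cF.
  + by apply: cvg_at_left_filter; exact: cF.
- move=> x; rewrite in_itv /= => /andP[ax _]; rewrite derive1E.
  have x0 := lt_trans a0 ax.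
  by apply: derive_val; exact: dF.
Qed.

(* The index n + 2 makes every J n a nondegenerate segment. *)
Let J n : set R := `[(n.+2%:R)^-1, n.+2%:R]%classic.

Let JE : \bigcup_n J n = Rpos.
Proof.
apply/seteqP; split=> x.
  move=> [n _]; rewrite /J /= !in_itv /= andbT => /andP[h _].
  by apply: lt_le_trans h; rewrite invr_gt0.
rewrite /= in_itv /= andbT => x0.
exists (Num.truncn (x + x^-1)) => //; rewrite /J /= in_itv /=.
have h : x + x^-1 <= (Num.truncn (x + x^-1)).+2%:R.
  have /andP[_ /ltW h] := Num.Theory.truncn_itv (addr_ge0 (ltW x0) (eqbRL (invr_ge0 x) (ltW x0))).
  by apply: (le_trans h); rewrite ler_nat.
apply/andP; split; last by apply: le_trans h; rewrite lerDl invr_ge0 ltW.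
rewrite invf_ple ?posrE//; apply: le_trans h; by rewrite lerDr ltW.
Qed.

Let J_nd : nondecreasing_seq J.
Proof.
move=> m n mn; apply/subsetPset => x; rewrite /J /= !in_itv /= => /andP[h1 h2].
rewrite (le_trans _ h1) ?(le_trans h2) ?ler_nat ?ltnS//.
by rewrite lef_pV2 ?posrE// ler_nat !ltnS.
Qed.

Let J_gt0 n x : J n x -> 0 < x.
Proof. by rewrite /J /= in_itv /= => /andP[+ _]; apply: lt_le_trans; rewrite invr_gt0. Qed.

Let J_FTC (F f : R -> R) n :
  (forall x : R, 0 < x -> is_derive x 1 F (f x)) ->
  (forall x : R, 0 < x -> {for x, continuous f}) ->
  (\int[leb]_(x in J n) (f x)%:E = (F n.+2%:R - F (n.+2%:R)^-1)%:E)%E.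
Proof.
move=> dF cf; apply: FTC_segment => //.
by rewrite (@lt_le_trans _ _ 1)// ?invf_lt1// ?ler1n// ltr1n.
Qed.

(** The integrals over the segments [J n], which exhaust the half-line, are increments of
    the primitive F. *)
Lemma integrable_bounded_primitive (F f : R -> R) (M : R) :
  (forall x : R, 0 < x -> is_derive x 1 F (f x)) ->
  (forall x : R, 0 < x -> {for x, continuous f}) ->
  (forall x : R, 0 < x -> 0 <= f x) -> (forall x : R, 0 < x -> `|F x| <= M) ->
  leb.-integrable Rpos (EFin \o f).
Proof.
move=> dF cf f0 FM; have mf := measurable_Rpos_continuous cf.
apply/integrableP; split; first exact/measurable_EFinP.
have h : (\int[leb]_(x in J i) `|(f x)%:E| @[i --> \oo] -->
    \int[leb]_(x in Rpos) `|(f x)%:E|)%E.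
  rewrite -JE; apply: ge0_nondecreasing_set_cvg_integral => //.
  - by move=> i; exact: measurable_itv.
  - move=> i; apply/measurable_EFinP; apply: measurableT_comp => //.
    by apply: measurable_funS mf => // x /J_gt0; rewrite /= in_itv /= andbT.
apply: (@le_lt_trans _ _ (M + M)%:E); last exact: ltry.
apply: (cvge_to_le h).
apply: nearW => n.
rewrite (_ : \int[leb]_(x in J n) _ = \int[leb]_(x in J n) (f x)%:E)%E; last first.
    apply: eq_integral => x; rewrite inE => /J_gt0 x0.
    by rewrite gee0_abs// lee_fin f0.
  rewrite (J_FTC _ dF cf) lee_fin (le_trans (ler_norm _))// (le_trans (ler_normB _ _))//.
  by rewrite lerD// FM// invr_gt0.
Qed.

Lemma Rintegral_primitive (F f : R -> R) (A B : R) :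
  (forall x : R, 0 < x -> is_derive x 1 F (f x)) ->
  (forall x : R, 0 < x -> {for x, continuous f}) ->
  leb.-integrable Rpos (EFin \o f) ->
  (fun n => F (n.+2%:R)^-1) @ \oo --> A -> (fun n => F n.+2%:R) @ \oo --> B ->
  \int[leb]_(x in Rpos) f x = B - A.
Proof.
move=> dF cf if_ FA FB; have mf := measurable_Rpos_continuous cf.
have h : (fun n => \int[leb]_(x in Rpos) (f \_ (J n)) x) @ \oo --> \int[leb]_(x in Rpos) f x.
  apply: (@Rintegral_dominated _ _ _ leb _ _ _ _ (fun x => `|f x|)) => //.
  - move=> n; apply/measurable_restrict => //; first exact: measurable_itv.
    apply: measurable_funS mf => //; exact: subIsetl.
  - move=> x x0; apply: cvg_near_cst.
    have [k _ Jk] : (\bigcup_n J n) x by rewrite JE.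
    near=> n; rewrite patchE mem_set//.
    have kn : (k <= n)%N by near: n; exists k.
    by have /subsetPset := @J_nd _ _ kn; exact.
  - exact: integrable_norm.
  - by move=> n x _; rewrite patchE; case: ifP; rewrite ?normr0.
apply: (cvg_unique _ h) => //.
rewrite (_ : (fun n => _) = (fun n => F n.+2%:R - F (n.+2%:R)^-1)); first exact: cvgB.
apply/funext => n; rewrite -Rintegral_mkcondr setIidr; last first.
  by move=> x /J_gt0; rewrite /= in_itv /= andbT.
by rewrite /Rintegral (J_FTC _ dF cf).
Unshelve. all: by end_near. Qed.

End half_line.

(** * The integrand of the Gamma integral *)

Section complex_derivative.
Context {R : realType}.
Implicit Types (f g : R -> R[i]) (a b c : R[i]).

Definition is_cderive f (x : R) a : Prop :=
  is_derive x 1 (fun t => Re (f t)) (Re a) /\ is_derive x 1 (fun t => Im (f t)) (Im a).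

Lemma is_cderive_eq f x a b : a = b -> is_cderive f x a -> is_cderive f x b.
Proof. by move=> ->. Qed.

Lemma eq_is_cderive f g x a : f =1 g -> is_cderive f x a -> is_cderive g x a.
Proof. by move=> /funext ->. Qed.

Lemma is_cderive_cst c x : is_cderive (fun=> c) x 0.
Proof. by split; exact: is_derive_cst. Qed.

Lemma is_cderiveD f g x a b :
  is_cderive f x a -> is_cderive g x b -> is_cderive (fun t => f t + g t) x (a + b).
Proof.
move=> [f1 f2] [g1 g2]; split.
- under eq_fun do rewrite cReD; rewrite cReD; exact: is_deriveD.
- under eq_fun do rewrite cImD; rewrite cImD; exact: is_deriveD.
Qed.

Lemma is_cderiveM f g x a b : is_cderive f x a -> is_cderive g x b ->
  is_cderive (fun t => f t * g t) x (a * g x + f x * b).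
Proof.
move=> [f1 f2] [g1 g2]; split.
- under eq_fun do rewrite cReM.
  apply: is_derive_eq; rewrite !cReD !cReM /GRing.scale /=; ring.
- under eq_fun do rewrite cImM.
  apply: is_derive_eq; rewrite !cImD !cImM /GRing.scale /=; ring.
Qed.

Lemma is_cderive_real (h : R -> R) (x dh : R) :
  is_derive x 1 h dh -> is_cderive (fun t => (h t)%:C) x dh%:C.
Proof. by split=> //; exact: is_derive_cst. Qed.

Lemma is_cderive_scale c (h : R -> R) (x dh : R) :
  is_derive x 1 h dh -> is_cderive (fun t => c * (h t)%:C) x (c * dh%:C).
Proof.
move=> /is_cderive_real dh'.
by apply: is_cderive_eq (is_cderiveM (is_cderive_cst c x) dh'); rewrite mul0r add0r.
Qed.

Lemma is_derive_expR_comp (g : R -> R) (x b : R) :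
  is_derive x 1 g b -> is_derive x 1 (fun t => expR (g t)) (expR (g x) * b).
Proof. exact: (is_derive1_comp (is_derive_expR (g x))). Qed.

Lemma is_cderive_cexp f x a :
  is_cderive f x a -> is_cderive (fun t => cexp (f t)) x (a * cexp (f x)).
Proof.
move=> [f1 f2].
have e1 := is_derive1_comp (is_derive_expR (Re (f x))) f1.
have c1 := is_derive1_comp (is_derive_cos (Im (f x))) f2.
have s1 := is_derive1_comp (is_derive_sin (Im (f x))) f2.
split; rewrite /cexp /=.
- apply: is_derive_eq (is_deriveM e1 c1) _; rewrite cReM /GRing.scale /=; ring.
- apply: is_derive_eq (is_deriveM e1 s1) _; rewrite cImM /GRing.scale /=; ring.
Qed.

Lemma is_cderive_continuous f x a : is_cderive f x a ->
  {for x, continuous (fun t => Re (f t))} /\ {for x, continuous (fun t => Im (f t))}.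
Proof.
by move=> [f1 f2]; split; apply: differentiable_continuous; apply/derivable1_diffP; exact: ex_derive.
Qed.

Lemma is_cderive0_cst f (u v : R) : (forall x, u < x < v -> is_cderive f x 0) ->
  forall x y, u < x < v -> u < y < v -> f x = f y.
Proof.
move=> df; have cst (h : R -> R) : (forall x, u < x < v -> is_derive x 1 h 0) ->
    forall x y, u < x < v -> u < y < v -> h x = h y.
  move=> dh; have le x y : u < x < v -> u < y < v -> x <= y -> h x = h y.
    move=> /andP[ux xv] /andP[uy yv] xy.
    have [z||z _] := @MVT_segment R h (fun=> 0) x y xy.
    - rewrite in_itv /= => /andP[xz zy]; apply: dh.
      by rewrite (lt_trans ux xz) (lt_trans zy yv).
    - apply: derivable_within_continuous => z; rewrite in_itv /= => /andP[xz zy].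
      by apply: ex_derive; apply: dh; rewrite (lt_le_trans ux xz) (le_lt_trans zy yv).
    by rewrite mul0r => /subr0_eq.
  by move=> x y hx hy; case: (leP x y) => [|/ltW] xy; [|symmetry]; exact: le.
move=> x y hx hy; apply: complex_ext.
- by apply: (cst (fun t => Re (f t))) => // t /df [].
- by apply: (cst (fun t => Im (f t))) => // t /df [].
Qed.

End complex_derivative.

Section mellin_kernel.
Context {R : realType}.
Notation leb := (@lebesgue_measure R).
Notation Rpos := (`]0%R, +oo[%classic : set R).
Implicit Types (z p q : R[i]) (x : R).

(** The function x^(z-1) e^(-px) of x > 0. *)
Definition mkernel z p x : R[i] := cexp ((z - 1) * (ln x)%:C - p * x%:C).

(** For Re z > 0 and Re p > 0, this will turn out to be p^(-z) Gamma z. *)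
Definition mintegral z p : R[i] := cintegral leb Rpos (mkernel z p).

Let mRpos : measurable (Rpos : set (measurableTypeR R)).
Proof. exact: measurable_itv. Qed.

Lemma normc_mkernel z p x :
  normc (mkernel z p x) = expR ((Re z - 1) * ln x - Re p * x).
Proof. by rewrite normc_cexp !ReImE /= !mulr0 !subr0. Qed.

Lemma mkernel_real (r c x : R) :
  mkernel r%:C c%:C x = (expR ((r - 1) * ln x - c * x))%:C.
Proof. by rewrite -cexp_real /mkernel !rmorphB /= !rmorphM /= rmorphB. Qed.

Lemma mkernelS z p x : 0 < x -> mkernel (z + 1) p x = x%:C * mkernel z p x.
Proof.
move=> x0; rewrite -[X in X%:C * _](@lnK R x) ?posrE// -cexp_real -cexpD.
congr cexp; ring.
Qed.

Lemma mkernelDp z p q x : mkernel z (p + q) x = mkernel z p x * cexp (- (q * x%:C)).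
Proof. by rewrite -cexpD; congr cexp; ring. Qed.

Lemma cmeasurable_mkernel z p : cmeasurable Rpos (mkernel z p).
Proof.
apply: (@cmeasurable_cexp _ _ _ _ (fun x => (z - 1) * (ln x)%:C - p * x%:C)).
apply: cmeasurableD.
  apply: cmeasurableM; first exact: cmeasurable_cst.
  by apply: cmeasurable_real; exact: measurable_funTS.
have -> : (fun x => - (p * x%:C)) = (fun x => - p * x%:C).
  by apply/funext => x; rewrite mulNr.
apply: cmeasurableM; first exact: cmeasurable_cst.
by apply: cmeasurable_real; exact: measurable_funTS.
Qed.

Lemma euler_gammaE z : euler_gamma z = mintegral z 1.
Proof.
apply: eq_cintegral => x; rewrite inE /= in_itv /= andbT => x0.
by rewrite /cpow clog_real// -cexpD; congr cexp; rewrite mul1r.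
Qed.

(** Apply log u <= u to u = c (1+x) / (r+1). *)
Lemma ln1D_le (r c : R) : 0 < r -> 0 < c ->
  exists K, forall x, 0 < x -> (r + 1) * ln (1 + x) <= c * x + K.
Proof.
move=> r0 c0; have r1 : 0 < r + 1 by rewrite addr_gt0.
exists (c - (r + 1) * ln (c / (r + 1))) => x x0.
have x1 : 0 < 1 + x by rewrite addr_gt0.
have cr : 0 < c / (r + 1) by rewrite divr_gt0.
have := ltW (ln_sublinear (mulr_gt0 cr x1)).
rewrite (@lnM R (c / (r + 1)) (1 + x)) ?posrE// => /(ler_wpM2l (ltW r1)).
rewrite mulrDr => h.
have e : (r + 1) * (c / (r + 1) * (1 + x)) = c * x + c by field; rewrite gt_eqF.
by rewrite e in h; lra.
Qed.

(** By [ln1D_le], the integrand is dominated by a multiple of x^(r-1) (1+x)^(-r-1), whose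
    primitive (x / (1+x))^r / r is bounded. *)
Lemma integrable_power_exp (r c : R) : 0 < r -> 0 < c ->
  leb.-integrable Rpos (fun x => (expR ((r - 1) * ln x - c * x))%:E).
Proof.
move=> r0 c0; have [K hK] := ln1D_le r0 c0.
pose A (x : R) := expR (r * (ln x - ln (1 + x))).
pose f (x : R) := r * expR ((r - 1) * ln x - (r + 1) * ln (1 + x)).
have dln1 (x : R) : 0 < x -> is_derive x 1 (fun x => ln (1 + x)) (1 + x)^-1.
  move=> x0; have d1 : is_derive x 1 (fun x : R => 1 + x) 1.
    by have := is_deriveD (is_derive_cst (1 : R) x 1) (is_derive_id x 1); rewrite add0r.
  have x1 : 0 < 1 + x by rewrite addr_gt0.
  by have := is_derive1_comp (is_derive1_ln x1) d1; rewrite mulr1.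
have dA (x : R) : 0 < x -> is_derive x 1 A (f x).
  move=> x0; have x1 : 0 < 1 + x by rewrite addr_gt0.
  have d2 : is_derive x 1 (fun x => r * (ln x - ln (1 + x))) (r * (x^-1 - (1 + x)^-1)).
    have := dln1 x x0; have := is_derive1_ln x0 => d3 d4.
    by apply: is_derive_eq; rewrite /GRing.scale /=; ring.
  have := is_derive_expR_comp d2.
  move/is_derive_eq; apply; rewrite /f mulrCA; congr (_ * _).
  have -> : x^-1 - (1 + x)^-1 = expR (- ln x - ln (1 + x)).
    rewrite expRD !expRN !lnK ?posrE//; field.
    by rewrite !gt_eqF.
  by rewrite -expRD; congr expR; ring.
have cf (x : R) : 0 < x -> {for x, continuous f}.
  move=> x0; apply: differentiable_continuous; apply/derivable1_diffP.
  have := dln1 x x0; have := is_derive1_ln x0 => d3 d4.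
  have d5 : is_derive x 1 (fun x => (r - 1) * ln x - (r + 1) * ln (1 + x))
     ((r - 1) * x^-1 - (r + 1) * (1 + x)^-1).
    by apply: is_derive_eq; rewrite /GRing.scale /=; ring.
  have d6 := is_derive_expR_comp d5.
  by rewrite /f; apply: ex_derive.
have if_ : leb.-integrable Rpos (EFin \o f).
  apply: (integrable_bounded_primitive dA cf (M := 1)).
  - by move=> x _; rewrite mulr_ge0 ?expR_ge0// ltW.
  - move=> x x0; rewrite ger0_norm ?expR_ge0// -expR0 ler_expR.
    rewrite pmulr_rle0// subr_le0 ler_ln ?posrE ?lerDr ?addr_gt0//.
have ifK := integrableZl mRpos (expR K / r) if_.
apply: (le_integrable mRpos _ _ ifK).
  apply/measurable_EFinP; apply: measurable_Rpos_continuous => x x0.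
  apply: differentiable_continuous; apply/derivable1_diffP.
  have d3 := is_derive1_ln x0.
  have d5 : is_derive x 1 (fun x => (r - 1) * ln x - c * x) ((r - 1) * x^-1 - c).
    by apply: is_derive_eq; rewrite /GRing.scale /=; ring.
  have d6 := is_derive_expR_comp d5.
  exact: ex_derive.
move=> x /=; rewrite in_itv /= andbT => x0; rewrite lee_fin.
rewrite ger0_norm ?expR_ge0// (le_trans _ (ler_norm _))// /f.
rewrite mulrA divfK ?gt_eqF// -expRD ler_expR.
by have := hK x x0; lra.
Qed.

Lemma cintegrable_mkernel z p : 0 < Re z -> 0 < Re p ->
  cintegrable leb Rpos (mkernel z p).
Proof.
move=> z0 p0; apply: (cintegrable_le mRpos (cmeasurable_mkernel z p) (integrable_power_exp z0 p0)).
move=> x _.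
by rewrite normc_mkernel.
Qed.

End mellin_kernel.

(** * Laplace transform of a power *)

Section laplace_of_powers.
Context {R : realType}.
Notation leb := (@lebesgue_measure R).
Notation Rpos := (`]0%R, +oo[%classic : set R).
Implicit Types (z p l : R[i]).

Let mRpos : measurable (Rpos : set (measurableTypeR R)).
Proof. exact: measurable_itv. Qed.

Lemma cintegral_primitive0 (F f : R -> R[i]) (h : R -> R) :
  (forall x : R, 0 < x -> is_cderive F x (f x)) ->
  (forall x : R, 0 < x -> exists a, is_cderive f x a) ->
  cintegrable leb Rpos f ->
  (forall x : R, 0 < x -> normc (F x) <= h x) ->
  (fun n => h (n.+2%:R)^-1) @ \oo --> 0 -> (fun n => h n.+2%:R) @ \oo --> 0 ->
  cintegral leb Rpos f = 0.
Proof.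
move=> dF df [i1 i2] Fh h1 h2.
have lim0 (G : R -> R) : (forall x, 0 < x -> `|G x| <= h x) ->
    ((fun n => G (n.+2%:R)^-1) @ \oo --> 0) /\ ((fun n => G n.+2%:R) @ \oo --> 0).
  move=> Gh; split; apply/norm_cvg0P.
  - apply: (@squeeze_cvgr _ _ _ _ (fun=> 0) _ _ _ _ _ h1); last exact: cvg_cst.
    by apply: nearW => n; rewrite normr_ge0 Gh// invr_gt0.
  - apply: (@squeeze_cvgr _ _ _ _ (fun=> 0) _ _ _ _ _ h2); last exact: cvg_cst.
    by apply: nearW => n; rewrite normr_ge0 Gh.
have [r1 r2] := lim0 (fun x => Re (F x)) (fun x x0 => le_trans (normc_Re_le _) (Fh x x0)).
have [j1 j2] := lim0 (fun x => Im (F x)) (fun x x0 => le_trans (normc_Im_le _) (Fh x x0)).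
apply: complex_ext => /=; (transitivity (0 - 0 : R); last by rewrite subr0).
- apply: Rintegral_primitive i1 r1 r2 => x x0; first exact: (dF x x0).1.
  by have [a /is_cderive_continuous[]] := df x x0.
- apply: Rintegral_primitive i2 j1 j2 => x x0; first exact: (dF x x0).2.
  by have [a /is_cderive_continuous[]] := df x x0.
Qed.

Let is_cderive_exponent (a p : R[i]) (x : R) : 0 < x ->
  is_cderive (fun x : R => a * (ln x)%:C - p * x%:C) x (a * (x^-1)%:C - p).
Proof.
move=> x0.
have h1 := is_cderive_scale a (is_derive1_ln x0).
have h2 := is_cderive_scale (- p) (is_derive_id x (1 : R)).
apply: is_cderive_eq (eq_is_cderive _ (is_cderiveD h1 h2)).
  by rewrite mulr1.
by move=> t; rewrite mulNr.
Qed.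

(** Integration by parts: the derivative of x^z e^(-px) integrates to 0. *)
Lemma mintegralS z p : 0 < Re z -> 0 < Re p ->
  p * mintegral (z + 1) p = z * mintegral z p.
Proof.
move=> z0 p0.
have z1 : 0 < Re (z + 1) by rewrite cReD addr_gt0.
have iz := cintegrable_mkernel z0 p0; have iz1 := cintegrable_mkernel z1 p0.
pose F (x : R) := cexp (z * (ln x)%:C - p * x%:C).
pose f (x : R) := z * mkernel z p x - p * mkernel (z + 1) p x.
have [K hK] := ln1D_le z0 p0.
have Fm (x : R) : mkernel (z + 1) p x = F x by rewrite /mkernel addrK.
have cint : cintegral leb Rpos f = z * mintegral z p - p * mintegral (z + 1) p.
  rewrite /mintegral -!cintegralZ// -cintegralB//.
  - exact: (cintegrableZ mRpos z iz).
  - exact: (cintegrableZ mRpos p iz1).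
have bnd0 (x : R) : 0 < x ->
    expR (K + Re z * ln x - (Re z + 1) * ln (1 + x)) <= expR K * x `^ Re z.
  move=> x0; rewrite /powR gt_eqF// -expRD ler_expR gerDl oppr_le0 mulr_ge0//.
    by rewrite addr_ge0// ltW.
  by rewrite ln_ge0// lerDl ltW.
have bndy (x : R) : 0 < x ->
    expR (K + Re z * ln x - (Re z + 1) * ln (1 + x)) <= expR K * x^-1.
  move=> x0; have x1 : 0 < 1 + x by rewrite addr_gt0.
  have h1 : ln x <= ln (1 + x) by rewrite ler_ln ?posrE// lerDr.
  rewrite -[x in x^-1]lnK ?posrE// -expRN -expRD ler_expR.
  by have := ler_wpM2l (ltW z0) h1; lra.
suff : cintegral leb Rpos f = 0 by rewrite cint => /subr0_eq ->.
apply: (@cintegral_primitive0 F f (fun x => expR (K + Re z * ln x - (Re z + 1) * ln (1 + x)))).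
- move=> x x0; apply: is_cderive_eq (is_cderive_cexp (is_cderive_exponent z p x0)).
  rewrite /f Fm mulrBl; congr (_ - _); rewrite -mulrA; congr (_ * _).
  rewrite -/(F x) -(Fm x) mkernelS// mulrA -rmorphM /= mulVf ?gt_eqF//.
  by rewrite rmorph1 mul1r.
- move=> x x0.
  have d1 := is_cderive_cexp (is_cderive_exponent (z - 1) p x0).
  have d2 := is_cderive_cexp (is_cderive_exponent (z + 1 - 1) p x0).
  have d3 := is_cderiveM (is_cderive_cst z x) d1.
  have d4 := is_cderiveM (is_cderive_cst (- p) x) d2.
  eexists; apply: eq_is_cderive (is_cderiveD d3 d4) => t.
  by rewrite /f mulNr.
- exact: (cintegrableB mRpos (cintegrableZ mRpos z iz) (cintegrableZ mRpos p iz1)).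
- move=> x x0; rewrite normc_cexp !cReD cReN !cReM /= !mulr0 !subr0 ler_expR.
  by have := hK x x0; lra.
- apply: (@squeeze_cvgr _ _ _ _ (fun=> 0) (fun n => expR K * (n.+2%:R)^-1 `^ Re z)).
  + by apply: nearW => n; rewrite expR_ge0 bnd0 ?invr_gt0.
  + exact: cvg_cst.
  + rewrite -[X in _ --> X](mulr0 (expR K)); apply: cvgM; first exact: cvg_cst.
    move/cvg_at_rightP : (powR_cvg0 z0); apply; split; first by move=> n; rewrite invr_gt0.
    by have := @cvg_harmonic R; rewrite -cvg_shiftS.
- apply: (@squeeze_cvgr _ _ _ _ (fun=> 0) (fun n => expR K * (n.+2%:R)^-1)).
  + by apply: nearW => n; rewrite expR_ge0 bndy.
  + exact: cvg_cst.
  + rewrite -[X in _ --> X](mulr0 (expR K)); apply: cvgM; first exact: cvg_cst.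
    by have := @cvg_harmonic R; rewrite -cvg_shiftS.
Qed.

Lemma is_derive_Rintegral (f df : R -> R -> R) (G : R -> R) (u v a : R) :
  u < a < v ->
  (forall s, u < s < v -> leb.-integrable Rpos (EFin \o f s)) ->
  (forall s x, u < s < v -> 0 < x -> is_derive s 1 (f ^~ x) (df s x)) ->
  (forall x, 0 <= G x) -> leb.-integrable Rpos (EFin \o G) ->
  (forall s x, u < s < v -> 0 < x -> `|df s x| <= G x) ->
  is_derive a 1 (fun s => \int[leb]_(x in Rpos) f s x) (\int[leb]_(x in Rpos) df a x).
Proof.
move=> uav fi dfs G0 iG dG.
have Ia : `]u, v[%classic a by rewrite /= in_itv.
have intf s : `]u, v[%classic s -> leb.-integrable Rpos (EFin \o f s).
  by rewrite /= in_itv /=; exact: fi.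
have der s x : `]u, v[%classic s -> Rpos x -> derivable (f ^~ x) s 1.
  by rewrite /= !in_itv /= andbT => us x0; apply: ex_derive; exact: dfs.
have p1 s x : u < s < v -> 0 < x -> partial1of2 f s x = df s x.
  by move=> us x0; rewrite partial1of2E; apply: derive_val; exact: dfs.
have ub s x : `]u, v[%classic s -> Rpos x -> `|partial1of2 f s x| <= G x.
  by rewrite /= !in_itv /= andbT => us x0; rewrite p1// dG.
have h1 := @derivable_under_integral R _ _ leb f Rpos mRpos a u v Ia intf der G G0 iG ub.
have h2 := @differentiation_under_integral R _ _ leb f Rpos mRpos a u v Ia intf der G G0 iG ub.
apply: DeriveDef h1 _; rewrite -derive1E h2; apply: eq_Rintegral => x.
by rewrite inE /= in_itv /= andbT => x0; rewrite p1.
Qed.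

(** The derivative of the integrand in s is -l e^(sl) times the integrand for z + 1, which
    [mintegralS] brings back to z. *)
Lemma is_cderive_mintegral z l (c M u v a : R) : 0 < Re z -> 0 < c -> u < a < v ->
  (forall s : R, u < s < v -> c <= Re (cexp (s%:C * l))) ->
  (forall s : R, u < s < v -> normc (cexp (s%:C * l)) <= M) ->
  is_cderive (fun s : R => mintegral z (cexp (s%:C * l))) a
    (- (l * z) * mintegral z (cexp (a%:C * l))).
Proof.
move=> z0 c0 uav cP PM.
pose P (s : R) := cexp (s%:C * l).
have P0 s : u < s < v -> 0 < Re (P s) by move=> us; apply: lt_le_trans (cP s us).
have z1 : 0 < Re (z + 1) by rewrite cReD addr_gt0.
pose df (s x : R) := - (l * P s) * mkernel (z + 1) (P s) x.
have dP s : is_cderive P s (l * P s).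
  have h := is_cderive_cexp (is_cderive_scale l (is_derive_id s (1 : R))).
  rewrite mulr1 in h; apply: is_cderive_eq (eq_is_cderive _ h); first by rewrite /P mulrC [l * _%:C]mulrC mulrC.
  by move=> t; rewrite mulrC.
have dm s (x : R) : 0 < x -> is_cderive (fun s => mkernel z (P s) x) s (df s x).
  move=> x0.
  have h := is_cderiveD (is_cderive_cst ((z - 1) * (ln x)%:C) s)
    (is_cderiveM (dP s) (is_cderive_cst (- x%:C) s)).
  apply: is_cderive_eq (eq_is_cderive _ (is_cderive_cexp h)).
    rewrite /df mkernelS// /mkernel !mulrN mulr0 addr0 add0r; ring.
  by move=> t; rewrite /mkernel mulrN.
pose G (x : R) := normc l * M * expR ((Re z + 1 - 1) * ln x - c * x).
have a0 : 0 <= M by apply: le_trans (PM a uav); exact: normc_ge0.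
have G0 x : 0 <= G x by rewrite mulr_ge0 ?expR_ge0// mulr_ge0 ?normc_ge0.
have iG : leb.-integrable Rpos (EFin \o G).
  have r0 : 0 < Re z + 1 by rewrite addr_gt0.
  exact: (integrableZl mRpos (normc l * M) (integrable_power_exp r0 c0)).
have dG s x : u < s < v -> 0 < x -> normc (df s x) <= G x.
  move=> us x0; rewrite /df Normc.normcM normcN Normc.normcM normc_mkernel /G.
  rewrite ler_pM ?expR_ge0 ?mulr_ge0 ?normc_ge0//.
    by rewrite ler_wpM2l ?normc_ge0 ?PM.
  by rewrite ler_expR cReD /= lerD2l lerN2 ler_wpM2r ?cP// ltW.
have im s : u < s < v -> cintegrable leb Rpos (mkernel z (P s)).
  by move=> us; apply: cintegrable_mkernel => //; exact: P0.
have <- : cintegral leb Rpos (df a) = - (l * z) * mintegral z (P a).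
  rewrite /df cintegralZ//; last by apply: cintegrable_mkernel => //; exact: P0.
  by rewrite !mulNr -!mulrA mintegralS// P0.
split.
- apply: (@is_derive_Rintegral (fun s x => Re (mkernel z (P s) x)) (fun s x => Re (df s x)) G u v) => //.
  + by move=> s /im [].
  + by move=> s x us x0; exact: (dm s x x0).1.
  + by move=> s x us x0; rewrite (le_trans (normc_Re_le _))// dG.
- apply: (@is_derive_Rintegral (fun s x => Im (mkernel z (P s) x)) (fun s x => Im (df s x)) G u v) => //.
  + by move=> s /im [].
  + by move=> s x us x0; exact: (dm s x x0).2.
  + by move=> s x us x0; rewrite (le_trans (normc_Im_le _))// dG.
Qed.

(** Both sides agree at p = 1, and along the path e^(s log p) from 1 to p the
    logarithmic derivative of the integral in s is constantly - z log p. *)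
Lemma mintegralE z p : 0 < Re z -> 0 < Re p ->
  mintegral z p = cpow p (- z) * euler_gamma z.
Proof.
move=> z0 p0; pose l := clog p; pose b := `|carg p|; pose a := ln (normc p).
have b1 : b < pi / 2 := carg_lt p0.
have b0 : 0 <= b by rewrite normr_ge0.
(* The factor del extends the path beyond its ends while keeping its argument below k,
   hence its real part away from 0. *)
pose k := (b + pi / 2) / 2; pose del := (k - b) / (b + 1).
have pi4 : pi / 2 <= 2 :> R by have := @pihalf_02_cos_pihalf R => -[/andP[_]].
have bk : b < k by rewrite /k; lra.
have kpi : k < pi / 2 by rewrite /k; lra.
have bb : 0 < b + 1 by lra.
have del0 : 0 < del by rewrite divr_gt0// subr_gt0.
have del1 : del <= 1 by rewrite ler_pdivrMr// mul1r /k; lra.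
have delb : del * (b + 1) = k - b by rewrite /del divfK// gt_eqF.
have vb : (1 + del) * b <= k by have : 0 < del by []; rewrite -subr_ge0; nra.
have cosk : 0 < cos k by apply: cos_gt0_pihalf; rewrite kpi andbT; lra.
have sb (s : R) : - (1 + del) < s < 1 + del -> cos k <= cos (s * carg p).
  move=> /andP[s1 s2]; rewrite -[cos (s * _)]cos_norm normrM -/b.
  have sle : `|s| <= 1 + del by rewrite ler_norml; apply/andP; split; lra.
  have sbk : `|s| * b <= k by apply: le_trans vb; rewrite ler_wpM2r.
  have [->//|ne] := eqVneq (`|s| * b) k.
  have lt : `|s| * b < k by rewrite lt_neqAle ne.
  have pi0 := @pi_gt0 R.
  apply: ltW; rewrite ltr_cos// in_itv /=; apply/andP; split.
  - by rewrite mulr_ge0.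
  - lra.
  - lra.
  - lra.
have sa (s : R) : - (1 + del) < s < 1 + del -> `|s * a| <= 2 * `|a|.
  move=> /andP[s1 s2]; rewrite normrM ler_wpM2r//.
  by rewrite ler_norml; apply/andP; split; lra.
have v1 : - (1 + del) < 1 < 1 + del by apply/andP; split; lra.
have v0 : - (1 + del) < 0 < 1 + del by apply/andP; split; lra.
have der s (us : - (1 + del) < s < 1 + del) :=
  @is_cderive_mintegral z l (expR (- (2 * `|a|)) * cos k) (expR (2 * `|a|)) _ _ s z0
    (mulr_gt0 (expR_gt0 _) cosk) us.
have ReP (s : R) : Re (cexp (s%:C * l)) = expR (s * a) * cos (s * carg p).
  by rewrite /l /clog /= !mul0r subr0 addr0.
have {}der s : - (1 + del) < s < 1 + del -> is_cderive (fun s : R => mintegral z (cexp (s%:C * l))) s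
    (- (l * z) * mintegral z (cexp (s%:C * l))).
  move=> us; apply: der => // t ut.
  - rewrite ReP; apply: ler_pM; [exact: expR_ge0|exact: ltW| |exact: sb].
    by rewrite ler_expR; have := sa t ut; rewrite ler_norml => /andP[].
  - rewrite normc_cexp !ReImE /= mul0r subr0 ler_expR.
    by apply: le_trans (sa t ut); exact: ler_norm.
(* W is the quotient of the integral by its expected value, up to a constant. *)
pose W (s : R) := cexp (l * z * s%:C) * mintegral z (cexp (s%:C * l)).
have W10 : W 1 = W 0.
  apply: (is_cderive0_cst _ v1 v0) => s us.
  have d1 := is_cderive_cexp (is_cderive_scale (l * z) (is_derive_id s (1 : R))).
  apply: is_cderive_eq (is_cderiveM d1 (der s us)); rewrite mulr1; ring.
have : cexp (l * z) * mintegral z p = mintegral z 1.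
  by move: W10; rewrite /W mulr1 mul1r cexp_clog// mulr0 mul0r !cexp0 mul1r.
rewrite euler_gammaE => <-; rewrite mulrA /cpow mulNr -/l [z * l]mulrC.
by rewrite cexpNK mul1r.
Qed.

End laplace_of_powers.

(** * Bounds for the Gamma function *)

Section gamma_bounds.
Context {R : realType}.
Notation leb := (@lebesgue_measure R).
Notation Rpos := (`]0%R, +oo[%classic : set R).
Implicit Types (z p : R[i]) (r c x y : R).

Let mRpos : measurable (Rpos : set (measurableTypeR R)).
Proof. exact: measurable_itv. Qed.

Definition rgamma r : R := \int[leb]_(x in Rpos) expR ((r - 1) * ln x - x).

Lemma integrable_rgamma r : 0 < r ->
  leb.-integrable Rpos (fun x => (expR ((r - 1) * ln x - x))%:E).
Proof.
move=> r0; apply: eq_integrable (integrable_power_exp r0 ltr01) => // x _.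
by rewrite mul1r.
Qed.

Lemma mintegral_real r c : mintegral r%:C c%:C =
  (\int[leb]_(x in Rpos) expR ((r - 1) * ln x - c * x))%:C.
Proof.
apply: complex_ext.
- by apply: eq_Rintegral => x _; rewrite mkernel_real.
- transitivity (\int[leb]_(x in Rpos) (cst 0 x : R)).
    by apply: eq_Rintegral => x _; rewrite mkernel_real.
  by rewrite Rintegral_cst// mul0r.
Qed.

Lemma euler_gamma_real r : euler_gamma r%:C = (rgamma r)%:C.
Proof.
rewrite euler_gammaE -(rmorph1 (real_complex R)) mintegral_real; congr _%:C.
by apply: eq_Rintegral => x _; rewrite mul1r.
Qed.

Lemma Rintegral_power_exp r c : 0 < r -> 0 < c ->
  \int[leb]_(x in Rpos) expR ((r - 1) * ln x - c * x) = expR (- (r * ln c)) * rgamma r.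
Proof.
move=> r0 c0; apply: (@complexI R); rewrite -mintegral_real mintegralE//.
rewrite euler_gamma_real /cpow clog_real//.
by rewrite -rmorphN -rmorphM cexp_real -rmorphM mulNr.
Qed.

Lemma euler_gammaS z : 0 < Re z -> euler_gamma (z + 1) = z * euler_gamma z.
Proof. by move=> z0; rewrite !euler_gammaE -mintegralS ?mul1r//= ltr01. Qed.

Lemma rgammaS r : 0 < r -> rgamma (r + 1) = r * rgamma r.
Proof.
move=> r0; apply: (@complexI R); rewrite rmorphM /= -!euler_gamma_real.
by rewrite rmorphD rmorph1 euler_gammaS.
Qed.

Lemma rgamma_ge0 r : 0 <= rgamma r.
Proof. by apply: Rintegral_ge0 => x _; exact: expR_ge0. Qed.

(** The integrand is at least m on the segment [1, 2]. *)
Lemma rgamma_gt0 r : 0 < r -> 0 < rgamma r.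
Proof.
move=> r0; pose m := expR (- `|r - 1| * ln 2 - 2).
apply: (@lt_le_trans _ _ m); first exact: expR_gt0.
have ig := integrable_rgamma r0.
have -> : m = \int[leb]_(x in `[1%R, 2%R]) m.
  rewrite Rintegral_cst//= lebesgue_measure_itv /= lte_fin ltr1n -EFinB /=; lra.
rewrite /rgamma /Rintegral -lee_fin !fineK.
- apply: (@le_trans _ _ (\int[leb]_(x in `[1%R, 2%R]) (expR ((r - 1) * ln x - x))%:E)%E).
    apply: ge0_le_integral => //.
    + by move=> x _; rewrite lee_fin expR_ge0.
    + have := measurable_int leb ig; apply: measurable_funS => // x.
      by rewrite /= !in_itv /= andbT => /andP[+ _]; apply: lt_le_trans.
    + move=> x; rewrite /= in_itv /= => /andP[x1 x2]; rewrite lee_fin ler_expR.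
      have x0 : 0 < x by apply: lt_le_trans x1.
      have l0 : 0 <= ln x by apply: ln_ge0.
      have l2 : ln x <= ln 2 by rewrite ler_ln ?posrE.
      have h1 : - `|r - 1| * ln 2 <= - `|r - 1| * ln x.
        by rewrite !mulNr lerN2 ler_wpM2l.
      have h2 : - `|r - 1| * ln x <= (r - 1) * ln x.
        by rewrite ler_wpM2r// lerNl -normrN ler_norm.
      lra.
  apply: ge0_subset_integral => //.
  + exact: (measurable_int leb ig).
  + move=> x; rewrite /= !in_itv /= andbT => /andP[+ _]; exact: lt_le_trans.
- exact: integrable_fin_num.
- rewrite integral_cst//= lebesgue_measure_itv /= lte_fin ltr1n -EFinB.
  by [].
Qed.


Let le0_of_derive (f df : R -> R) : (forall t, is_derive t (1 : R) f (df t)) ->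
  (forall t, 0 <= t -> 0 <= df t) -> forall x, 0 <= x -> f 0 <= f x.
Proof.
move=> fd d0 x x0.
have [|c + e] := @MVT_segment R f df 0 x x0 (fun t _ => fd t).
  by apply: derivable_within_continuous => t _; apply: ex_derive; exact: fd.
rewrite in_itv /= => /andP[c0 _].
by rewrite -subr_ge0 e subr0 mulr_ge0// d0.
Qed.

Lemma sin_le_id x : 0 <= x -> sin x <= x.
Proof.
move=> x0; rewrite -subr_ge0 -[X in X <= _](_ : 0 - sin 0 = 0); last by rewrite sin0 subr0.
apply: (@le0_of_derive (fun t => t - sin t) (fun t => 1 - cos t) _ _ x x0) => t _.
by rewrite subr_ge0 cos_le1.
Qed.

Lemma cos_ge x : 1 - x ^+ 2 / 2 <= cos x.
Proof.
wlog x0 : x / 0 <= x.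
  by move=> h; have := h `|x| (normr_ge0 x); rewrite cos_norm real_normK ?num_real.
have : cos 0 + 0 ^+ 2 / 2 <= cos x + x ^+ 2 / 2.
  apply: (@le0_of_derive (fun t => cos t + t ^+ 2 / 2) (fun t => t - sin t) _ _ x x0).
    by move=> t; apply: is_derive_eq; rewrite /GRing.scale /=; field.
  by move=> t t0; rewrite subr_ge0 sin_le_id.
by rewrite cos0 expr0n /= mul0r addr0; lra.
Qed.

(** With w = 2h and h >= 0, the bracket is (e^h - e^(-h))^2, and e^h - e^(-h) >= h. *)
Lemma sqr_le_cosh (w : R) : w ^+ 2 <= 4 * (expR w + expR (- w) - 2).
Proof.
wlog w0 : w / 0 <= w.
  move=> h; have [/h//|/ltW w0] := leP 0 w.
  by have := h (- w); rewrite oppr_ge0 => /(_ w0); rewrite sqrrN opprK [expR (- w) + _]addrC.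
pose h := w / 2.
have h0 : 0 <= h by rewrite divr_ge0.
pose a := expR h; pose b := expR (- h).
have a1 : 1 + h <= a by exact: expR_ge1Dx.
have ab : a * b = 1 by rewrite -expRD subrr expR0.
have ew : expR w = a ^+ 2 by rewrite expr2 -expRD; congr expR; rewrite /h; field.
have eb : expR (- w) = b ^+ 2 by rewrite expr2 -expRD; congr expR; rewrite /h; field.
have b0 : 0 <= b by exact: expR_ge0.
have b1 : b <= 1 by rewrite -expR0 ler_expR oppr_le0.
have e : expR w + expR (- w) - 2 = (a - b) ^+ 2 by rewrite ew eb sqrrB ab; ring.
have -> : w ^+ 2 = 4 * h ^+ 2 by rewrite /h; field.
rewrite e ler_pM2l// -subr_ge0 subr_sqr mulr_ge0//; lra.
Qed.

(** Under the Gamma distribution, with density t^(x-1) e^(-t) / Gamma x, the phase y log t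
    of t^(iy) stays close to y log x: since log^2 u <= 4 (u + 1/u - 2), the mean of
    log^2 (t/x) is at most 4 / (x-1), by the values of Gamma at x-1, x and x+1. *)
Lemma euler_gamma_lower z : 2 < Re z ->
  rgamma (Re z) * (1 - 2 * Im z ^+ 2 / (Re z - 1)) <= normc (euler_gamma z).
Proof.
set x := Re z; set y := Im z => x2.
have x0 : 0 < x by lra.
have xm0 : 0 < x - 1 by lra.
(* th is the conjugate of the phase x^(iy). *)
pose th := cexp (- (0 +i* y * (ln x)%:C)).
have nth : normc th = 1 by rewrite normc_cexp !ReImE /= !mul0r !mulr0 subr0 oppr0 expR0.
have z0 : 0 < Re z by [].
have p1 : 0 < Re (1 : R[i]) by exact: ltr01.
have im := cintegrable_mkernel z0 p1.
have -> : normc (euler_gamma z) = normc (th * euler_gamma z).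
  by rewrite Normc.normcM nth mul1r.
apply: le_trans (normc_Re_le _); apply: le_trans (ler_norm _).
rewrite euler_gammaE /mintegral -cintegralZ//.
rewrite [X in _ <= X](_ : _ = \int[leb]_(t in Rpos) Re (th * mkernel z 1 t))//.
pose E (r t : R) := expR ((r - 1) * ln t - t).
have iE r : 0 < r -> leb.-integrable Rpos (EFin \o E r) by exact: integrable_rgamma.
have i1 := iE x x0.
have x1 : 0 < x + 1 by lra.
have i2 := iE (x + 1) x1.
have i3 := iE (x - 1) xm0.
pose g (t : R) := (1 + 4 * y ^+ 2) * E x t - 2 * y ^+ 2 / x * E (x + 1) t
   - 2 * y ^+ 2 * x * E (x - 1) t.
have s1 := integrableZl mRpos (1 + 4 * y ^+ 2) i1.
have s2 := integrableZl mRpos (2 * y ^+ 2 / x) i2.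
have s3 := integrableZl mRpos (2 * y ^+ 2 * x) i3.
have s12 := integrableB mRpos s1 s2.
have ig : leb.-integrable Rpos (EFin \o g).
  by apply: eq_integrable (integrableB mRpos s12 s3) => // t _.
apply: (@le_trans _ _ (\int[leb]_(t in Rpos) g t)).
  rewrite /g RintegralB// RintegralB// !RintegralZl//.
  have e1 : rgamma (x + 1) = x * rgamma x by rewrite rgammaS.
  have e2 : rgamma x = (x - 1) * rgamma (x - 1) by rewrite -rgammaS// subrK.
  rewrite -!/(rgamma _) e1 e2 le_eqVlt; apply/orP; left; apply/eqP.
  by field; rewrite !gt_eqF.
apply: le_Rintegral => //.
  by have [] := cintegrableZ mRpos th im.
move=> t tpos; have t0 : 0 < t by move: tpos; rewrite /= in_itv /= andbT.
pose w := ln t - ln x.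
have -> : Re (th * mkernel z 1 t) = E x t * cos (y * w).
  rewrite -cexpD /= !ReImE /= -/x -/y.
  congr (expR _ * cos _); rewrite /w; ring.
have -> : g t = E x t * (1 - 2 * y ^+ 2 * (expR w + expR (- w) - 2)).
  have e1 : E (x + 1) t = E x t * t.
    by rewrite -[X in _ * X]lnK ?posrE// -expRD; congr expR; ring.
  have e2 : E (x - 1) t = E x t * t^-1.
    by rewrite -[X in _ * X^-1]lnK ?posrE// -expRN -expRD; congr expR; ring.
  have e3 : expR w = t / x by rewrite expRD expRN !lnK ?posrE.
  have e4 : expR (- w) = x / t by rewrite opprB expRD expRN !lnK ?posrE.
  by rewrite /g e1 e2 e3 e4; field; rewrite !gt_eqF.
rewrite ler_wpM2l ?expR_ge0//; apply: le_trans (cos_ge _).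
have := ler_wpM2l (sqr_ge0 y) (sqr_le_cosh w); rewrite exprMn; lra.
Qed.

Lemma euler_gamma_half z : 2 < Re z -> 1 + 4 * Im z ^+ 2 <= Re z ->
  rgamma (Re z) <= 2 * normc (euler_gamma z).
Proof.
move=> z2 zI; have := euler_gamma_lower z2.
have x1 : 0 < Re z - 1 by lra.
have h : 2 * Im z ^+ 2 / (Re z - 1) <= 1 / 2 by rewrite ler_pdivrMr//; lra.
have := rgamma_ge0 (Re z); nra.
Qed.

Lemma euler_gamma_shift z n : 0 < Re z ->
  euler_gamma (z + n%:R) = \prod_(i < n) (z + i%:R) * euler_gamma z.
Proof.
move=> z0; elim: n => [|n ih]; first by rewrite addr0 big_ord0 mul1r.
rewrite big_ord_recr /= -natr1 addrA euler_gammaS.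
  by rewrite ih mulrCA mulrA.
by rewrite cReD cRe_nat ltr_wpDr.
Qed.

(** By the functional equation it is enough to look far to the right, where
    [euler_gamma_half] applies. *)
Lemma euler_gamma_neq0 z : 0 < Re z -> euler_gamma z != 0.
Proof.
move=> z0; pose n := (Num.truncn (3 + 4 * Im z ^+ 2)).+1.
have b0 : 0 <= 3 + 4 * Im z ^+ 2 by have := sqr_ge0 (Im z); lra.
have nb : 3 + 4 * Im z ^+ 2 < n%:R by have /andP[] := Num.Theory.truncn_itv b0.
have h := sqr_ge0 (Im z).
have : 0 < normc (euler_gamma (z + n%:R)).
  have r0 : 0 < rgamma (Re (z + n%:R)).
    by apply: rgamma_gt0; rewrite cReD cRe_nat; lra.
  suff : rgamma (Re (z + n%:R)) <= 2 * normc (euler_gamma (z + n%:R)) by lra.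
  by apply: euler_gamma_half; rewrite cReD ?cImD cRe_nat ?cIm_nat ?addr0; lra.
rewrite euler_gamma_shift// Normc.normcM; apply: contraTneq => ->.
by rewrite Normc.normc0 mulr0 ltxx.
Qed.

Lemma Gamma_eq z : 0 < Re z -> Gamma z = euler_gamma z.
Proof. by rewrite /Gamma => ->. Qed.

(** The product in the continuation to Re z <= 0 vanishes at the poles only. *)
Lemma Gamma_neq0 z : ~ gamma_pole z -> Gamma z != 0.
Proof.
move=> np; rewrite /Gamma; case: ifPn => [/euler_gamma_neq0//|].
rewrite -leNgt => z0; set n := (Num.truncn _).+1.
have zn : 0 < Re (z + n%:R).
  have /andP[_] := Num.Theory.truncn_itv (eqbRL (oppr_ge0 (Re z)) z0).
  by rewrite cReD cRe_nat -/n => h; lra.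
rewrite mulf_neq0 ?euler_gamma_neq0// invr_neq0//.
apply/prodf_neq0 => i _; apply/eqP => /eqP; rewrite addr_eq0 => /eqP zi.
by apply: np; exists i.
Qed.

(** The ratio is at most 2 once Re z is large compared with the constant Im z; the finitely
    many other indices m < M are absorbed in B. *)
Lemma rgamma_le_Gamma (d : R[i]) (a : R) : 0 < a -> exists2 B, 0 <= B &
  forall m : nat, 0 < Re (d + (a * m%:R)%:C) ->
    rgamma (Re (d + (a * m%:R)%:C)) <= B * normc (Gamma (d + (a * m%:R)%:C)).
Proof.
move=> a0; pose b := (3 + 4 * Im d ^+ 2 + `|Re d|) / a.
have sq := sqr_ge0 (Im d); have nn := normr_ge0 (Re d).
have b0 : 0 <= b by rewrite divr_ge0 ?ltW//; lra.
pose M := (Num.truncn b).+1.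
have bM : b < M%:R by have /andP[] := Num.Theory.truncn_itv b0.
pose q (m : nat) := rgamma (Re (d + (a * m%:R)%:C)) / normc (Gamma (d + (a * m%:R)%:C)).
have q0 m : 0 <= q m by rewrite divr_ge0 ?rgamma_ge0 ?normc_ge0.
have s0 : 0 <= \sum_(i < M) q i by apply: sumr_ge0.
exists (2 + \sum_(i < M) q i); first by rewrite addr_ge0.
move=> m z0; have [mM|Mm] := ltnP m M.
  have g0 : 0 < normc (Gamma (d + (a * m%:R)%:C)).
    by rewrite normc_gt0 Gamma_eq// euler_gamma_neq0.
  rewrite -ler_pdivrMr// -/(q m) (bigD1 (Ordinal mM))//= addrCA lerDl addr_ge0//.
  exact: sumr_ge0.
apply: (@le_trans _ _ (2 * normc (Gamma (d + (a * m%:R)%:C)))); last first.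
  by rewrite ler_wpM2r ?normc_ge0// lerDl.
have bm : b < m%:R by apply: (lt_le_trans bM); rewrite ler_nat.
have abm : 3 + 4 * Im d ^+ 2 + `|Re d| < a * m%:R.
  by move: bm; rewrite ltr_pdivrMr// [a * _]mulrC.
have rd : - `|Re d| <= Re d by rewrite lerNl -normrN ler_norm.
by rewrite Gamma_eq//; apply: euler_gamma_half; rewrite cReD ?cImD /= ?addr0; lra.
Qed.

(** Compare |z + j| with Re z + |Im z| + j in the functional equation. *)
Lemma euler_gamma_shift_le z k : 0 < Re z ->
  normc (euler_gamma (z + k%:R)) * rgamma (Re z + `|Im z|) <=
  normc (euler_gamma z) * rgamma (Re z + `|Im z| + k%:R).
Proof.
move=> z0; elim: k => [|k ih]; first by rewrite !addr0.
have r0 : 0 < Re z + `|Im z| by rewrite ltr_wpDr.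
have zk : 0 < Re (z + k%:R) by rewrite cReD cRe_nat ltr_wpDr.
rewrite -(@natr1 R[i]) -(@natr1 R) !addrA euler_gammaS// rgammaS; last by rewrite ltr_wpDr.
rewrite Normc.normcM -mulrA [leRHS]mulrCA ler_pM ?normc_ge0 ?mulr_ge0 ?normc_ge0 ?rgamma_ge0//.
apply: (le_trans (normc_le_ReIm _)); rewrite (ger0_norm (ltW zk)).
by rewrite cReD cImD cRe_nat cIm_nat addr0 addrAC.
Qed.

End gamma_bounds.

(** * Power series *)

Section power_series.
Context {R : realType}.
Notation cnt := (@counting nat R).
Notation leb := (@lebesgue_measure R).
Implicit Types (c al : nat -> R[i]) (u r s : R).

Lemma csum_real (v : nat -> R) : csum (fun k => (v k)%:C) = (sumR v)%:C.
Proof.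
apply: complex_ext => //.
transitivity (\int[cnt]_k (cst 0 k : R)) => //.
by rewrite Rintegral_cst// mul0r.
Qed.

Lemma csumB (v w : nat -> R[i]) : csummable v -> csummable w ->
  csum (fun k => v k - w k) = csum v - csum w.
Proof. by move=> sv sw; apply: cintegralB => //; exact: csummable_cintegrable. Qed.

Lemma csummable_pow c u : csummable c -> 0 <= u <= 1 ->
  csummable (fun k => c k * (u ^+ k)%:C).
Proof.
move=> sc /andP[u0 u1]; apply: (csummable_le _ sc) => k.
rewrite Normc.normcM normc_real ger0_norm ?exprn_ge0//.
by rewrite ler_piMr ?normc_ge0// exprn_ile1.
Qed.

(** A power series is equivalent at 0 to its first nonzero term: u^(k+1) is a common
    factor of the later ones. *)
Lemma leading_term c k u : csummable c -> (forall j, (j < k)%N -> c j = 0) -> 0 <= u <= 1 ->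
  normc (csum (fun j => c j * (u ^+ j)%:C) - c k * (u ^+ k)%:C)
  <= 2 * sumR (normc \o c) * u ^+ k.+1.
Proof.
move=> sc cj /andP[u0 u1].
have [s1 e1] := csum_single (c k * (u ^+ k)%:C) k.
have sp : csummable (fun j => c j * (u ^+ j)%:C) by apply: csummable_pow; rewrite ?u0.
rewrite -[X in _ - X]e1 -csumB//.
set f := fun j => _.
have fE j : f j = if (k < j)%N then c j * (u ^+ j)%:C else 0.
  rewrite /f eq_sym; have [//|jk|<-] := ltngtP k j; rewrite ?subrr ?subr0//.
  by rewrite cj// mul0r.
have fle j : normc (f j) <= normc (c j) * u ^+ k.+1.
  rewrite fE; case: ifP => kj; last by rewrite Normc.normc0 mulr_ge0 ?normc_ge0 ?exprn_ge0.
  rewrite Normc.normcM normc_real ger0_norm ?exprn_ge0// ler_wpM2l ?normc_ge0//.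
  by rewrite -(subnKC kj) exprD ler_piMr ?exprn_ge0// exprn_ile1.
have sK : summableR (fun j => normc (c j) * u ^+ k.+1).
  by apply: eq_integrable (integrableZl measurableT (u ^+ k.+1) sc) => // j _; rewrite /= mulrC.
have sf := csummable_le fle sK.
rewrite (le_trans (normc_cintegral_le measurableT (csummable_cintegrable sf)))//.
rewrite -mulrA ler_wpM2l// -[leRHS]RintegralZr//.
by apply: le_Rintegral => // j _; exact: fle.
Qed.

(** At a zero u, the first nonzero term is at most a constant times u^(k+1). *)
Lemma identity_theorem c : csummable c ->
  (forall e, 0 < e -> exists u, [/\ 0 < u, u < e, u <= 1 & csum (fun k => c k * (u ^+ k)%:C) = 0]) ->
  forall k, c k = 0.
Proof.
move=> sc h k; elim/ltn_ind: k => k ih; apply/eqP; rewrite -[_ == _]negbK -normc_gt0.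
apply/negP => ck0; pose K := 2 * sumR (normc \o c).
have K0 : 0 <= K by rewrite mulr_ge0// Rintegral_ge0// => j _; exact: normc_ge0.
have [|u [u0 ue u1 e]] := h (normc (c k) / (K + 1)); first by rewrite divr_gt0// ltr_wpDl.
have := @leading_term c k u sc ih; rewrite (ltW u0) u1 => /(_ isT).
rewrite e sub0r normcN Normc.normcM normc_real (ger0_norm (exprn_ge0 _ (ltW u0))).
rewrite exprS mulrA ler_pM2r ?exprn_gt0// leNgt => /negP; apply.
move: ue; rewrite ltr_pdivlMr ?ltr_wpDl// mulrDr mulr1; rewrite -/K; nra.
Qed.

(** Over the segment from e = x exp (-C-1), with C the integral, 1/t integrates to C + 1. *)
Lemma not_integrable_inv x : 0 < x ->
  ~ leb.-integrable (`]0%R, x] : set R) (fun t => (t^-1)%:E).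
Proof.
move=> x0 ii; pose C := \int[leb]_(t in `]0%R, x]) t^-1.
have C0 : 0 <= C by apply: Rintegral_ge0 => t; rewrite /= in_itv /= invr_ge0 => /andP[/ltW].
pose e := expR (ln x - C - 1).
have e0 : 0 < e := expR_gt0 _.
have ex : e < x by rewrite -[X in _ < X]lnK ?posrE// ltr_expR; lra.
have h : (\int[leb]_(t in `[e, x]) (t^-1)%:E = (ln x - ln e)%:E)%E.
  apply: (FTC_segment e0 ex (fun t => @is_derive1_ln R t)) => t t0.
  by apply: inv_continuous; rewrite gt_eqF.
have le : (\int[leb]_(t in `[e, x]) (t^-1)%:E <= \int[leb]_(t in `]0%R, x]) (t^-1)%:E)%E.
  apply: ge0_subset_integral => //.
  - exact: (measurable_int leb ii).
  - by move=> t; rewrite /= in_itv /= lee_fin invr_ge0 => /andP[/ltW].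
  - by move=> t; rewrite /= !in_itv /= => /andP[et ->]; rewrite (lt_le_trans e0 et).
move: le; rewrite h -[X in (_ <= X)%E]fineK; last exact: integrable_fin_num.
by rewrite lee_fin -/(Rintegral _ _ _) -/C expRK; lra.
Qed.

(** Near 0 the first nonzero term c_k x^(ak) carries at least half of the series; if
    sg + ak <= 0, then x^(sg-1+ak) >= 1/x there. *)
Lemma integrable_leading_exponent c (sg a : R) : 0 < a -> csummable c ->
  leb.-integrable (`]0%R, 1%R] : set R)
    (fun x => (expR ((sg - 1) * ln x) * normc (csum (fun k => c k * ((x `^ a) ^+ k)%:C)))%:E) ->
  forall k, sg + a * k%:R <= 0 -> c k = 0.
Proof.
move=> a0 sc ig k; elim/ltn_ind: k => k ih sk; apply/eqP.
rewrite -[_ == _]negbK -normc_gt0; apply/negP => ck0.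
have cj j : (j < k)%N -> c j = 0.
  move=> jk; apply: ih => //; apply: le_trans sk; rewrite lerD2l ler_pM2l// ler_nat.
  exact: ltnW.
pose K := 2 * sumR (normc \o c).
have K0 : 0 <= K by rewrite mulr_ge0// Rintegral_ge0// => j _; exact: normc_ge0.
pose n := normc (c k).
(* For x^a <= de, the terms after c_k amount to at most half of it. *)
pose de := Num.min 1 (n / (2 * (K + 1))).
have K1 : 0 < K + 1 by rewrite ltr_wpDl.
have de0 : 0 < de by rewrite lt_min ltr01 divr_gt0// mulr_gt0.
pose x1 := expR (ln de / a).
have x10 : 0 < x1 := expR_gt0 _.
have x11 : x1 <= 1.
  rewrite -expR0 ler_expR pmulr_lle0 ?invr_gt0// ln_le0//.
  by rewrite /de ge_min lexx.
apply: (not_integrable_inv x10).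
have sub : `]0%R, x1] `<=` (`]0%R, 1%R] : set R).
  by move=> t; rewrite /= !in_itv /= => /andP[-> h]; exact: le_trans x11.
have mi : measurable (`]0%R, x1] : set (measurableTypeR R)) by exact: measurable_itv.
have ig1 : leb.-integrable (`]0%R, x1] : set (measurableTypeR R))
    (fun x => (expR ((sg - 1) * ln x) * normc (csum (fun k => c k * ((x `^ a) ^+ k)%:C)))%:E).
  by apply: integrableS ig => //; exact: measurable_itv.
have ig2 := integrableZl mi (2 / n) ig1.
apply: (le_integrable mi _ _ ig2).
  apply/measurable_EFinP; apply: (@measurable_funS _ _ _ _ (`]0%R, +oo[ : set (measurableTypeR R))) => //.
    by move=> t; rewrite /= !in_itv /= andbT => /andP[].
  by apply: measurable_Rpos_continuous => t t0; apply: inv_continuous; rewrite gt_eqF.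
move=> t; rewrite /= in_itv /= => /andP[t0 tx]; rewrite lee_fin.
have u0 : 0 < t `^ a by rewrite powR_gt0.
have ude : t `^ a <= de.
  rewrite /powR gt_eqF// -[X in _ <= X]lnK ?posrE// ler_expR.
  by rewrite -ler_pdivlMl// mulrC -[X in _ <= X]expRK ler_ln ?posrE.
have u1 : t `^ a <= 1 by apply: (le_trans ude); rewrite /de ge_min lexx.
have un : t `^ a * (2 * (K + 1)) <= n.
  by rewrite -ler_pdivlMr ?mulr_gt0//; apply: (le_trans ude); rewrite /de ge_min lexx orbT.
have := @leading_term c k (t `^ a) sc cj; rewrite (ltW u0) u1 => /(_ isT).
set S := csum _; rewrite -/K => lt.
have uk0 : 0 < (t `^ a) ^+ k by rewrite exprn_gt0.
have Sn : n * (t `^ a) ^+ k <= 2 * normc S.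
  have h1 : n * (t `^ a) ^+ k <= normc S + normc (S - c k * ((t `^ a) ^+ k)%:C).
    have -> : n * (t `^ a) ^+ k = normc (c k * ((t `^ a) ^+ k)%:C).
      by rewrite Normc.normcM normc_real ger0_norm// ltW.
    rewrite -[X in normc X <= _](subKr S).
    by apply: le_trans (le_normcD _ _) _; rewrite normcN.
  have h2 : 2 * (K * (t `^ a) ^+ k.+1) <= n * (t `^ a) ^+ k.
    rewrite exprS [K * _]mulrA mulrA ler_pM2r//; apply: le_trans un; nra.
  lra.
have tinv : t^-1 <= expR ((sg - 1) * ln t) * (t `^ a) ^+ k.
  rewrite -[X in X^-1 <= _]lnK ?posrE// -expRN /powR gt_eqF// -expRM_natl -expRD ler_expR.
  have l0 : ln t <= 0 by rewrite ln_le0// (le_trans tx).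
  by move: sk; nra.
rewrite (ger0_norm (eqbRL (invr_ge0 t) (ltW t0))); apply: le_trans (ler_norm _).
rewrite mulrCA; apply: (le_trans tinv); rewrite ler_wpM2l ?expR_ge0//.
by rewrite mulrAC ler_pdivlMr// mulrC.
Qed.

(** Absolute convergence is asked at the end point r itself, which dominates the series
    at all u with |u| <= r. *)
Definition has_pser (V : R -> R[i]) s0 r al : Prop :=
  csummable (fun k => al k * (r ^+ k)%:C) /\
  forall u, `|u| <= r -> V (s0 + u) = csum (fun k => al k * (u ^+ k)%:C).

Lemma pser_zero_left (V : R -> R[i]) s0 r al : 0 < r -> has_pser V s0 r al ->
  (forall s, s0 <= s -> V s = 0) -> forall s, s0 - r <= s -> V s = 0.
Proof.
move=> r0 [sal VE] V0 s sr; have [/V0//|ss0] := leP s0 s.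
have al0 k : al k * (r ^+ k)%:C = 0.
  move: k; apply: identity_theorem sal _ => e e0.
  pose u := Num.min 1 (e / 2); have u0 : 0 < u by rewrite lt_min ltr01 divr_gt0.
  have u1 : u <= 1 by rewrite ge_min lexx.
  exists u; split=> //; first by rewrite gt_min; apply/orP; right; lra.
  have h : `|u * r| <= r by rewrite ger0_norm ?(mulr_ge0 (ltW u0) (ltW r0))// ler_piMl// ltW.
  rewrite -(V0 (s0 + u * r)) ?lerDl ?mulr_ge0 ?ltW// VE//.
  congr csum; apply/funext => k; rewrite -mulrA -rmorphM; congr (_ * _%:C).
  by rewrite exprMn mulrC.
have {}al0 k : al k = 0.
  move/eqP: (al0 k); rewrite mulf_eq0 => /orP[/eqP//|].
  by rewrite -normc_gt0 || rewrite eq_complex /= expf_eq0 (gt_eqF r0) andbF.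
have -> : s = s0 + (s - s0) by ring.
rewrite VE; last by rewrite ltr0_norm ?subr_lt0//; lra.
rewrite -[RHS](csum_single (0 : R[i]) 0).2; congr csum; apply/funext => k.
by rewrite al0 mul0r; case: ifP.
Qed.

(** Above s the radii are at least h = rad s, so each use of [pser_zero_left] extends the
    zero set to the left by h. *)
Lemma continuation (V : R -> R[i]) (rad : R -> R) T :
  (forall s, 0 < s -> 0 < rad s) ->
  (forall s t, 0 < s -> s <= t -> rad s <= rad t) ->
  (forall s, 0 < s -> exists al, has_pser V s (rad s) al) ->
  (forall s, T <= s -> V s = 0) -> forall s, 0 < s -> V s = 0.
Proof.
move=> rad0 radm ps VT s s0; pose h := rad s; have h0 : 0 < h := rad0 s s0.
have step n t : s <= t -> T - h * n%:R <= t -> V t = 0.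
  elim: n t => [|n ih] t st tT; first by apply: VT; move: tT; rewrite mulr0 subr0.
  have sth : s <= t + h by rewrite (le_trans st)// lerDl ltW.
  have [al al_ps] := ps _ (lt_le_trans s0 sth).
  apply: (pser_zero_left (rad0 _ (lt_le_trans s0 sth)) al_ps).
    move=> x tx; apply: ih; first exact: le_trans tx.
    by apply: le_trans tx; move: tT; rewrite -natr1 mulrDr mulr1; lra.
  by have := radm s (t + h) s0 sth; rewrite -/h; lra.
pose n := (Num.truncn (`|T| / h)).+1.
apply: (step n) => //.
have /andP[_] := Num.Theory.truncn_itv (divr_ge0 (normr_ge0 T) (ltW h0)).
rewrite -/n ltr_pdivrMr// => hn; have := ler_norm T; rewrite [h * _]mulrC; lra.
Qed.

Lemma expR_series (y : R) : summableR (fun k => y ^+ k / k`!%:R) /\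
  sumR (fun k => y ^+ k / k`!%:R) = expR y.
Proof.
have cE (x : R) : series (fun k => x ^+ k / k`!%:R) @ \oo --> expR x.
  exact: is_cvg_series_exp_coeff.
have s : summableR (fun k => y ^+ k / k`!%:R).
  apply/summableRP; rewrite (_ : (\sum_(k <oo) _)%E = (expR `|y|)%:E) ?ltry//.
  apply/cvg_lim => //; rewrite (_ : (fun n => _) = EFin \o series (fun k => `|y| ^+ k / k`!%:R)).
    by apply: cvg_EFin; [exact: nearW|exact: cE].
  apply/funext => n /=; rewrite sumEFin; congr EFin; apply: eq_bigr => k _.
  by rewrite normrM normrX normfV normr_nat.
by split=> //; apply: cvg_unique (summableR_cvg s) (cE y).
Qed.

Lemma nneseries_expR (y : R) : 0 <= y ->
  (\sum_(k <oo) (y ^+ k / k`!%:R)%:E = (expR y)%:E)%E.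
Proof.
move=> y0; have [s e] := expR_series y.
rewrite -ge0_integral_count; last by move=> k; rewrite lee_fin divr_ge0 ?exprn_ge0.
by rewrite -e /sumR /Rintegral fineK//; exact: integrable_fin_num.
Qed.

Lemma expR_ge_term k (y : R) : 0 <= y -> y ^+ k / k`!%:R <= expR y.
Proof.
move=> y0; rewrite -lee_fin -nneseries_expR//.
have t0 j : (0 <= (y ^+ j / j`!%:R)%:E)%E by rewrite lee_fin divr_ge0 ?exprn_ge0.
by rewrite (@nneseriesD1 _ _ k)// leeDl// nneseries_ge0.
Qed.

Section laplace_pser.
Context d (T : measurableType d).
Variables (mu : {measure set T -> \bar R}) (D : set T).
Hypothesis mD : measurable D.
Variables (g : T -> R[i]) (xi : T -> R).
Hypotheses (ig : cintegrable mu D g) (mxi : measurable_fun D xi).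
Hypothesis xi0 : forall x, D x -> 0 <= xi x.

(** Expand e^(-u xi) in powers of u: for |u| <= s0, the sum of the moduli is at most
    |g| e^(-s0 xi) e^(|u| xi) <= |g|. *)
Lemma laplace_pser s0 r : 0 < s0 -> 0 <= r -> r <= s0 ->
  has_pser (fun s => cintegral mu D (fun x => g x * (expR (- (s * xi x)))%:C)) s0 r
    (fun k => cintegral mu D
      (fun x => g x * (expR (- (s0 * xi x)) * ((- xi x) ^+ k / k`!%:R))%:C)).
Proof.
move=> s00 r0 rs0.
pose h k x := g x * (expR (- (s0 * xi x)) * ((- xi x) ^+ k / k`!%:R))%:C.
pose f u k x := h k x * (u ^+ k)%:C.
have mg := cintegrable_measurable ig.
have mh k : cmeasurable D (h k).
  apply: cmeasurableM mg _; apply: cmeasurable_real; apply: measurable_funM.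
    apply: (measurableT_comp (@measurable_expR R)).
    by apply: measurableT_comp => //; apply: measurable_funM => //; exact: measurable_cst.
  by apply: measurable_funM; [apply: measurable_funX; exact: measurableT_comp|exact: measurable_cst].
have nf u k x : D x -> normc (f u k x) =
    normc (g x) * expR (- (s0 * xi x)) * ((`|u| * xi x) ^+ k / k`!%:R).
  move=> Dx; rewrite /f /h !Normc.normcM !normc_real !normrM !normrX normrN.
  rewrite (ger0_norm (expR_ge0 _)) (ger0_norm (xi0 Dx)) normfV normr_nat exprMn.
  ring.
have fE u k : f u k = fun x => g x * (expR (- (s0 * xi x)))%:C * ((- (u * xi x)) ^+ k / k`!%:R)%:C.
  apply/funext => x; rewrite /f /h -!mulrA; congr (_ * _); rewrite -!rmorphM; congr _%:C.
  by rewrite -[- (u * _)]mulrN exprMn; ring.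
have ub u : `|u| <= r -> [/\ cintegrable mu D (fun x => csum (f u ^~ x)),
    csummable (fun k => cintegral mu D (f u k)) &
    cintegral mu D (fun x => csum (f u ^~ x)) = csum (fun k => cintegral mu D (f u k))].
  move=> ur; apply: termwise_cintegral => //.
  - by move=> k; apply: cmeasurableM (mh k) _; exact: cmeasurable_cst.
  - rewrite -integral_nneseries//; last 2 first.
    + move=> k; apply/measurable_EFinP; apply: cmeasurable_normc.
      by apply: cmeasurableM (mh k) _; exact: cmeasurable_cst.
    + by move=> k x _; rewrite lee_fin normc_ge0.
    have /integrableP[_] := integrable_normc mD ig; apply: le_lt_trans.
    apply: ge0_le_integral => //.
    + by move=> x _; apply: nneseries_ge0 => *; rewrite lee_fin normc_ge0.
    + apply: ge0_emeasurable_sum => k; first by move=> x _ _; rewrite lee_fin normc_ge0.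
      move=> _; apply/measurable_EFinP; apply: cmeasurable_normc.
      by apply: cmeasurableM (mh k) _; exact: cmeasurable_cst.
    + apply: measurableT_comp => //; apply/measurable_EFinP; exact: cmeasurable_normc.
    + move=> x Dx.
      have -> : (\sum_(k <oo) (normc (f u k x))%:E =
          (normc (g x) * expR (- (s0 * xi x)))%:E * (expR (`|u| * xi x))%:E)%E.
        rewrite -nneseries_expR ?mulr_ge0 ?xi0// -nneseriesZl//.
          by apply: eq_eseriesr => k _; rewrite nf.
        by move=> k _; rewrite lee_fin divr_ge0 ?exprn_ge0 ?mulr_ge0 ?xi0.
      rewrite -EFinM lee_fin ger0_norm ?normc_ge0// -mulrA -expRD ler_piMr ?normc_ge0//.
      rewrite -expR0 ler_expR addrC subr_le0 ler_wpM2r ?xi0//.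
      exact: le_trans rs0.
  - move=> x Dx; rewrite (_ : f u ^~ x = fun k => g x * (expR (- (s0 * xi x)))%:C *
       ((- (u * xi x)) ^+ k / k`!%:R)%:C); last by apply/funext => k; rewrite fE.
    apply: csummableZ.
    apply: (csummable_le _ (integrable_norm (expR_series (- (u * xi x))).1)) => k.
    by rewrite normc_real.
have ih k : cintegrable mu D (h k).
  apply: (@cintegrable_le _ _ _ _ _ mD _ (fun x => (s0 ^- k) * normc (g x)) (mh k)).
    exact: (integrableZl mD _ (integrable_normc mD ig)).
  move=> x Dx; rewrite /h Normc.normcM normc_real mulrC ler_wpM2r ?normc_ge0//.
  rewrite !normrM normrX normrN (ger0_norm (expR_ge0 _)) (ger0_norm (xi0 Dx)) normfV normr_nat.
  have := expR_ge_term k (mulr_ge0 (ltW s00) (xi0 Dx)).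
  rewrite exprMn -mulrA -ler_pdivlMl ?exprn_gt0// => le.
  by rewrite expRN ler_pdivrMl ?expR_gt0// [X in _ <= X]mulrC.
have cZ u k : cintegral mu D (f u k) = cintegral mu D (h k) * (u ^+ k)%:C.
  rewrite mulrC -cintegralZ//; apply: eq_cintegral => x _; exact: mulrC.
split.
- have [|_ s _] := ub r; first by rewrite ger0_norm.
  by rewrite (_ : (fun k => _) = fun k => cintegral mu D (f r k))//; apply/funext => k; rewrite cZ.
- move=> u /ub[_ s e].
  rewrite (_ : (fun k => _) = fun k => cintegral mu D (f u k)); last by apply/funext => k; rewrite cZ.
  rewrite -e; apply: eq_cintegral => x _.
  rewrite (_ : f u ^~ x = fun k => g x * (expR (- (s0 * xi x)))%:C *
     ((- (u * xi x)) ^+ k / k`!%:R)%:C); last by apply/funext => k; rewrite fE.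
  have [s1 e1] := expR_series (- (u * xi x)).
  rewrite csumZ; last first.
    by apply: (csummable_le _ (integrable_norm s1)) => k; rewrite normc_real.
  by rewrite csum_real e1 -mulrA -rmorphM -expRD; congr (_ * (expR _)%:C); ring.
Qed.

End laplace_pser.

End power_series.

(** * Taylor expansion of (p + s)^(-z) in s *)

Section analytic_continuation.
Context {R : realType}.
Notation cnt := (@counting nat R).
Notation leb := (@lebesgue_measure R).
Notation Rpos := (`]0%R, +oo[%classic : set R).

Let mRpos : measurable (Rpos : set (measurableTypeR R)).
Proof. exact: measurable_itv. Qed.

(** The majorants [B i] justify the interchange of the sums over i and k. *)
Lemma pser_csum (V : nat -> R -> R[i]) (s0 r : R) (al : nat -> nat -> R[i]) (B : nat -> R) :
  0 < r -> summableR B ->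
  (forall i, (\sum_(k <oo) (normc (al i k) * r ^+ k)%:E <= (B i)%:E)%E) ->
  (forall i u, `|u| <= r -> V i (s0 + u) = csum (fun k => al i k * (u ^+ k)%:C)) ->
  has_pser (fun s => csum (fun i => V i s)) s0 r (fun k => csum (fun i => al i k)).
Proof.
move=> r0 sB alB VE; have r0' := ltW r0.
have nn (v : nat -> R[i]) k : (0 <= (normc (v k) * r ^+ k)%:E)%E.
  by rewrite lee_fin mulr_ge0 ?normc_ge0 ?exprn_ge0.
have sal k : csummable (fun i => al i k).
  have sB' : summableR (fun i => r ^- k * B i) by exact: (integrableZl measurableT _ sB).
  apply: (csummable_le _ sB') => i; rewrite ler_pdivlMl ?exprn_gt0// mulrC -lee_fin.
  apply: le_trans (alB i); rewrite (@nneseriesD1 _ _ k)//.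
  by rewrite leeDl//; apply: nneseries_ge0 => j _ _; exact: nn.
pose f (u : R) (k i : nat) := al i k * (u ^+ k)%:C.
have fn u k i : `|u| <= r -> normc (f u k i) <= normc (al i k) * r ^+ k.
  move=> ur; rewrite /f Normc.normcM normc_real normrX ler_wpM2l ?normc_ge0//.
  by rewrite lerXn2r ?nnegrE.
have fB u i : `|u| <= r -> (\sum_(k <oo) (normc (f u k i))%:E <= (B i)%:E)%E.
  move=> ur; apply: le_trans (alB i); apply: lee_nneseries => k.
    by move=> _; rewrite lee_fin normc_ge0.
  by move=> _; rewrite lee_fin fn.
have main u : `|u| <= r -> [/\ cintegrable cnt setT (fun i => csum (f u ^~ i)),
    csummable (fun k => csum (f u k)) &
    cintegral cnt setT (fun i => csum (f u ^~ i)) = csum (fun k => csum (f u k))].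
  move=> ur; apply: (termwise_cintegral measurableT).
  - by move=> k; exact: cmeasurable_nat.
  - rewrite -integral_nneseries//; last by move=> k i _; rewrite lee_fin normc_ge0.
    have /integrableP[_] := sB; apply: le_lt_trans; apply: ge0_le_integral => //.
    + by move=> i _; apply: nneseries_ge0 => *; rewrite lee_fin normc_ge0.
    + move=> i _; apply: (le_trans (fB u i ur)).
      by rewrite /= lee_fin ler_norm.
  - move=> i _; apply/summableRP; apply: le_lt_trans (ltry (B i)).
    apply: le_trans (fB u i ur); apply: lee_nneseries => k _; rewrite lee_fin//.
    by rewrite ger0_norm ?normc_ge0.
have fZ u k : csum (f u k) = csum (fun i => al i k) * (u ^+ k)%:C.
  by rewrite mulrC -csumZ//; congr csum; apply/funext => i; exact: mulrC.
split.
- have [|_ s _] := main r; first by rewrite ger0_norm.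
  by rewrite (_ : (fun k => _) = fun k => csum (f r k))//; apply/funext => k; rewrite fZ.
- move=> u ur; have [_ _ e] := main u ur.
  rewrite (_ : (fun k => _ * _) = fun k => csum (f u k)); last by apply/funext => k; rewrite fZ.
  by rewrite -e; apply: eq_cintegral => i _; rewrite VE.
Qed.

(** The binomial series of (c - r)^(-rho), obtained by expanding e^(rx) under the integral
    of x^(rho-1) e^(-cx) e^(rx). *)
Lemma nneseries_rgamma (rho c r : R) : 0 < rho -> 0 <= r -> r < c ->
  (\sum_(k <oo) (expR (- ((rho + k%:R) * ln c)) * rgamma (rho + k%:R) * (r ^+ k / k`!%:R))%:E
   = (expR (- (rho * ln (c - r))) * rgamma rho)%:E)%E.
Proof.
move=> rho0 r0 rc; have c0 : 0 < c by apply: le_lt_trans rc.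
have cr0 : 0 < c - r by rewrite subr_gt0.
pose f k (x : R) := expR ((rho + k%:R - 1) * ln x - c * x) * (r ^+ k / k`!%:R).
have rk k : 0 < rho + k%:R by rewrite ltr_wpDr.
have f0 k x : (0 <= (f k x)%:E)%E.
  by rewrite lee_fin mulr_ge0 ?expR_ge0// divr_ge0// exprn_ge0.
have if_ k : leb.-integrable Rpos (EFin \o f k).
  apply: eq_integrable (integrableZl mRpos (r ^+ k / k`!%:R) (integrable_power_exp (rk k) c0)) => // x _.
  by rewrite /f /= -EFinM mulrC.
transitivity (\sum_(k <oo) \int[leb]_(x in Rpos) (f k x)%:E)%E.
  apply: eq_eseriesr => k _; rewrite -Rintegral_power_exp// -RintegralZr//.
    by rewrite /Rintegral fineK//; exact: (integrable_fin_num mRpos (if_ k)).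
  exact: (integrable_power_exp (rk k) c0).
rewrite -integral_nneseries//; last by move=> k; exact: measurable_int (if_ k).
rewrite -Rintegral_power_exp// /Rintegral fineK; last first.
  exact: (integrable_fin_num mRpos (integrable_power_exp rho0 cr0)).
apply: eq_integral => x; rewrite inE /= in_itv /= andbT => x0.
transitivity ((expR ((rho - 1) * ln x - c * x))%:E * (expR (r * x))%:E)%E.
  rewrite -(@nneseries_expR _ (r * x)) ?mulr_ge0 ?(ltW x0)// -nneseriesZl//; last first.
    by move=> k _; rewrite lee_fin divr_ge0 ?exprn_ge0 ?mulr_ge0 ?(ltW x0).
  apply: eq_eseriesr => k _; rewrite -EFinM /f; congr EFin.
  have -> : (rho + k%:R - 1) * ln x - c * x = ((rho - 1) * ln x - c * x) + k%:R * ln x by ring.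
  by rewrite expRD expRM_natl lnK ?posrE// exprMn; ring.
by rewrite -EFinM -expRD; congr (expR _)%:E; ring.
Qed.

Section shift.
Variable p : R[i].
Hypothesis p0 : 0 < Re p.

Lemma Re_shift (s : R) : 0 <= s -> 0 < Re (p + s%:C).
Proof. by move=> s0; rewrite cReD /= ltr_wpDr. Qed.

Lemma normc_shift_le (s t : R) : 0 <= s -> s <= t -> normc (p + s%:C) <= normc (p + t%:C).
Proof.
move=> s0 st; rewrite -(@ler_pXn2r _ 2)// ?nnegrE ?normc_ge0// !normc_sqr !cReD !cImD /=.
have a1 : 0 <= Re p + s by rewrite addr_ge0 ?(ltW p0).
have a2 : 0 <= Re p + t by rewrite addr_ge0 ?(ltW p0)// (le_trans s0).
by rewrite lerD2r lerXn2r// lerD2l.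
Qed.

Lemma normc_shift_ge (s : R) : 0 <= s -> normc p <= normc (p + s%:C).
Proof. by move=> s0; have := normc_shift_le (lexx 0) s0; rewrite rmorph0 addr0. Qed.

Lemma normc_shift_gt (s : R) : 0 < s -> normc p < normc (p + s%:C).
Proof.
move=> s0; rewrite -(@ltr_pXn2r _ 2)// ?nnegrE ?normc_ge0// !normc_sqr !cReD !cImD /=.
have a1 : 0 <= Re p + s by rewrite addr_ge0 ?(ltW p0) ?(ltW s0).
by rewrite addr0 ltrD2r ltrXn2r ?nnegrE ?(ltW p0)// ltrDl.
Qed.

Lemma normc_shift_sub (s : R) : 0 <= s -> normc (p + s%:C) - normc p <= s.
Proof.
move=> s0; rewrite lerBlDl; apply: le_trans (le_normcD _ _) _.
by rewrite normc_real ger0_norm.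
Qed.

Lemma cpow_shift_integral (z : R[i]) (s : R) : 0 < Re z -> 0 <= s ->
  cpow (p + s%:C) (- z) =
  cintegral leb Rpos (fun x => (euler_gamma z)^-1 * mkernel z p x * (expR (- (s * x)))%:C).
Proof.
move=> z0 s0; have ez := euler_gamma_neq0 z0.
have -> : cpow (p + s%:C) (- z) = (euler_gamma z)^-1 * mintegral z (p + s%:C).
  by rewrite mintegralE ?Re_shift// mulrC mulfK.
rewrite -cintegralZ//; last by apply: cintegrable_mkernel => //; exact: Re_shift.
apply: eq_cintegral => x _; rewrite mkernelDp -mulrA; congr (_ * (_ * _)).
by rewrite -cexp_real rmorphN rmorphM.
Qed.

Lemma normc_cpow_shift_le (z : R[i]) (s : R) : 0 < Re z -> 0 <= s ->
  normc (cpow (p + s%:C) (- z)) <= expR (`|Im z| * (pi / 2)) * expR (- Re z * ln (normc p)).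
Proof.
move=> z0 s0; apply: (le_trans (normc_cpow_le _ (Re_shift s0))).
rewrite cImN cReN normrN ler_wpM2l ?expR_ge0// ler_expR !mulNr lerN2 ler_wpM2l ?(ltW z0)//.
rewrite ler_ln ?posrE ?normc_Re_gt0 ?Re_shift//.
exact: normc_shift_ge.
Qed.

(** With P = p + s0, the k-th Taylor coefficient is
    (-1)^k Gamma (z+k) / (k! Gamma z) P^(-z-k). By [euler_gamma_shift_le] its modulus is
    controlled by the same expression at rho = Re z + |Im z| and |P|, and the resulting
    binomial series at r = |P| - |p| sums to (|P| - r)^(-rho) = |p|^(-rho). *)
Lemma cpow_shift_pser (z : R[i]) (s0 : R) : 0 < Re z -> 0 < s0 ->
  exists al : nat -> R[i],
  (\sum_(k <oo) (normc (al k) * (normc (p + s0%:C) - normc p) ^+ k)%:E <=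
    (expR (`|Im z| * (pi / 2)) * expR (`|Im z| * (ln (normc (p + s0%:C)) - ln (normc p)))
     * expR (- Re z * ln (normc p)))%:E)%E /\
  forall u, `|u| <= normc (p + s0%:C) - normc p ->
    cpow (p + (s0 + u)%:C) (- z) = csum (fun k => al k * (u ^+ k)%:C).
Proof.
move=> z0 s00; have s0' := ltW s00.
pose P := p + s0%:C; pose r := normc P - normc p; pose y := `|Im z|.
have P0 : 0 < Re P by exact: Re_shift.
have r0 : 0 <= r by rewrite subr_ge0 normc_shift_ge.
have rs : r <= s0 by exact: normc_shift_sub.
have ez := euler_gamma_neq0 z0.
pose g x := (euler_gamma z)^-1 * mkernel z p x.
have ig : cintegrable leb Rpos g.
  by apply: (cintegrableZ mRpos); exact: cintegrable_mkernel.
pose al k := cintegral leb Rpos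
   (fun x => g x * (expR (- (s0 * x)) * ((- x) ^+ k / k`!%:R))%:C).
have xi0 x : Rpos x -> 0 <= x by rewrite /= in_itv /= andbT => /ltW.
have [_ ps] := @laplace_pser R _ _ leb Rpos mRpos g id ig
  (@measurable_id _ _ _) xi0 s0 r s00 r0 rs.
exists al; split; last first.
  move=> u ur; rewrite cpow_shift_integral//.
    exact: (ps u ur).
  by move: ur; rewrite -/r ler_norml => /andP[ur _]; lra.
have zk k : 0 < Re (z + k%:R) by rewrite cReD cRe_nat ltr_wpDr.
have alE k : al k = (euler_gamma z)^-1 * ((-1) ^+ k / k`!%:R)%:C * mintegral (z + k%:R) P.
  rewrite /al /mintegral -cintegralZ; last 2 first.
  - exact: mRpos.
  - exact: cintegrable_mkernel.
  apply: eq_cintegral => x; rewrite inE /= in_itv /= andbT => x0.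
  rewrite /g -!mulrA; congr (_ * _).
  have -> : mkernel (z + k%:R) P x = (x ^+ k)%:C * mkernel z P x.
    elim: k => [|k ih]; first by rewrite addr0 expr0 mul1r.
    by rewrite -natr1 addrA mkernelS// ih mulrA -rmorphM -exprS.
  rewrite mkernelDp [(- x) ^+ k]exprNn.
  have -> : cexp (- (s0%:C * x%:C)) = (expR (- (s0 * x)))%:C.
    by rewrite -cexp_real rmorphN rmorphM.
  rewrite !rmorphM /=; ring.
pose rho := Re z + y.
have rho0 : 0 < rho by rewrite ltr_wpDr// /y.
pose C := expR (y * (pi / 2)) * expR (y * ln (normc P)) / rgamma rho.
have C0 : 0 <= C by rewrite divr_ge0 ?rgamma_ge0// mulr_ge0 ?expR_ge0.
have alle k : normc (al k) * r ^+ k <= C *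
    (expR (- ((rho + k%:R) * ln (normc P))) * rgamma (rho + k%:R) * (r ^+ k / k`!%:R)).
  have nP : normc (cpow P (- (z + k%:R))) <=
      expR (y * (pi / 2)) * expR (- (Re z + k%:R) * ln (normc P)).
    apply: (le_trans (normc_cpow_le _ P0)).
    by rewrite cImN cReN normrN cImD cReD cIm_nat cRe_nat addr0.
  have nE : normc (euler_gamma (z + k%:R)) <=
      normc (euler_gamma z) * rgamma (rho + k%:R) / rgamma rho.
    by rewrite ler_pdivlMr ?rgamma_gt0//; exact: euler_gamma_shift_le.
  have e0 : 0 < normc (euler_gamma z) by rewrite normc_gt0.
  have nA : normc (al k) = (normc (euler_gamma z))^-1 * k`!%:R^-1 *
      (normc (cpow P (- (z + k%:R))) * normc (euler_gamma (z + k%:R))).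
    rewrite alE mintegralE// !Normc.normcM Normc.normcV normc_real normrM normrX.
    by rewrite normrN1 expr1n mul1r normfV normr_nat.
  have := ler_pM (normc_ge0 _) (normc_ge0 _) nP nE => nPE.
  rewrite nA.
  have i0 : 0 <= (normc (euler_gamma z))^-1 * k`!%:R^-1.
    by rewrite mulr_ge0 ?invr_ge0 ?normc_ge0.
  apply: (le_trans (ler_wpM2r (exprn_ge0 k r0) (ler_wpM2l i0 nPE))).
  rewrite le_eqVlt; apply/orP; left; apply/eqP.
  have -> : - (Re z + k%:R) * ln (normc P) = y * ln (normc P) - (rho + k%:R) * ln (normc P).
    by rewrite /rho; ring.
  rewrite expRD /C; field.
  by rewrite pnatr_eq0 -lt0n fact_gt0 !gt_eqF ?rgamma_gt0.
have c0 : 0 < normc p by exact: normc_Re_gt0.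
have rP : r < normc P by rewrite /r gtrBl.
apply: (@le_trans _ _ (\sum_(k <oo) (C *
    (expR (- ((rho + k%:R) * ln (normc P))) * rgamma (rho + k%:R) * (r ^+ k / k`!%:R)))%:E)%E).
  apply: lee_nneseries => k _; last by rewrite lee_fin alle.
  by rewrite lee_fin mulr_ge0 ?normc_ge0 ?exprn_ge0.
under eq_eseriesr do rewrite EFinM.
rewrite nneseriesZl; last first.
  move=> k _; rewrite lee_fin mulr_ge0 ?divr_ge0 ?exprn_ge0//.
  by rewrite mulr_ge0 ?expR_ge0 ?rgamma_ge0.
rewrite nneseries_rgamma// -EFinM lee_fin.
have -> : normc P - r = normc p by rewrite /r; ring.
have g0 : 0 < rgamma rho by exact: rgamma_gt0.
have -> : C * (expR (- (rho * ln (normc p))) * rgamma rho) =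
   expR (y * (pi / 2)) * (expR (y * ln (normc P)) * expR (- (rho * ln (normc p)))).
  by rewrite /C; field; rewrite gt_eqF.
rewrite -[leRHS]mulrA -!expRD le_eqVlt; apply/orP; left; apply/eqP.
by congr (expR _); rewrite /rho -/y -/P; ring.
Qed.

End shift.
End analytic_continuation.

(** * Analytic continuation down to s = 0 *)

Section descent.
Context {R : realType}.
Notation cnt := (@counting nat R).
Notation leb := (@lebesgue_measure R).
Notation Rpos := (`]0%R, +oo[%classic : set R).

Let mRpos : measurable (Rpos : set (measurableTypeR R)).
Proof. exact: measurable_itv. Qed.

Lemma csummableB (v w : nat -> R[i]) : csummable v -> csummable w ->
  csummable (fun k => v k - w k).
Proof.
move=> sv sw; apply: (@csummable_le _ _ (fun k => normc (v k) + normc (w k))).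
  by move=> k; apply: le_trans (le_normcD _ _) _; rewrite normcN.
exact: (integrableD measurableT sv sw).
Qed.

Lemma has_pserB (V W : R -> R[i]) (s0 r : R) (al be : nat -> R[i]) : 0 <= r ->
  has_pser V s0 r al -> has_pser W s0 r be ->
  has_pser (fun s => V s - W s) s0 r (fun k => al k - be k).
Proof.
move=> r0 [sa Va] [sb Wb].
have le (c : nat -> R[i]) u : `|u| <= r -> csummable (fun k => c k * (r ^+ k)%:C) ->
    csummable (fun k => c k * (u ^+ k)%:C).
  move=> ur sc; apply: (csummable_le _ sc) => k; rewrite /= !Normc.normcM !normc_real !normrX.
  by rewrite ler_wpM2l ?normc_ge0// (ger0_norm r0) lerXn2r ?nnegrE.
have subE u : (fun k => (al k - be k) * (u ^+ k)%:C) =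
    (fun k => al k * (u ^+ k)%:C - be k * (u ^+ k)%:C).
  by apply/funext => k; rewrite mulrBl.
split; first by rewrite subE; exact: csummableB.
by move=> u ur; rewrite subE csumB ?Va ?Wb//; exact: le.
Qed.

Section laplace_limit.
Context d (T : measurableType d).
Variables (mu : {measure set T -> \bar R}) (D : set T).
Hypothesis mD : measurable D.
Variables (g : T -> R[i]) (xi : T -> R).
Hypotheses (ig : cintegrable mu D g) (mxi : measurable_fun D xi).
Hypothesis xi0 : forall x, D x -> 0 <= xi x.

Lemma laplace_cvg0 : ccvg
  (fun n => cintegral mu D (fun x => g x * (expR (- (n.+1%:R^-1 * xi x)))%:C))
  (cintegral mu D g).
Proof.
apply: (@cintegral_dominated _ _ _ mu D mD
  (fun n x => g x * (expR (- (n.+1%:R^-1 * xi x)))%:C) g (fun x => normc (g x))).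
- move=> n; apply: cmeasurableM; first exact: (cintegrable_measurable ig).
  apply: cmeasurable_real; apply: (measurableT_comp (@measurable_expR R)).
  by apply: measurableT_comp => //; apply: measurable_funM => //; exact: measurable_cst.
- exact: (cintegrable_measurable ig).
- move=> x Dx; rewrite -[X in ccvg _ X]mulr1; apply: ccvgM; first exact: ccvg_cst.
  split; last exact: cvg_cst.
  have h : (fun n : nat => - (n.+1%:R^-1 * xi x)) @ \oo --> (0 : R).
    have := cvgN (cvgM (@cvg_harmonic R) (cvg_cst (xi x))).
    by rewrite mul0r oppr0; apply.
  have := @continuous_cvg _ _ _ _ _ _ (@expR R) 0 (@continuous_expR R 0) h.
  by rewrite expR0; apply.
- exact: integrable_normc.
- move=> n x Dx; rewrite Normc.normcM normc_real (ger0_norm (expR_ge0 _)).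
  by rewrite ler_piMr ?normc_ge0// -expR0 ler_expR oppr_le0 mulr_ge0 ?xi0.
Qed.

End laplace_limit.

(** A power is a Laplace integral, so that continuity in s comes from [laplace_cvg0]. *)
Lemma cpow_shift_cvg0 (p z : R[i]) : 0 < Re p -> 0 < Re z ->
  ccvg (fun n => cpow (p + (n.+1%:R^-1)%:C) (- z)) (cpow p (- z)).
Proof.
move=> p0 z0; pose g x := (euler_gamma z)^-1 * mkernel z p x.
have ig : cintegrable leb Rpos g.
  by apply: (cintegrableZ mRpos); exact: cintegrable_mkernel.
have -> : (fun n => cpow (p + (n.+1%:R^-1)%:C) (- z)) =
    (fun n => cintegral leb Rpos (fun x => g x * (expR (- (n.+1%:R^-1 * x)))%:C)).
  by apply/funext => n; rewrite cpow_shift_integral// invr_ge0.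
have -> : cpow p (- z) = cintegral leb Rpos g.
  rewrite -[X in cpow X]addr0 -(rmorph0 (real_complex R)) cpow_shift_integral//.
  by apply: eq_cintegral => x _; rewrite mul0r oppr0 expR0 mulr1.
apply: laplace_cvg0 => //.
by move=> x; rewrite /= in_itv /= andbT => /ltW.
Qed.

(** Both sides are analytic in s > 0, with local radius of convergence at least
    |p + s| - |p|, hence equal there; and both are continuous at s = 0. The constant
    imaginary part y makes the factor e^(y arg p) in |p^(-z)| harmless. *)
Lemma laplace_descent d (T : measurableType d) (mu : {measure set T -> \bar R})
    (D : set T) (g : T -> R[i]) (xi : T -> R) (p : R[i]) (K zz : nat -> R[i]) (y T0 : R) :
  measurable D -> cintegrable mu D g -> measurable_fun D xi ->
  (forall x, D x -> 0 <= xi x) -> 0 < Re p ->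
  (forall i, Im (zz i) = y) -> (forall i, K i != 0 -> 0 < Re (zz i)) ->
  summableR (fun i => normc (K i) * expR (- Re (zz i) * ln (normc p))) ->
  (forall s, T0 <= s -> cintegral mu D (fun x => g x * (expR (- (s * xi x)))%:C) =
     csum (fun i => K i * cpow (p + s%:C) (- zz i))) ->
  cintegral mu D g = csum (fun i => K i * cpow p (- zz i)).
Proof.
move=> mD ig mxi xi0 p0 zy Kz sK eqT.
pose L s := cintegral mu D (fun x => g x * (expR (- (s * xi x)))%:C).
pose S s := csum (fun i => K i * cpow (p + s%:C) (- zz i)).
pose rad s := normc (p + s%:C) - normc p.
have pos : forall s, 0 < s -> L s - S s = 0.
  apply: (@continuation R _ rad T0).
  - by move=> s s0; rewrite subr_gt0 normc_shift_gt.
  - by move=> s t s0 st; rewrite lerD2r normc_shift_le// ltW.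
  - move=> s0 s00; have r0 : 0 < rad s0 by rewrite subr_gt0 normc_shift_gt.
    have rs : rad s0 <= s0 by apply: normc_shift_sub; rewrite ltW.
    have Lp := laplace_pser mD ig mxi xi0 s00 (ltW r0) rs.
    pose A := expR (`|y| * (pi / 2)) * expR (`|y| * (ln (normc (p + s0%:C)) - ln (normc p))).
    pose B i := A * (normc (K i) * expR (- Re (zz i) * ln (normc p))).
    have sB : summableR B by exact: (integrableZl measurableT _ sK).
    have : forall i, exists al : nat -> R[i],
        (\sum_(k <oo) (normc (al k) * rad s0 ^+ k)%:E <= (B i)%:E)%E /\
        forall u, `|u| <= rad s0 ->
          K i * cpow (p + (s0 + u)%:C) (- zz i) = csum (fun k => al k * (u ^+ k)%:C).
      move=> i; have [K0|Kn0] := eqVneq (K i) 0.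
        exists (fun=> 0); split.
          rewrite eseries0; last by move=> k _ _; rewrite Normc.normc0 mul0r.
          by rewrite lee_fin /B K0 Normc.normc0 mul0r mulr0.
        move=> u _; rewrite K0 mul0r -[LHS](csum_single (0 : R[i]) 0).2.
        by congr csum; apply/funext => k; rewrite mul0r; case: ifP.
      have [al [alB alE]] := cpow_shift_pser p0 (Kz i Kn0) s00.
      exists (fun k => K i * al k); split.
        have -> : (\sum_(k <oo) (normc (K i * al k) * rad s0 ^+ k)%:E =
            (normc (K i))%:E * \sum_(k <oo) (normc (al k) * rad s0 ^+ k)%:E)%E.
          rewrite -nneseriesZl; last first.
            by move=> k _; rewrite lee_fin mulr_ge0 ?normc_ge0 ?exprn_ge0 ?(ltW r0).
          by apply: eq_eseriesr => k _; rewrite Normc.normcM -mulrA EFinM.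
        apply: (le_trans (lee_wpmul2l _ alB)); first by rewrite lee_fin normc_ge0.
        by rewrite -EFinM lee_fin /B /A zy mulrCA.
      move=> u ur; rewrite (alE u ur) -csumZ.
        by congr csum; apply/funext => k; rewrite mulrA.
      apply/summableRP; apply: le_lt_trans (le_lt_trans alB (ltry _)).
      apply: lee_nneseries => k _; rewrite lee_fin//.
      rewrite /= ger0_norm ?normc_ge0// Normc.normcM normc_real normrX ler_wpM2l ?normc_ge0//.
      by rewrite lerXn2r ?nnegrE// ltW.
    move=> /choice[al al_ps].
    have Sp := @pser_csum R (fun i s => K i * cpow (p + s%:C) (- zz i)) s0 (rad s0) al B
      r0 sB (fun i => (al_ps i).1) (fun i => (al_ps i).2).
    by eexists; exact: (has_pserB (ltW r0) Lp Sp).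
  - by move=> s Ts; rewrite /L /S eqT// subrr.
have lim1 := laplace_cvg0 mD ig mxi xi0.
apply: (ccvg_unique lim1).
have -> : (fun n => cintegral mu D (fun x => g x * (expR (- (n.+1%:R^-1 * xi x)))%:C)) =
    (fun n => S n.+1%:R^-1).
  by apply/funext => n; apply: subr0_eq; apply: (pos n.+1%:R^-1); rewrite invr_gt0.
pose C := expR (`|y| * (pi / 2)).
apply: (@cintegral_dominated _ _ _ cnt setT measurableT
  (fun n i => K i * cpow (p + (n.+1%:R^-1)%:C) (- zz i)) (fun i => K i * cpow p (- zz i))
  (fun i => C * (normc (K i) * expR (- Re (zz i) * ln (normc p))))).
- by move=> n; exact: cmeasurable_nat.
- exact: cmeasurable_nat.
- move=> i _; have [K0|Kn0] := eqVneq (K i) 0.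
    by rewrite K0; under eq_fun do rewrite mul0r; rewrite mul0r; exact: ccvg_cst.
  by apply: ccvgM; [exact: ccvg_cst|exact: cpow_shift_cvg0 (Kz i Kn0)].
- exact: (integrableZl measurableT _ sK).
- move=> n i _; have [->|Kn0] := eqVneq (K i) 0.
    by rewrite mul0r Normc.normc0 mul0r mulr0.
  rewrite Normc.normcM [leRHS]mulrCA ler_wpM2l ?normc_ge0//.
  have := @normc_cpow_shift_le R p p0 (zz i) (n.+1%:R^-1) (Kz i Kn0).
  by rewrite zy; apply; rewrite invr_ge0.
Qed.

End descent.

(** * Integrals over the quadrant *)

Section quadrant_integrals.
Context {R : realType}.
Notation leb := (@lebesgue_measure R).
Notation leb2 := (@lebesgue_measure R \x @lebesgue_measure R)%E.
Notation Rpos := (`]0%R, +oo[%classic : set R).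
Notation Q2 := (@quadrant R).

Let mRpos : measurable (Rpos : set (measurableTypeR R)).
Proof. exact: measurable_itv. Qed.

Lemma measurable_quadrant : measurable (Q2 : set (measurableTypeR R * measurableTypeR R)).
Proof. by apply: measurableX. Qed.

Lemma quadrantP (t : R * R) : Q2 t <-> 0 < t.1 /\ 0 < t.2.
Proof. by rewrite /quadrant /setX /= !in_itv /= !andbT. Qed.

(** Extended by 0, both functions live on the whole line, where Fubini's theorem applies. *)
Lemma quadrant_product (f g : R -> R) :
  leb.-integrable Rpos (EFin \o f) -> leb.-integrable Rpos (EFin \o g) ->
  leb2.-integrable Q2 (fun t => (f t.1 * g t.2)%:E) /\
  \int[leb2]_(t in Q2) (f t.1 * g t.2) =
    \int[leb]_(x in Rpos) f x * \int[leb]_(x in Rpos) g x.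
Proof.
move=> fi gi.
pose f' := f \_ Rpos; pose g' := g \_ Rpos.
pose h (t : measurableTypeR R * measurableTypeR R) := ((f' t.1 * g' t.2)%:E : \bar R).
have hE : h = (fun t => (f t.1 * g t.2)%:E) \_ Q2.
  apply/funext => -[x y]; rewrite /h /f' /g' !patchE /=.
  have -> : ((x, y) \in Q2) = (x \in Rpos) && (y \in Rpos).
    apply/idP/andP; rewrite !inE /=; last by move=> [] ? ?; split.
    by move=> [].
  by case: (x \in Rpos); case: (y \in Rpos) => //=; rewrite ?mulr0 ?mul0r.
have fi' : leb.-integrable setT (EFin \o f').
  by rewrite -restrict_EFin; apply/(integrable_mkcond _ mRpos).
have gi' : leb.-integrable setT (EFin \o g').
  by rewrite -restrict_EFin; apply/(integrable_mkcond _ mRpos).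
have mh : measurable_fun setT h.
  have mf' : measurable_fun (setT : set (measurableTypeR R)) f'.
    by apply/measurable_EFinP; exact: (measurable_int leb fi').
  have mg' : measurable_fun (setT : set (measurableTypeR R)) g'.
    by apply/measurable_EFinP; exact: (measurable_int leb gi').
  apply/measurable_EFinP; apply: measurable_funM.
    exact: (measurableT_comp mf' measurable_fst).
  exact: (measurableT_comp mg' measurable_snd).
have gabs : (\int[leb]_y `|(g' y)%:E| \is a fin_num)%E.
  apply: integrable_fin_num => //; exact: integrable_norm gi'.
have hi : leb2.-integrable setT h.
  apply/integrable12ltyP => //.
  under eq_integral => x _.
    have -> : (\int[leb]_y `|h (x, y)| = `|(f' x)%:E| * \int[leb]_y `|(g' y)%:E|)%E.
      rewrite -ge0_integralZl//; last first.
        by apply: measurableT_comp => //; exact: measurable_int gi'.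
      by apply: eq_integral => y _; rewrite -abseM -EFinM.
    over.
  rewrite -(fineK gabs) ge0_integralZr//; last 2 first.
  - by apply: measurableT_comp => //; exact: measurable_int fi'.
  - by rewrite lee_fin fine_ge0// integral_ge0.
  have /integrableP[_ flt] := fi'.
  by rewrite lte_mul_pinfty// ?integral_ge0// ?ge0_fin_numE ?integral_ge0// ltry.
split; first by apply/(integrable_mkcond _ measurable_quadrant); rewrite -hE.
rewrite /Rintegral [X in fine X](_ : _ = \int[leb2]_t h t)%E; last first.
  by rewrite integral_mkcond hE.
rewrite -(integral12_prod_meas1 hi) /fubini_F /=.
under eq_integral => x _.
  have -> : (\int[leb]_y h (x, y) = (f' x)%:E * \int[leb]_y (g' y)%:E)%E.
    by rewrite -integralZl//; apply: eq_integral => y _; rewrite -EFinM.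
  over.
have ge : (\int[leb]_y (g' y)%:E = (\int[leb]_(y in Rpos) g y)%:E)%E.
  rewrite /Rintegral fineK; last exact: (integrable_fin_num mRpos gi).
  by rewrite [RHS]integral_mkcond restrict_EFin.
rewrite ge integralZr// fineM ?integrable_fin_num//=; congr (_ * _).
by rewrite [in RHS]integral_mkcond restrict_EFin.
Qed.

Lemma quadrant_cproduct (f g : R -> R[i]) :
  cintegrable leb Rpos f -> cintegrable leb Rpos g ->
  cintegrable leb2 Q2 (fun t => f t.1 * g t.2) /\
  cintegral leb2 Q2 (fun t => f t.1 * g t.2) = cintegral leb Rpos f * cintegral leb Rpos g.
Proof.
move=> [f1 f2] [g1 g2].
have [i11 e11] := quadrant_product f1 g1.
have [i12 e12] := quadrant_product f1 g2.
have [i21 e21] := quadrant_product f2 g1.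
have [i22 e22] := quadrant_product f2 g2.
have mQ := measurable_quadrant.
split; first split.
- by apply: eq_integrable (integrableB mQ i11 i22) => // t _; rewrite cReM.
- by apply: eq_integrable (integrableD mQ i12 i21) => // t _; rewrite cImM.
- apply: complex_ext; rewrite ?cReM ?cImM /=.
  + rewrite -e11 -e22 -RintegralB//; apply: eq_Rintegral => t _; exact: cReM.
  + rewrite -e12 -e21 -RintegralD//; apply: eq_Rintegral => t _; exact: cImM.
Qed.

(** The modulus of the i-th term has integral
    |K_i| Gamma (Re z) / |Gamma z| (Re P)^(-Re z) times the same factor for w and Q; the
    bounds B1, B2 and Re P >= |p|, Re Q >= |q| make these integrals summable. *)
Lemma laplace2_termwise (p q P Q : R[i]) (K zz ww : nat -> R[i]) (B1 B2 : R) :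
  0 < Re p -> 0 < Re q -> normc p <= Re P -> normc q <= Re Q ->
  0 <= B1 -> 0 <= B2 ->
  (forall i, K i != 0 -> 0 < Re (zz i) /\ 0 < Re (ww i)) ->
  (forall i, 0 < Re (zz i) -> rgamma (Re (zz i)) <= B1 * normc (Gamma (zz i))) ->
  (forall i, 0 < Re (ww i) -> rgamma (Re (ww i)) <= B2 * normc (Gamma (ww i))) ->
  summableR (fun i => normc (K i) * expR (- Re (zz i) * ln (normc p))
                      * expR (- Re (ww i) * ln (normc q))) ->
  (forall t, Q2 t -> csummable (fun i => K i / (Gamma (zz i) * Gamma (ww i)) *
     (mkernel (zz i) P t.1 * mkernel (ww i) Q t.2))) ->
  cintegral leb2 Q2 (fun t => csum (fun i => K i / (Gamma (zz i) * Gamma (ww i)) *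
     (mkernel (zz i) P t.1 * mkernel (ww i) Q t.2))) =
  csum (fun i => K i * cpow P (- zz i) * cpow Q (- ww i)).
Proof.
move=> p0 q0 pP qQ B10 B20 Kzw zB wB sK st.
have np0 := normc_Re_gt0 p0; have nq0 := normc_Re_gt0 q0.
have P0 : 0 < Re P by apply: lt_le_trans pP.
have Q0 : 0 < Re Q by apply: lt_le_trans qQ.
pose f i (t : R * R) := K i / (Gamma (zz i) * Gamma (ww i)) *
     (mkernel (zz i) P t.1 * mkernel (ww i) Q t.2).
have mQ := measurable_quadrant.
have fi i : cintegrable leb2 Q2 (f i) /\
    cintegral leb2 Q2 (f i) = K i * cpow P (- zz i) * cpow Q (- ww i).
  have [K0|Kn0] := eqVneq (K i) 0.
    have -> : f i = fun t => 0 * (mkernel 1 P t.1 * mkernel 1 Q t.2).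
      by apply/funext => t; rewrite /f K0 !mul0r.
    have r1 : 0 < Re (1 : R[i]) by exact: ltr01.
    have [h1 h2] := quadrant_cproduct (cintegrable_mkernel r1 P0) (cintegrable_mkernel r1 Q0).
    by split; [exact: (cintegrableZ mQ 0 h1)|rewrite (cintegralZ mQ 0 h1) K0 !mul0r].
  have [z0 w0] := Kzw i Kn0.
  have [h1 h2] := quadrant_cproduct (cintegrable_mkernel z0 P0) (cintegrable_mkernel w0 Q0).
  split; first exact: (cintegrableZ mQ _ h1).
  rewrite (cintegralZ mQ _ h1) h2 -!/(mintegral _ _) !mintegralE// !Gamma_eq//.
  by field; rewrite !euler_gamma_neq0.
have nf i : (\int[leb2]_(t in Q2) (normc (f i t))%:E <=
    (B1 * B2 * (normc (K i) * expR (- Re (zz i) * ln (normc p)) * expR (- Re (ww i) * ln (normc q))))%:E)%E.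
  have [K0|Kn0] := eqVneq (K i) 0.
    rewrite integral0_eq ?lee_fin; last by move=> t _; rewrite /f K0 !mul0r Normc.normc0.
    by rewrite K0 Normc.normc0 !mul0r mulr0.
  have [z0 w0] := Kzw i Kn0.
  have [j1 j2] := quadrant_product (integrable_power_exp z0 P0) (integrable_power_exp w0 Q0).
  pose c := normc (K i / (Gamma (zz i) * Gamma (ww i))).
  have -> : (\int[leb2]_(t in Q2) (normc (f i t))%:E =
    (c * (expR (- (Re (zz i) * ln (Re P))) * rgamma (Re (zz i)) *
          (expR (- (Re (ww i) * ln (Re Q))) * rgamma (Re (ww i)))))%:E)%E.
    rewrite -!Rintegral_power_exp// -j2 -RintegralZl// /Rintegral fineK.
      by apply: eq_integral => t _; rewrite /f Normc.normcM -/c Normc.normcM !normc_mkernel.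
    exact: (integrable_fin_num mQ (integrableZl mQ c j1)).
  rewrite lee_fin /c !Normc.normcM Normc.normcV Normc.normcM.
  have nz : 0 < normc (Gamma (zz i)) by rewrite normc_gt0 Gamma_eq// euler_gamma_neq0.
  have nw : 0 < normc (Gamma (ww i)) by rewrite normc_gt0 Gamma_eq// euler_gamma_neq0.
  have gz : rgamma (Re (zz i)) / normc (Gamma (zz i)) <= B1 by rewrite ler_pdivrMr// zB.
  have gw : rgamma (Re (ww i)) / normc (Gamma (ww i)) <= B2 by rewrite ler_pdivrMr// wB.
  have ep : expR (- (Re (zz i) * ln (Re P))) <= expR (- Re (zz i) * ln (normc p)).
    by rewrite ler_expR mulNr lerN2 ler_wpM2l ?(ltW z0)// ler_ln ?posrE.
  have eq : expR (- (Re (ww i) * ln (Re Q))) <= expR (- Re (ww i) * ln (normc q)).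
    by rewrite ler_expR mulNr lerN2 ler_wpM2l ?(ltW w0)// ler_ln ?posrE.
  have gz0 : 0 <= rgamma (Re (zz i)) / normc (Gamma (zz i)) by rewrite divr_ge0 ?rgamma_ge0 ?normc_ge0.
  have gw0 : 0 <= rgamma (Re (ww i)) / normc (Gamma (ww i)) by rewrite divr_ge0 ?rgamma_ge0 ?normc_ge0.
  have h1 := ler_pM gz0 gw0 gz gw.
  have h2 := ler_pM (expR_ge0 _) (expR_ge0 _) ep eq.
  have h3 := ler_pM (mulr_ge0 gz0 gw0) (mulr_ge0 (expR_ge0 _) (expR_ge0 _)) h1 h2.
  have h4 := ler_wpM2l (normc_ge0 (K i)) h3.
  set L := leLHS; set M := leRHS.
  have -> : M = normc (K i) * (B1 * B2 * (expR (- Re (zz i) * ln (normc p)) * expR (- Re (ww i) * ln (normc q)))).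
    by rewrite /M; ring.
  apply: le_trans h4; rewrite le_eqVlt; apply/orP; left; apply/eqP.
  by rewrite /L; field; rewrite !gt_eqF.
have [|||_ _ e] := @termwise_cintegral R _ _ leb2 Q2 mQ f.
- by move=> k; exact: cintegrable_measurable (fi k).1.
- have sB := integrableZl measurableT (B1 * B2) sK.
  have /integrableP[_] := sB; apply: le_lt_trans.
  rewrite ge0_integral_count//; apply: lee_nneseries => k.
    by move=> _ _; apply: integral_ge0 => t _; rewrite lee_fin normc_ge0.
  by move=> _; apply: (le_trans (nf k)); rewrite /= lee_fin ler_norm.
- by move=> t Qt; exact: st.
rewrite e; congr csum; apply/funext => i; exact: (fi i).2.
Qed.

End quadrant_integrals.

(** * Behaviour of a convergent integrand near the axes *)

Section vanishing.
Context {R : realType}.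
Notation leb := (@lebesgue_measure R).
Notation leb2 := (@lebesgue_measure R \x @lebesgue_measure R)%E.
Notation Rpos := (`]0%R, +oo[%classic : set R).
Notation I01 := (`]0%R, 1%R]%classic : set R).
Notation Q2 := (@quadrant R).

(** Fubini's theorem for the modulus, restricted to ]0, 1] in the variable of the slice. *)
Lemma quadrant_slices (F : R * R -> R[i]) : cintegrable leb2 Q2 F ->
  {ae leb, forall y, 0 < y -> leb.-integrable I01 (fun x => (normc (F (x, y)))%:E)} /\
  {ae leb, forall x, 0 < x -> leb.-integrable I01 (fun y => (normc (F (x, y)))%:E)}.
Proof.
move=> iF; have mQ := @measurable_quadrant R.
have /(integrable_mkcond _ mQ) iG := integrable_normc mQ iF.
have mI : measurable (I01 : set (measurableTypeR R)) by exact: measurable_itv.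
split.
- apply: filterS (ae_integrable2 iG) => y iy y0.
  have := integrableS measurableT mI (@subsetT _ _) iy.
  apply: eq_integrable => // x; rewrite inE /= in_itv /= => /andP[x0 _].
  by rewrite patchE mem_set//; apply/quadrantP.
- apply: filterS (ae_integrable1 iG) => x ix x0.
  have := integrableS measurableT mI (@subsetT _ _) ix.
  apply: eq_integrable => // y; rewrite inE /= in_itv /= => /andP[y0 _].
  by rewrite patchE mem_set//; apply/quadrantP.
Qed.

(** For almost every y, the coefficient [C j0 y] of x^(a j0) vanishes by
    [integrable_leading_exponent]. It is a power series in y^b, and such y accumulate at 0,
    so all its coefficients vanish; [inj] says that each of them is a single E i. *)
Lemma slice_vanish (E : nat -> R[i]) (mm nn : nat -> nat) (a b sg : R) :
  0 < a -> 0 < b ->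
  (forall i j, mm i = mm j -> nn i = nn j -> i = j) ->
  (forall x y : R, 0 < x -> 0 < y ->
     csummable (fun i => E i * (((x `^ a) ^+ mm i)%:C * ((y `^ b) ^+ nn i)%:C))) ->
  {ae leb, forall y, 0 < y -> leb.-integrable I01 (fun x => (expR ((sg - 1) * ln x) *
     normc (csum (fun i => E i * (((x `^ a) ^+ mm i)%:C * ((y `^ b) ^+ nn i)%:C))))%:E)} ->
  forall i, sg + a * (mm i)%:R <= 0 -> E i = 0.
Proof.
move=> a0 b0 inj sE slices i0 si0; pose j0 := mm i0.
pose C j y := csum (fun i => if mm i == j then E i * ((y `^ b) ^+ nn i)%:C else 0).
have CE x y : 0 < x -> 0 < y ->
    [/\ forall j, csummable (fun i => if mm i == j then E i * ((y `^ b) ^+ nn i)%:C else 0),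
      csummable (fun j => C j y * ((x `^ a) ^+ j)%:C) &
      csum (fun i => E i * (((x `^ a) ^+ mm i)%:C * ((y `^ b) ^+ nn i)%:C)) =
      csum (fun j => C j y * ((x `^ a) ^+ j)%:C)].
  move=> x0 y0; have [s1 s2 e] := csum_packets mm (sE x y x0 y0).
  have xn j : ((x `^ a) ^+ j)%:C != 0 :> R[i].
    by rewrite -normc_gt0 normc_real normr_gt0 expf_neq0// gt_eqF// powR_gt0.
  have pk j : (fun i => if mm i == j then E i * (((x `^ a) ^+ mm i)%:C * ((y `^ b) ^+ nn i)%:C) else 0)
     = (fun i => ((x `^ a) ^+ j)%:C * (if mm i == j then E i * ((y `^ b) ^+ nn i)%:C else 0)).
    apply/funext => i; case: eqP => [->|_]; last by rewrite mulr0.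
    by rewrite mulrCA.
  have s3 j : csummable (fun i => if mm i == j then E i * ((y `^ b) ^+ nn i)%:C else 0).
    have := s1 j; rewrite (pk j) => /(csummableZ (((x `^ a) ^+ j)%:C)^-1).
    by rewrite (_ : (fun k => _) = (fun i => if mm i == j then E i * ((y `^ b) ^+ nn i)%:C else 0))//;
       apply/funext => i; rewrite mulKf.
  have ej : (fun j => csum (fun i => if mm i == j then
        E i * (((x `^ a) ^+ mm i)%:C * ((y `^ b) ^+ nn i)%:C) else 0)) =
      (fun j => C j y * ((x `^ a) ^+ j)%:C).
    by apply/funext => j; rewrite (pk j) csumZ// mulrC.
  by split=> //; rewrite -ej.
have C0 : {ae leb, forall y, 0 < y -> C j0 y = 0}.
  case: slices => N [mN N0 subN]; exists N; split=> //; apply: subset_trans subN.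
  apply: subsetC => y /= iy y0.
  have sC : csummable (fun j => C j y).
    have [_ + _] := CE 1 y ltr01 y0.
    rewrite (_ : (fun j => _) = (fun j => C j y))//; apply/funext => j.
    by rewrite powR1 expr1n mulr1.
  apply: (integrable_leading_exponent a0 sC _ si0); apply: eq_integrable (iy y0) => //.
  move=> x; rewrite inE => xI.
  have x0 : 0 < x by move: xI; rewrite /= in_itv /= => /andP[].
  have [_ _ e] := CE x y x0 y0.
  exact: (congr1 (fun c => (expR ((sg - 1) * ln x) * normc c)%:E) e).
pose E' i := if mm i == j0 then E i else 0.
pose Dk k := csum (fun i => if nn i == k then E' i else 0).
have DE y : 0 < y -> csummable (fun k => Dk k * ((y `^ b) ^+ k)%:C) /\
    C j0 y = csum (fun k => Dk k * ((y `^ b) ^+ k)%:C).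
  move=> y0; have [s _ _] := CE 1 y ltr01 y0.
  have CEE : (fun i => if mm i == j0 then E i * ((y `^ b) ^+ nn i)%:C else 0) =
      (fun i => E' i * ((y `^ b) ^+ nn i)%:C).
    by apply/funext => i; rewrite /E'; case: ifP => // _; rewrite mul0r.
  have := s j0; rewrite CEE => sj.
  have [s1 s2 e] := csum_packets nn sj.
  have yn k : ((y `^ b) ^+ k)%:C != 0 :> R[i].
    by rewrite -normc_gt0 normc_real normr_gt0 expf_neq0// gt_eqF// powR_gt0.
  have pk k : (fun i => if nn i == k then E' i * ((y `^ b) ^+ nn i)%:C else 0)
     = (fun i => ((y `^ b) ^+ k)%:C * (if nn i == k then E' i else 0)).
    apply/funext => i; case: eqP => [->|_]; last by rewrite mulr0.
    by rewrite mulrC.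
  have s3 k : csummable (fun i => if nn i == k then E' i else 0).
    have := s1 k; rewrite (pk k) => /(csummableZ (((y `^ b) ^+ k)%:C)^-1).
    by rewrite (_ : (fun k => _) = (fun i => if nn i == k then E' i else 0))//;
       apply/funext => i; rewrite mulKf.
  have ek : (fun k => csum (fun i => if nn i == k then E' i * ((y `^ b) ^+ nn i)%:C else 0)) =
      (fun k => Dk k * ((y `^ b) ^+ k)%:C).
    by apply/funext => k; rewrite (pk k) csumZ// mulrC.
  by rewrite -ek; split=> //; rewrite /C CEE.
have sD : csummable Dk.
  have [+ _] := DE 1 ltr01.
  rewrite (_ : (fun j => _) = Dk)//; apply/funext => j.
  by rewrite powR1 expr1n mulr1.
have D0 : forall k, Dk k = 0.
  apply: identity_theorem sD _ => e e0.
  pose de := Num.min 1 (expR (ln e / b)).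
  have de0 : 0 < de by rewrite lt_min ltr01 expR_gt0.
  have [y [y0 yd Cy]] : exists y, [/\ 0 < y, y < de & C j0 y = 0].
    apply: contrapT => no; have [N [mN N0 subN]] := C0.
    have sub y : ~ (0 < y -> C j0 y = 0) -> N y by exact: subN.
    have : (leb `]0%R, de[%classic <= leb N)%E.
      apply: le_measure; rewrite ?inE//.
      move=> y; rewrite /= in_itv /= => /andP[y0 yd]; apply: sub => /(_ y0) Cy.
      by apply: no; exists y.
    by rewrite N0 lebesgue_measure_itv /= lte_fin de0 oppr0 adde0 lee_fin leNgt de0.
  exists (y `^ b); split.
  - exact: powR_gt0.
  - rewrite /powR gt_eqF// -[X in _ < X]lnK ?posrE// ltr_expR mulrC -ltr_pdivlMr//.
    rewrite -ltr_expR lnK ?posrE//; apply: (lt_le_trans yd).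
    by rewrite ge_min lexx orbT.
  - rewrite /powR gt_eqF// -expR0 ler_expR pmulr_rle0// ln_le0//.
    by apply: (le_trans (ltW yd)); rewrite ge_min lexx.
  - by rewrite -Cy; have [_ ->] := DE y y0.
rewrite -(D0 (nn i0)) -[LHS](csum_single (E i0) i0).2; congr csum; apply/funext => i.
rewrite /E' /j0; case: eqP => [->|ne]; first by rewrite !eqxx.
case: eqP => // ni; case: eqP => // mi.
by case: ne; apply: inj.
Qed.

End vanishing.

(** * Laplace transform of a double series *)

Section laplace_double_series.
Context {R : realType}.
Notation leb := (@lebesgue_measure R).
Notation leb2 := (@lebesgue_measure R \x @lebesgue_measure R)%E.
Notation I01 := (`]0%R, 1%R]%classic : set R).
Notation Q2 := (@quadrant R).
Variables (c : nat -> nat -> R[i]) (d1 d2 p q : R[i]) (a b : R).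
Hypotheses (a0 : 0 < a) (b0 : 0 < b) (p0 : 0 < Re p) (q0 : 0 < Re q).

Let zeta m : R[i] := d1 + (a * m%:R)%:C.
Let omega n : R[i] := d2 + (b * n%:R)%:C.

Definition original_term (x y : R) (m n : nat) : R[i] :=
  c m n / (Gamma (d1 + (a * m%:R)%:C) * Gamma (d2 + (b * n%:R)%:C))
  * ((x `^ a)%:C ^+ m * (y `^ b)%:C ^+ n).

Definition image_term (m n : nat) : R[i] :=
  c m n * ((1 / cpow p a%:C) ^+ m * (1 / cpow q b%:C) ^+ n).

Definition original (x y : R) : R[i] :=
  cpow x%:C (d1 - 1) * cpow y%:C (d2 - 1) * csum2 (original_term x y).

Hypothesis zeta_pole : forall m, ~ gamma_pole (d1 + (a * m%:R)%:C).
Hypothesis omega_pole : forall n, ~ gamma_pole (d2 + (b * n%:R)%:C).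
Hypothesis original_conv :
  forall x y : R, 0 < x -> 0 < y -> abs_convergent2 (original_term x y).
Hypothesis image_conv : abs_convergent2 image_term.
Hypothesis laplace_conv : laplace2_exists original p q.

Let mkernel_shift (z P : R[i]) (al x : R) (m : nat) : 0 < x ->
  mkernel (z + (al * m%:R)%:C) P x = mkernel z P x * (((x `^ al) ^+ m)%:C).
Proof.
move=> x0; rewrite /powR gt_eqF// -expRM_natl -cexp_real -cexpD; congr cexp.
by rewrite !rmorphM /= rmorph_nat; ring.
Qed.

Let Re_zeta m : Re (zeta m) = Re d1 + a * m%:R. Proof. by rewrite cReD. Qed.
Let Im_zeta m : Im (zeta m) = Im d1. Proof. by rewrite cImD /= addr0. Qed.
Let Re_omega n : Re (omega n) = Re d2 + b * n%:R. Proof. by rewrite cReD. Qed.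
Let Im_omega n : Im (omega n) = Im d2. Proof. by rewrite cImD /= addr0. Qed.

(** A weight bounded above and below on ]0, 1] does not affect integrability. *)
Let integrable_unweight (g h : R -> R) (s k : R) : 0 <= s -> 0 < k ->
  leb.-integrable I01 (EFin \o g) -> (forall x, 0 < x -> 0 <= h x) ->
  (forall x, 0 < x -> g x = expR (- s * x) * k * h x) ->
  leb.-integrable I01 (EFin \o h).
Proof.
move=> s0 k0 ig h0 gE; have mI : measurable (I01 : set (measurableTypeR R)) by exact: measurable_itv.
have hE x : 0 < x -> h x = expR (s * x) * (k^-1 * g x).
  move=> x0; rewrite gE// mulNr expRN; field.
  by rewrite !gt_eqF ?expR_gt0.
have mg : measurable_fun (I01 : set (measurableTypeR R)) g.
  by apply/measurable_EFinP; exact: (measurable_int leb ig).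
have mh : measurable_fun (I01 : set (measurableTypeR R)) h.
  have me : measurable_fun (I01 : set (measurableTypeR R)) (fun x : R => expR (s * x)).
    apply: (measurableT_comp (@measurable_expR R)).
    by apply: measurable_funM; [exact: measurable_cst|exact: measurable_id].
  have mk : measurable_fun (I01 : set (measurableTypeR R)) (fun x : R => k^-1 * g x).
    by apply: measurable_funM; [exact: measurable_cst|].
  apply: eq_measurable_fun (measurable_funM me mk) => x; rewrite inE /= in_itv /= => /andP[x0 _].
  by rewrite -hE.
have ik := integrableZl mI (expR s * k^-1) ig.
apply: (le_integrable mI _ _ ik); first exact/measurable_EFinP.
move=> x /=; rewrite in_itv /= => /andP[x0 x1]; rewrite lee_fin (ger0_norm (h0 x x0)).
apply: le_trans (ler_norm _); rewrite hE// -mulrA ler_wpM2r//.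
  by rewrite gE// mulrA mulr_ge0 ?h0// mulr_ge0 ?invr_ge0 ?(ltW k0)// mulr_ge0 ?expR_ge0// ltW.
by rewrite ler_expR ler_piMr.
Qed.

Section enumerated.
Variable e : nat -> nat * nat.
Hypothesis e_bij : set_bij setT setT e.

Let zz i := zeta (e i).1.
Let ww i := omega (e i).2.
Let K i := c (e i).1 (e i).2.
Let E i := K i / (Gamma (zz i) * Gamma (ww i)).
Let G := laplace2_kernel original p q.
Let mQ := @measurable_quadrant R.

Let original_sum (x y : R) : 0 < x -> 0 < y ->
  csummable (fun i => E i * (((x `^ a) ^+ (e i).1)%:C * ((y `^ b) ^+ (e i).2)%:C)) /\
  csum2 (original_term x y) =
  csum (fun i => E i * (((x `^ a) ^+ (e i).1)%:C * ((y `^ b) ^+ (e i).2)%:C)).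
Proof.
move=> x0 y0; have := csum2_enum e_bij (original_conv x0 y0).
rewrite (_ : (fun k => original_term x y (e k).1 (e k).2) =
  (fun i => E i * (((x `^ a) ^+ (e i).1)%:C * ((y `^ b) ^+ (e i).2)%:C)))//.
by apply/funext => i; rewrite !rmorphXn.
Qed.

Let kernel_sum (P Q : R[i]) (t : R * R) : Q2 t ->
  csummable (fun i => E i * (mkernel (zz i) P t.1 * mkernel (ww i) Q t.2)) /\
  laplace2_kernel original P Q t =
  csum (fun i => E i * (mkernel (zz i) P t.1 * mkernel (ww i) Q t.2)).
Proof.
case: t => x y /quadrantP[/= x0 y0]; have [s ss] := original_sum x0 y0.
have -> : (fun i => E i * (mkernel (zz i) P x * mkernel (ww i) Q y)) =
    (fun i => mkernel d1 P x * mkernel d2 Q y *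
       (E i * (((x `^ a) ^+ (e i).1)%:C * ((y `^ b) ^+ (e i).2)%:C))).
  by apply/funext => i; rewrite /zz /ww !mkernel_shift//; ring.
split; first exact: csummableZ.
rewrite csumZ// -ss /laplace2_kernel /original /= mulrAC; congr (_ * _).
rewrite /cpow !clog_real// -!cexpD; congr cexp; ring.
Qed.

Let normc_kernel (x y : R) : 0 < x -> 0 < y -> normc (G (x, y)) =
  expR ((Re d1 - 1) * ln x - Re p * x) * expR ((Re d2 - 1) * ln y - Re q * y)
  * normc (csum2 (original_term x y)).
Proof.
move=> x0 y0; have -> : G (x, y) = mkernel d1 p x * mkernel d2 q y * csum2 (original_term x y).
  rewrite /G /laplace2_kernel /original /= mulrAC; congr (_ * _).
  rewrite /cpow !clog_real// -!cexpD; congr cexp; ring.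
by rewrite !Normc.normcM !normc_mkernel.
Qed.

(** The integrand is integrable near each axis, so [slice_vanish] applies in x and, with
    the roles exchanged, in y; E and K vanish together because Gamma has no zero. *)
Let positive_exponents i : K i != 0 -> 0 < Re (zz i) /\ 0 < Re (ww i).
Proof.
move=> Kn0; have [sl1 sl2] := quadrant_slices laplace_conv.
have inj1 j k : (e j).1 = (e k).1 -> (e j).2 = (e k).2 -> j = k.
  move=> h1 h2; have [_ e_inj _] := e_bij; apply: e_inj; rewrite ?inE//.
  by move: h1 h2; case: (e j) => ? ?; case: (e k) => ? ? /= -> ->.
have En0 : E i != 0.
  have g1 : Gamma (zz i) != 0 := Gamma_neq0 (@zeta_pole _).
  have g2 : Gamma (ww i) != 0 := Gamma_neq0 (@omega_pole _).
  by rewrite mulf_neq0// invr_neq0// mulf_neq0.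
split; rewrite ltNge; apply/negP => le0.
- move: En0; rewrite (_ : E i = 0) ?eqxx//.
  apply: (@slice_vanish R E (fun i => (e i).1) (fun i => (e i).2) a b (Re d1)) => //.
  + by move=> x y x0 y0; have [] := original_sum x0 y0.
  + case: sl1 => N [mN N0 subN]; exists N; split=> //; apply: subset_trans subN.
    apply: subsetC => y /= iy y0.
    apply: (@integrable_unweight (fun x => normc (G (x, y)))
      (fun x => expR ((Re d1 - 1) * ln x) * normc (csum (fun i => E i *
        (((x `^ a) ^+ (e i).1)%:C * ((y `^ b) ^+ (e i).2)%:C))))
      (Re p) (expR ((Re d2 - 1) * ln y - Re q * y))) => //.
    * exact: ltW.
    * exact: expR_gt0.
    * exact: iy.
    * by move=> x _; rewrite mulr_ge0 ?expR_ge0 ?normc_ge0.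
    * move=> x x0; have [_ <-] := original_sum x0 y0.
      by rewrite normc_kernel// expRD mulNr; ring.
  + by rewrite -Re_zeta.
- move: En0; rewrite (_ : E i = 0) ?eqxx//.
  apply: (@slice_vanish R E (fun i => (e i).2) (fun i => (e i).1) b a (Re d2)) => //.
  + by move=> j k h1 h2; exact: inj1.
  + move=> y x y0 x0; have [+ _] := original_sum x0 y0.
    rewrite (_ : (fun i => _) = (fun i => E i * (((y `^ b) ^+ (e i).2)%:C * ((x `^ a) ^+ (e i).1)%:C)))//.
    by apply/funext => k; congr (_ * _); exact: mulrC.
  + case: sl2 => N [mN N0 subN]; exists N; split=> //; apply: subset_trans subN.
    apply: subsetC => x /= ix x0.
    apply: (@integrable_unweight (fun y => normc (G (x, y)))
      (fun y => expR ((Re d2 - 1) * ln y) * normc (csum (fun i => E i *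
        (((y `^ b) ^+ (e i).2)%:C * ((x `^ a) ^+ (e i).1)%:C))))
      (Re q) (expR ((Re d1 - 1) * ln x - Re p * x))) => //.
    * exact: ltW.
    * exact: expR_gt0.
    * exact: ix.
    * by move=> y _; rewrite mulr_ge0 ?expR_ge0 ?normc_ge0.
    * move=> y y0; have [_ ss] := original_sum x0 y0.
      rewrite normc_kernel// ss.
      have -> : (fun i => E i * (((y `^ b) ^+ (e i).2)%:C * ((x `^ a) ^+ (e i).1)%:C)) =
          (fun i => E i * (((x `^ a) ^+ (e i).1)%:C * ((y `^ b) ^+ (e i).2)%:C)).
        by apply/funext => k; congr (_ * _); exact: mulrC.
      by rewrite [expR (_ * ln y - _)]expRD mulNr; ring.
  + by rewrite -Re_omega.
Qed.

Let image_sum :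
  csummable (fun i => K i * cpow p (- zz i) * cpow q (- ww i)) /\ (cpow p d1 * cpow q d2)^-1 * csum2 image_term =
  csum (fun i => K i * cpow p (- zz i) * cpow q (- ww i)).
Proof.
have [s ss] := csum2_enum e_bij image_conv.
have -> : (fun i => K i * cpow p (- zz i) * cpow q (- ww i)) =
    (fun i => (cpow p d1 * cpow q d2)^-1 * image_term (e i).1 (e i).2).
  apply/funext => i; rewrite /image_term /K /zz /ww /zeta /omega.
  have pw (r : R[i]) (al : R) (d : R[i]) n : cpow r (- (d + (al * n%:R)%:C)) =
      (cpow r d)^-1 * (1 / cpow r al%:C) ^+ n.
    rewrite opprD cpowD cpowN cpowN rmorphM /= rmorph_nat mulrC [al%:C * _]mulrC cpowX.
    by rewrite div1r exprVn mulrC.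
  by rewrite !pw invfM; ring.
by split; [exact: csummableZ|rewrite csumZ// ss].
Qed.

(** |p^(-z)| and |p|^(-Re z) differ by a factor that depends only on Im z = Im d1. *)
Let summable_image : summableR (fun i => normc (K i) * expR (- Re (zz i) * ln (normc p))
  * expR (- Re (ww i) * ln (normc q))).
Proof.
have [s _] := image_sum.
pose C := expR (Im d1 * carg p) * expR (Im d2 * carg q).
have C0 : 0 < C by rewrite mulr_gt0 ?expR_gt0.
apply: eq_integrable (integrableZl measurableT C^-1 s) => // i _ /=.
congr EFin; rewrite !Normc.normcM !normc_cpow !cReN !cImN /zz /ww Im_zeta Im_omega.
rewrite !mulNr !opprK !expRD -/C /C; field.
by rewrite !gt_eqF ?expR_gt0.
Qed.

Let normc_cpow_re (r z : R[i]) : 0 < Re r ->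
  normc (cpow r (- z)) <= expR (`|Im z| * (pi / 2)) * expR (- Re z * ln (normc r)).
Proof. by move=> r0; have := normc_cpow_le (- z) r0; rewrite cImN cReN normrN. Qed.

(** Damping the kernel by e^(-sx-ty) replaces p, q by p + s, q + t. *)
Let identity_far (s t : R) : normc p <= s -> normc q <= t ->
  cintegral leb2 Q2 (fun u => G u * (expR (- (t * u.2)))%:C * (expR (- (s * u.1)))%:C) =
  csum (fun i => K i * cpow (p + s%:C) (- zz i) * cpow (q + t%:C) (- ww i)).
Proof.
move=> ps qt.
have [B1 B10 hB1] := @rgamma_le_Gamma R d1 a a0.
have [B2 B20 hB2] := @rgamma_le_Gamma R d2 b b0.
have h := @laplace2_termwise R p q (p + s%:C) (q + t%:C) K zz ww B1 B2 p0 q0.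
rewrite -h //.
- apply: eq_cintegral => u; rewrite inE => Qu.
  have [_ <-] := kernel_sum (p + s%:C) (q + t%:C) Qu.
  rewrite /G /laplace2_kernel -[LHS]mulrA -[LHS]mulrA; congr (_ * _).
  by rewrite -!cexp_real -!cexpD; congr cexp; rewrite !rmorphN !rmorphM /=; ring.
- by rewrite cReD /= (le_trans ps)// lerDr ltW.
- by rewrite cReD /= (le_trans qt)// lerDr ltW.
- by move=> i; exact: hB1.
- by move=> i; exact: hB2.
- by move=> u Qu; have [] := kernel_sum (p + s%:C) (q + t%:C) Qu.
Qed.

Let Q2_gt0 (u : R * R) : Q2 u -> 0 <= u.1 /\ 0 <= u.2.
Proof. by move=> /quadrantP[/ltW ? /ltW]. Qed.

Let mfst : measurable_fun (Q2 : set (measurableTypeR R * measurableTypeR R)) (fun u => u.1).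
Proof. exact: (measurable_funS measurableT (@subsetT _ _) measurable_fst). Qed.

Let msnd : measurable_fun (Q2 : set (measurableTypeR R * measurableTypeR R)) (fun u => u.2).
Proof. exact: (measurable_funS measurableT (@subsetT _ _) measurable_snd). Qed.

Let cintegrable_damped (t : R) : 0 <= t ->
  cintegrable leb2 Q2 (fun u => G u * (expR (- (t * u.2)))%:C).
Proof.
move=> t0; apply: (cintegrable_le mQ _ (integrable_normc mQ laplace_conv)).
  apply: cmeasurableM; first exact: (cintegrable_measurable laplace_conv).
  apply: cmeasurable_real; apply: (measurableT_comp (@measurable_expR R)).
  apply: measurableT_comp => //; apply: measurable_funM => //; exact: measurable_cst.
move=> u /Q2_gt0[_ u2]; rewrite Normc.normcM normc_real (ger0_norm (expR_ge0 _)).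
by rewrite ler_piMr ?normc_ge0// -expR0 ler_expR oppr_le0 mulr_ge0.
Qed.

(** Descent in the first variable, with the second one still shifted. *)
Let identity_half (t : R) : normc q <= t ->
  cintegral leb2 Q2 (fun u => G u * (expR (- (t * u.2)))%:C) =
  csum (fun i => K i * cpow p (- zz i) * cpow (q + t%:C) (- ww i)).
Proof.
move=> qt; have t0 : 0 <= t by apply: le_trans qt; exact: normc_ge0.
have swap P : (fun i => K i * cpow P (- zz i) * cpow (q + t%:C) (- ww i)) =
    (fun i => K i * cpow (q + t%:C) (- ww i) * cpow P (- zz i)).
  by apply/funext => i; rewrite mulrAC.
rewrite swap.
apply: (@laplace_descent R _ _ leb2 Q2 _ (fun u => u.1) p
  (fun i => K i * cpow (q + t%:C) (- ww i)) zz (Im d1) (normc p)) => //.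
- exact: cintegrable_damped.
- by move=> u /Q2_gt0[].
- by move=> i; exact: Im_zeta.
- by move=> i; rewrite mulf_eq0 negb_or => /andP[/positive_exponents[]].
- pose C := expR (`|Im d2| * (pi / 2)).
  apply: (summableR_le _ (integrableZl measurableT C summable_image)) => i /=.
  rewrite ger0_norm ?mulr_ge0 ?normc_ge0 ?expR_ge0//.
  have [->|Kn0] := eqVneq (K i) 0; first by rewrite mul0r Normc.normc0 !mul0r mulr0.
  have [_ w0] := positive_exponents Kn0.
  have := normc_cpow_shift_le q0 w0 t0; rewrite {2}/ww Im_omega -/C => le.
  rewrite Normc.normcM [leLHS]mulrAC [leRHS]mulrCA.
  by rewrite ler_wpM2l// mulr_ge0 ?normc_ge0 ?expR_ge0.
- by move=> s ps; rewrite identity_far// swap.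
Qed.

(** Descent in the second variable. *)
Lemma laplace2_original_enum :
  laplace2 original p q = (cpow p d1 * cpow q d2)^-1 * csum2 image_term.
Proof.
have [_ ->] := image_sum.
apply: (@laplace_descent R _ _ leb2 Q2 _ (fun u => u.2) q
  (fun i => K i * cpow p (- zz i)) ww (Im d2) (normc q)) => //.
- by move=> u /Q2_gt0[].
- by move=> i; exact: Im_omega.
- by move=> i; rewrite mulf_eq0 negb_or => /andP[/positive_exponents[]].
- pose C := expR (`|Im d1| * (pi / 2)).
  apply: (summableR_le _ (integrableZl measurableT C summable_image)) => i /=.
  rewrite ger0_norm ?mulr_ge0 ?normc_ge0 ?expR_ge0//.
  rewrite Normc.normcM; have := normc_cpow_re (zz i) p0; rewrite {2}/zz Im_zeta -/C => le.
  rewrite mulrA ler_wpM2r ?expR_ge0// [leRHS]mulrCA.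
  by rewrite ler_wpM2l ?normc_ge0.
Qed.

End enumerated.

Theorem laplace2_original :
  laplace2 original p q = (cpow p d1 * cpow q d2)^-1 * csum2 image_term.
Proof. by have [e e_bij] := nat_pair_enum; exact: laplace2_original_enum e_bij. Qed.

End laplace_double_series.

Theorem mainTheorem15 (R : realType)
    (g1 g2 g3 d1 d2 d3 d4 : R[i])
    (a1 a2 a3 a4 b1 b2 b3 b4 : R)
    (p q : R[i])
    (ha1 : 0 < a1) (ha2 : 0 < a2) (ha3 : 0 < a3) (ha4 : 0 < a4)
    (hb1 : 0 < b1) (hb2 : 0 < b2) (hb3 : 0 < b3) (hb4 : 0 < b4)
    (hp : 0 < complex.Re p) (hq : 0 < complex.Re q)
    (* the Gamma factors of D2 attached to d1 and d2 are defined *)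
    (hd1 : forall m : nat, ~ gamma_pole (d1 + (a3 * m%:R)%:C))
    (hd2 : forall n : nat, ~ gamma_pole (d2 + (b3 * n%:R)%:C))
    (* both sides are taken in the region of absolute convergence *)
    (hD2 : forall x y : R, 0 < x -> 0 < y ->
       abs_convergent2 (D2_term g1 a1 b1 g2 a2 g3 b2 d1 a3 d2 b3 d3 a4 d4 b4
                          (x `^ a3)%:C (y `^ b3)%:C))
    (hE11 : abs_convergent2 (E11_term g1 a1 b1 g2 a2 g3 b2 d3 a4 d4 b4
                               (1 / cpow p a3%:C) (1 / cpow q b3%:C)))
    (* the Laplace integral exists *)
    (hL : laplace2_exists
       (fun x y : R => cpow x%:C (d1 - 1) * cpow y%:C (d2 - 1) *
          D2 g1 a1 b1 g2 a2 g3 b2 d1 a3 d2 b3 d3 a4 d4 b4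
             (x `^ a3)%:C (y `^ b3)%:C) p q) :
  laplace2
    (fun x y : R => cpow x%:C (d1 - 1) * cpow y%:C (d2 - 1) *
       D2 g1 a1 b1 g2 a2 g3 b2 d1 a3 d2 b3 d3 a4 d4 b4
          (x `^ a3)%:C (y `^ b3)%:C) p q
  = 1 / (cpow p d1 * cpow q d2) *
    E11 g1 a1 b1 g2 a2 g3 b2 d3 a4 d4 b4
        (1 / cpow p a3%:C) (1 / cpow q b3%:C).
Proof.
pose c m n := pochhammer g1 (a1 * m%:R + b1 * n%:R) * pochhammer g2 (a2 * m%:R)
  * pochhammer g3 (b2 * n%:R)
  / (Gamma (d3 + (a4 * m%:R)%:C) * Gamma (d4 + (b4 * n%:R)%:C)).
have DE (x y : R) : D2_term g1 a1 b1 g2 a2 g3 b2 d1 a3 d2 b3 d3 a4 d4 b4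
    (x `^ a3)%:C (y `^ b3)%:C = original_term c d1 d2 a3 b3 x y.
  apply/funext => m; apply/funext => n.
  by rewrite /D2_term /original_term /c !invfM; ring.
have EE : E11_term g1 a1 b1 g2 a2 g3 b2 d3 a4 d4 b4
    (1 / cpow p a3%:C) (1 / cpow q b3%:C) = image_term c p q a3 b3.
  apply/funext => m; apply/funext => n.
  by rewrite /E11_term /image_term /c !invfM; ring.
have FE : (fun x y : R => cpow x%:C (d1 - 1) * cpow y%:C (d2 - 1) *
    D2 g1 a1 b1 g2 a2 g3 b2 d1 a3 d2 b3 d3 a4 d4 b4 (x `^ a3)%:C (y `^ b3)%:C) =
    original c d1 d2 a3 b3.
  by apply/funext => x; apply/funext => y; rewrite /D2 DE.
rewrite FE in hL *; rewrite /E11 EE in hE11 *.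
have hD (x y : R) : 0 < x -> 0 < y -> abs_convergent2 (original_term c d1 d2 a3 b3 x y).
  by move=> x0 y0; rewrite -DE; exact: hD2.
rewrite (laplace2_original ha3 hb3 hp hq hd1 hd2 hD hE11 hL).
by rewrite div1r.
Qed.
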